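(* Let $d,N\in\mathbb{N}$, $n\in\mathbb{N}$ with $n\ge2$, and $\nu>0$. Let $\lambda_0,\dots,\lambda_N\in\mathbb{R}$ satisfy $\sum_{k=0}^N\lambda_kx^k=\prod_{j=1}^M(x-\eta_j)^{m_j}$ for some pairwise distinct $\eta_1,\dots,\eta_M\in\mathbb{C}\setminus\{0\}$ and positive integers $m_1,\dots,m_M$. Let $f_0,\dots,f_{\lceil N\nu/n\rceil-1}:\mathbb{R}^d\to\mathbb{R}$ be given. Then the solution $F_{\nu/n}$ of the problem $$\sum_{k=0}^N\lambda_k\frac{\partial^{\nu k/n}}{\partial t^{\nu k/n}}F(t,x)=0,\quad t\ge0,\ x\in\mathbb{R}^d,\qquad \frac{\partial^lF}{\partial t^l}\Big|_{t=0}=f_l(x),\quad l=0,\dots,\Bigl\lceil\tfrac{N\nu}{n}\Bigr\rceil-1,$$ can be expressed as $$F_{\nu/n}(t,x)=\mathbb{E}\,F_\nu\Bigl(\prod_{j=1}^{n-1}G_j^{(n)}(t),\,x\Bigr),$$ where $G_1^{(n)}(t),\dots,G_{n-1}^{(n)}(t)$ are independent random variables with the laws described in the context, and $F_\nu$ is the solution of the problem $$\sum_{k=0}^N\lambda_k\frac{\partial^{\nu k}}{\partial t^{\nu k}}F(t,x)=0,\quad t\ge0,\ x\in\mathbb{R}^d,\qquad \frac{\partial^lF}{\partial t^l}\Big|_{t=0}=\begin{cases}f_h, & l=hn\ \text{with } h=0,\dots,\lceil N\nu/n\rceil-1,\\ 0, & \text{otherwise},\end{cases}\quad l=0,\dots,\lceil\nu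 N\rceil-1.$$
   Context: Fractional derivatives are Dzherbashyan-Caputo derivatives in $t$: for $m\in\mathbb{N}$ and $m-1<\alpha<m$, $\frac{d^\alpha}{dt^\alpha}f(t)=\frac{1}{\Gamma(m-\alpha)}\int_0^t(t-s)^{m-\alpha-1}\frac{d^m}{ds^m}f(s)\,ds$, and for $\alpha=m\in\mathbb{N}_0$ it is the ordinary derivative of order $m$. Functions are considered in the class for which the $t$-Laplace transform exists and $\lim_{t\to\infty}e^{-\mu t}\frac{\partial^{l-1}}{\partial t^{l-1}}F(t,x)=0$ for all $l\ge1$ and suitable $\mu>0$. For $t>0$, $n\ge2$ and $j=1,\dots,n-1$, $G_j^{(n)}(t)$ is the positive absolutely continuous random variable with density $$P\{G_j^{(n)}(t)\in dy\}=\frac{y^{j-1}}{n^{\frac{j}{n-1}-1}\,t^{\frac{j}{n(n-1)}}\,\Gamma(j/n)}\,e^{-\frac{y^n}{(n^nt)^{1/(n-1)}}}\,dy,\qquad y>0.$$ (For $n=2$, $G_1^{(2)}(t)$ has the law of $|B(2t)|$ with $B$ a standard Brownian motion.) *)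

(* Defs.v *)
From HB Require Import structures.
From mathcomp Require Import all_boot all_order all_algebra.
From mathcomp Require Import all_classical all_reals all_analysis.
From mathcomp Require Import complex.

Set Implicit Arguments.
Unset Strict Implicit.
Unset Printing Implicit Defensive.

Import Order.TTheory GRing.Theory Num.Theory.
Import numFieldNormedType.Exports.
Local Open Scope classical_set_scope.
Local Open Scope ring_scope.

Section FracDefs.
Context {R : realType}.

Definition ceiln (x : R) : nat := `|Num.ceil x|%N.

Definition Gamma (a : R) : R :=
  \int[lebesgue_measure]_(s in `]0%R, +oo[%classic) (s `^ (a - 1) * expR (- s)).

Definition caputo_integrand (a : R) (f : R -> R) (t : R) : R -> R :=
  fun s => (t - s) `^ ((ceiln a)%:R - a - 1) * derive1n (ceiln a) f s.

Definition caputo (a : R) (f : R -> R) (t : R) : R :=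
  if a \is a Num.nat then derive1n (Num.truncn a) f t
  else (Gamma ((ceiln a)%:R - a))^-1 *
       \int[lebesgue_measure]_(s in `]0, t[%classic) caputo_integrand a f t s.

(* The Caputo derivative of order a of f exists at t (for non-integer a:
   the defining integral is a Lebesgue integral of an integrable function;
   for integer a, differentiability is provided by the function class). *)
Definition caputo_exists (a : R) (f : R -> R) (t : R) : Prop :=
  if a \is a Num.nat then True
  else lebesgue_measure.-integrable `]0, t[%classic
         (fun s => (caputo_integrand a f t s)%:E).

(* The function class of the paper: for each x, F(., x) is infinitely
   differentiable in t on (0, +oo), its t-Laplace transform exists, and
   e^(-mu t) d^(l-1)/dt^(l-1) F(t, x) -> 0 as t -> +oo for all l >= 1,
   for a suitable mu > 0. *)
Definition LT_class (d : nat) (F : R -> 'rV[R]_d -> R) : Prop :=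
  forall x : 'rV[R]_d, exists mu : R, 0 < mu /\
    (forall (l : nat) (t : R), 0 < t -> derivable (derive1n l (F^~ x)) t 1) /\
    lebesgue_measure.-integrable `]0%R, +oo[%classic
        (fun t => (expR (- (mu * t)) * F t x)%:E) /\
    (forall l : nat,
        (expR (- (mu * t)) * derive1n l (F^~ x) t) @[t --> +oo%R] --> 0).

Definition solves_caputo (d : nat) (alpha : R) (N : nat) (lambda : nat -> R)
    (init : nat -> 'rV[R]_d -> R) (F : R -> 'rV[R]_d -> R) : Prop :=
  [/\ LT_class F,
      (forall (t : R) (x : 'rV[R]_d), 0 < t ->
         (forall k : nat, (k <= N)%N -> caputo_exists (alpha * k%:R) (F^~ x) t) /\
         \sum_(k < N.+1) lambda k * caputo (alpha * k%:R) (F^~ x) t = 0) &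
      (forall (l : nat) (x : 'rV[R]_d), (l < ceiln (N%:R * alpha))%N ->
         derive1n l (F^~ x) s @[s --> (0 : R)^'+] --> init l x)].

Definition G_density (n j : nat) (t y : R) : R :=
  if 0 < y then
    y ^+ j.-1 /
      ((n%:R) `^ (j%:R / (n.-1)%:R - 1) * t `^ (j%:R / (n * n.-1)%:R)
         * Gamma (j%:R / n%:R))
    * expR (- (y ^+ n / ((n%:R ^+ n * t) `^ (1 / (n.-1)%:R))))
  else 0.

Definition mutually_independent (dT : measure_display) (T : measurableType dT)
    (P : probability T R) (m : nat) (X : 'I_m -> T -> R) : Prop :=
  forall B : 'I_m -> set R, (forall i, measurable (B i)) ->
    P (\bigcap_(i in [set: 'I_m]) (X i @^-1` B i)) =
    (\prod_(i < m) P (X i @^-1` B i))%E.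

End FracDefs.

(* Main.v *)
(** Let [Y] be the product of the [G_j] divided by [t^(1/n)].  By independence and Gauss'
    multiplication formula [E Y^k = k! / Gamma (1 + k/n)], and these moments do not involve [t].
    For [s > 0] and [sigma = s^(1/n)], Tonelli turns the Laplace transform of
    [t |-> E F (t^(1/n) Y)] into the integral of [F] against a kernel [k_s], whose moments are
    those of [s^(1/n - 1) e^(- sigma u)]; for [sigma >= 4] these moments grow slowly enough to
    determine the kernel, hence
      [L (E F (t^(1/n) Y)) (s) = s^(1/n - 1) (L F) (s^(1/n))].
    Taking Laplace transforms of the two Caputo problems, the function [E F_nu (t^(1/n) Y)]
    and [F_(nu/n)] have the same transform wherever the characteristic polynomial does not
    vanish at [s^(nu/n)], that is, for all large [s], and Laplace transforms of continuous
    functions are injective. *)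

Require Import Defs.
From HB Require Import structures.
From mathcomp Require Import all_boot all_order all_algebra.
From mathcomp Require Import all_classical all_reals all_analysis measurable_realfun.
From mathcomp Require Import complex ring lra.

Import Order.TTheory GRing.Theory Num.Theory.
Import numFieldNormedType.Exports.
Local Open Scope classical_set_scope.
Local Open Scope ring_scope.

Set Implicit Arguments.
Unset Strict Implicit.
Unset Printing Implicit Defensive.

(** * Integrals over the half-line *)

(** The variables G_j are given at a single time t, while a Laplace transform sees all times.
    Dividing by t^(1/n) removes t from the moments, so u^(1/n) Y can stand in at every other time u.
    The law of Y is never identified: only its integer moments enter, which is why the kernel has to
    be recovered from a moment problem. Restricting to sigma >= 4 costs nothing, because injectivity
    is used in a form that samples the transforms only at s0, s0 + 1, s0 + 2, ...; the slack makes
    e^(2u) integrable against the kernel, and the termwise expansion of e^(-u) consumes exactly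
    that. The same kernel identity, applied to e^(mu), yields the exponential moments of Y that make
    E F finite for F of exponential order. A second obstacle is that the function class provides the
    transform of F but not of its derivatives. Those of low order are controlled near 0 by the
    initial values, the derivative inside a Caputo integral by the existence of that integral, and
    an integer top order by the equation itself. *)

Section real_integrable.
Context d (T : measurableType d) (R : realType).
Variables (mu : {measure set T -> \bar R}) (D : set T).
Hypothesis mD : measurable D.
Implicit Types f g : T -> R.

Lemma integrable_mulrl (k : R) f : mu.-integrable D (EFin \o f) ->
  mu.-integrable D (fun x => (k * f x)%:E).
Proof.
by move=> /(integrableZl mD k); apply: eq_integrable => // x _; rewrite /= EFinM.
Qed.

Lemma integrable_addr f g : mu.-integrable D (EFin \o f) ->
  mu.-integrable D (EFin \o g) -> mu.-integrable D (fun x => (f x + g x)%:E).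
Proof.
move=> /integrableD h /h-/(_ mD); exact: eq_integrable.
Qed.

Lemma integrable_subr f g : mu.-integrable D (EFin \o f) ->
  mu.-integrable D (EFin \o g) -> mu.-integrable D (fun x => (f x - g x)%:E).
Proof.
move=> /integrableB h /h-/(_ mD); exact: eq_integrable.
Qed.

Lemma integrable_oppr f : mu.-integrable D (EFin \o f) ->
  mu.-integrable D (fun x => (- f x)%:E).
Proof.
by move=> /integrableN; exact: eq_integrable.
Qed.

Lemma eq_integrable_real f g : mu.-integrable D (EFin \o f) ->
  (forall x, D x -> f x = g x) -> mu.-integrable D (EFin \o g).
Proof.
move=> + fg; apply: eq_integrable => // x; rewrite inE => Dx.
by rewrite /= fg.
Qed.

Lemma EFin_Rintegral f : mu.-integrable D (EFin \o f) ->
  (\int[mu]_(x in D) (f x)%:E = (\int[mu]_(x in D) f x)%R%:E)%E.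
Proof. by move=> iF; rewrite /Rintegral fineK// integrable_fin_num. Qed.

Lemma Rintegral_sum I (r : seq I) (P : pred I) (F : I -> T -> R) :
  (forall i, mu.-integrable D (EFin \o F i)) ->
  mu.-integrable D (fun x => (\sum_(i <- r | P i) F i x)%:E) /\
  \int[mu]_(x in D) (\sum_(i <- r | P i) F i x) =
  \sum_(i <- r | P i) \int[mu]_(x in D) F i x.
Proof.
move=> iF; elim: r => [|i r [IH1 IH2]].
  split; last by rewrite big_nil; under eq_Rintegral do rewrite big_nil; rewrite /Rintegral integral0.
  apply: (@eq_integrable_real (fun=> 0)); first exact: integrable0.
  by move=> x _; rewrite big_nil.
case: (boolP (P i)) => Pi; last first.
  split; last by rewrite big_cons (negbTE Pi) -IH2; apply: eq_Rintegral => x _; rewrite big_cons (negbTE Pi).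
  by apply: (eq_integrable_real IH1) => x _; rewrite big_cons (negbTE Pi).
have E x : \sum_(j <- i :: r | P j) F j x = F i x + \sum_(j <- r | P j) F j x.
  by rewrite big_cons Pi.
split.
  apply: (@eq_integrable_real (fun x => F i x + \sum_(j <- r | P j) F j x)) => //.
  exact: integrable_addr.
under eq_Rintegral do rewrite E.
by rewrite RintegralD// big_cons Pi IH2.
Qed.

End real_integrable.

Section half_line.
Context {R : realType}.
Local Notation mu := (@lebesgue_measure R).
Implicit Types (F G f g : R -> R) (a b c s t x y : R).

Lemma measurable_pos : measurable (`]0%R, +oo[%classic : set (measurableTypeR R)).
Proof. exact: measurable_itv. Qed.

Lemma pos_derivable_increasing F F' :
  (forall x, 0 < x -> is_derive x 1 F (F' x)) -> (forall x, 0 < x -> 0 < F' x) ->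
  forall x y, 0 < x -> x < y -> F x < F y.
Proof.
move=> dF F'0 x y x0 xy.
have inI z : z \in `[x, y] -> 0 < z.
  by rewrite in_itv/= => /andP[xz _]; exact: lt_le_trans xz.
have dFI z : z \in `]x, y[ -> is_derive z 1 F (F' z).
  by move=> zI; apply: dF; apply: inI; exact: subset_itv_oo_cc zI.
have cFI : {within `[x, y], continuous F}.
  apply: derivable_within_continuous => z /inI z0.
  by have [] := dF _ z0.
have [z zI e] := MVT xy dFI cFI.
rewrite -subr_gt0 e mulr_gt0 ?subr_gt0//.
by apply: F'0; apply: inI; exact: subset_itv_oo_cc zI.
Qed.

Lemma pos_continuous_within f (a b : R) : 0 < a ->
  (forall x, 0 < x -> {for x, continuous f}) -> {within `[a, b], continuous f}.
Proof.
move=> a0 cf; apply: continuous_in_subspaceT => x.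
by rewrite inE/= in_itv/= => /andP[ax _]; apply: cf; exact: lt_le_trans ax.
Qed.

Lemma pos_continuous_measurable f :
  (forall x, 0 < x -> {for x, continuous f}) -> measurable_fun (`]0%R, +oo[ : set R) f.
Proof.
move=> cf; apply: open_continuous_measurable_fun; first exact: interval_open.
by move=> x; rewrite inE/= in_itv/= andbT => /cf.
Qed.

Lemma is_derive_continuous f x l : is_derive x 1 f l -> {for x, continuous f}.
Proof. by case=> df _; apply/differentiable_continuous/derivable1_diffP. Qed.

(** The compact intervals [1/(k+2), k+2] exhaust the open half-line; the offset 2 makes them
    nondegenerate already for k = 0. *)
Let lo (k : nat) : R := k.+2%:R^-1.
Let hi (k : nat) : R := k.+2%:R.

Let lo_gt0 k : 0 < lo k. Proof. by rewrite invr_gt0 ltr0n. Qed.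
Let lo_hi k : lo k < hi k.
Proof.
apply: (@lt_trans _ _ 1); last by rewrite ltr1n.
by rewrite invf_lt1 ?ltr1n ?ltr0n.
Qed.

Let hi_homo k m : (k <= m)%N -> hi k <= hi m.
Proof. by move=> km; rewrite ler_nat. Qed.
Let lo_homo k m : (k <= m)%N -> lo m <= lo k.
Proof. by move=> km; rewrite lef_pV2 ?posrE ?ltr0n// ler_nat. Qed.

Let cvg_hi : hi k @[k --> \oo] --> +oo.
Proof.
apply/cvgryPge => A; near=> k.
have kA : A <= k%:R by near: k; exact: nbhs_infty_ger.
by rewrite (le_trans kA)// /hi ler_nat -addn2 leq_addr.
Unshelve. all: end_near. Qed.

Let cvg_lo : lo k @[k --> \oo] --> (0 : R).
Proof.
apply/cvgrPdist_le => e e0; near=> k.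
rewrite sub0r normrN ger0_norm ?(ltW (lo_gt0 _))// /lo.
rewrite -(invrK e) lef_pV2 ?posrE ?invr_gt0 ?ltr0n//.
near: k.
move/cvgryPge : cvg_hi => /(_ e^-1).
by apply: filterS.
Unshelve. all: end_near. Qed.

(** Change of variables on each compact interval of the exhaustion, then monotone convergence on
    both sides. Regularity is asked only in the interior, so maps such as x^a with a < 1, whose
    derivative blows up at 0, are covered. *)
Lemma ge0_integral_subst_pos F F' G c :
  (forall x, 0 < x -> is_derive x 1 F (F' x)) -> (forall x, 0 < x -> 0 < F' x) ->
  (forall x, 0 < x -> {for x, continuous F'}) ->
  F x @[x --> 0^'+] --> c -> F x @[x --> +oo] --> +oo ->
  (forall x, c < x -> {for x, continuous G}) ->
  (forall x, c < x -> 0 <= G x) ->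
  (\int[mu]_(y in `]c, +oo[) (G y)%:E =
   \int[mu]_(x in `]0%R, +oo[) (G (F x) * F' x)%:E)%E.
Proof.
move=> dF F'0 cF' F0 Fy cG G0.
have incF := pos_derivable_increasing dF F'0.
have cF x : 0 < x -> {for x, continuous F} by move=> /dF; exact: is_derive_continuous.
have cltF x : 0 < x -> c < F x.
  move=> x0; apply: (@le_lt_trans _ _ (F (x / 2))); last first.
    by apply: incF; lra.
  apply: (cvgr_to_le F0).
  near=> y; apply/ltW/incF; near: y; first exact: nbhs_right_gt.
  by apply: nbhs_right_lt; lra.
pose I k := [set` `[F (lo k), F (hi k)]].
pose J k := [set` `[lo k, hi k]].
have ndI : nondecreasing_seq I.
  move=> k m km; apply/subsetPset => z; rewrite /I/= !in_itv/= => /andP[h1 h2].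
  have le_F x y : 0 < x -> x <= y -> F x <= F y.
    by move=> x0; rewrite le_eqVlt => /predU1P[->//|xy]; exact/ltW/incF.
  rewrite (le_trans (le_F _ _ _ (lo_homo km)) h1)//=.
  by rewrite (le_trans h2)// le_F ?hi_homo// /hi ltr0n.
have ndJ : nondecreasing_seq J.
  move=> k m km; apply/subsetPset => z; rewrite /J/= !in_itv/= => /andP[h1 h2].
  by rewrite (le_trans (lo_homo km) h1)//= (le_trans h2)// hi_homo.
have UI : \bigcup_k I k = `]c, +oo[%classic.
  apply/seteqP; split => [z [k _]|z]; rewrite /I/= !in_itv/= ?andbT.
    by move=> /andP[+ _]; apply: lt_le_trans; exact: cltF.
  move=> cz.
  have e1 : \forall k \near \oo, F (lo k) <= z.
    have : F (lo k) @[k --> \oo] --> c.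
      by move/cvg_at_rightP : F0; apply; split.
    by move/cvgr_le => /(_ _ cz).
  have e2 : \forall k \near \oo, z <= F (hi k).
    have : F (hi k) @[k --> \oo] --> +oo by exact: (cvg_comp _ _ cvg_hi Fy).
    by move/cvgryPge => /(_ z).
  near \oo => k; exists k => //=; rewrite in_itv/=; apply/andP; split; near: k.
    exact: e1.
  exact: e2.
have UJ : \bigcup_k J k = `]0%R, +oo[%classic.
  apply/seteqP; split => [z [k _]|z]; rewrite /J/= !in_itv/= ?andbT.
    by move=> /andP[+ _]; apply: lt_le_trans.
  move=> z0; near \oo => k; exists k => //=; rewrite in_itv/=; apply/andP; split; near: k.
    by move/cvgr_le : cvg_lo => /(_ _ z0).
  by move/cvgryPge : cvg_hi => /(_ z).
have cGF x : 0 < x -> {for x, continuous (fun x => G (F x) * F' x)}.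
  move=> x0; apply: cvgM; last exact: cF'.
  by apply: continuous_comp; [exact: cF|exact/cG/cltF].
have step k : (\int[mu]_(y in I k) (G y)%:E = \int[mu]_(x in J k) (G (F x) * F' x)%:E)%E.
  have F'E x : 0 < x -> derive1 F x = F' x by move=> /dF[_ <-]; rewrite derive1E.
  have cF'1 x : 0 < x -> {for x, continuous (derive1 F)}.
    move=> x0; have := cF' _ x0; rewrite /prop_for/continuous_at F'E//.
    apply: cvg_trans; apply: near_eq_cvg; near=> y; rewrite F'E//.
    by near: y; exact: lt_nbhsr.
  rewrite /I (integration_by_substitution_increasing (F := F)).
  - apply: eq_integral => x; rewrite inE /= in_itv/= => /andP[lx _].
    by rewrite /= fctE/= F'E// (lt_le_trans _ lx).
  - exact/ltW/lo_hi.
  - move=> x y; rewrite !in_itv/= => /andP[lx _] _; apply: incF.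
    exact: lt_le_trans lx.
  - move=> x; rewrite in_itv/= => /andP[lx _]; apply: cF'1; exact: lt_trans lx.
  - apply/cvg_ex; exists (derive1 F (lo k)).
    by apply: cvg_at_right_filter; exact: cF'1.
  - apply/cvg_ex; exists (derive1 F (hi k)).
    by apply: cvg_at_left_filter; apply: cF'1; rewrite /hi ltr0n.
  - split.
    + by move=> x; rewrite in_itv/= => /andP[lx _]; have [] := dF _ (lt_trans (lo_gt0 _) lx).
    + by apply: cvg_at_right_filter; exact: cF.
    + by apply: cvg_at_left_filter; apply: cF; rewrite /hi ltr0n.
  - apply: continuous_in_subspaceT => x; rewrite inE/= in_itv/= => /andP[lx _].
    by apply: cG; apply: lt_le_trans lx; exact: cltF.
have h1 : (\int[mu]_(y in I k) (G y)%:E)%E @[k --> \oo] --> (\int[mu]_(y in \bigcup_k I k) (G y)%:E)%E.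
  apply: ge0_nondecreasing_set_cvg_integral => //.
  - by move=> k; exact: measurable_itv.
  - move=> k; apply/measurable_EFinP; apply: subspace_continuous_measurable_fun; first exact: measurable_itv.
    apply: (@continuous_in_subspaceT _ _ (I k)) => x; rewrite /I inE/= in_itv/= => /andP[lx _].
    by apply: cG; apply: lt_le_trans lx; exact: cltF.
  - move=> k x; rewrite /I/= in_itv/= => /andP[lx _]; rewrite lee_fin.
    by apply: G0; apply: lt_le_trans lx; exact: cltF.
have h2 : (\int[mu]_(x in J k) (G (F x) * F' x)%:E)%E @[k --> \oo] -->
    (\int[mu]_(x in \bigcup_k J k) (G (F x) * F' x)%:E)%E.
  apply: ge0_nondecreasing_set_cvg_integral => //.
  - by move=> k; exact: measurable_itv.
  - move=> k; apply/measurable_EFinP; apply: subspace_continuous_measurable_fun; first exact: measurable_itv.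
    exact: (pos_continuous_within (lo_gt0 _) cGF).
  - move=> k x; rewrite /J/= in_itv/= => /andP[lx _]; rewrite lee_fin.
    have x0 := lt_le_trans (lo_gt0 _) lx.
    by rewrite mulr_ge0 ?(ltW (F'0 _ _))// G0// cltF.
rewrite -UI -UJ; move: h2; rewrite -(funext step) => h2.
exact: (cvg_unique _ h1 h2).
Unshelve. all: end_near. Qed.

(** The fundamental theorem of calculus holds on each compact interval of the exhaustion; since f'
    may change sign, the limit is taken by dominated convergence with |f'| as majorant. This is the
    source of every integration by parts below. *)
Lemma integral_derive_pos f f' (l0 l : R) :
  (forall x, 0 < x -> is_derive x 1 f (f' x)) ->
  (forall x, 0 < x -> {for x, continuous f'}) ->
  mu.-integrable `]0%R, +oo[ (EFin \o f') ->
  f x @[x --> 0^'+] --> l0 -> f x @[x --> +oo] --> l ->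
  (\int[mu]_(x in `]0%R, +oo[) (f' x)%:E = (l - l0)%:E)%E.
Proof.
move=> df cf' intf' f0 fy.
have cf x : 0 < x -> {for x, continuous f} by move=> /df; exact: is_derive_continuous.
pose J k := [set` `[lo k, hi k]].
have JS k : J k `<=` `]0%R, +oo[.
  by move=> x; rewrite /J/= !in_itv/= andbT => /andP[+ _]; exact: lt_le_trans.
have step k : (\int[mu]_(x in J k) (f' x)%:E = (f (hi k) - f (lo k))%:E)%E.
  rewrite /J (@continuous_FTC2 _ f' f) ?lo_hi//.
  - exact: (pos_continuous_within (lo_gt0 _) cf').
  - split.
    + by move=> x; rewrite in_itv/= => /andP[lx _]; have [] := df _ (lt_trans (lo_gt0 _) lx).
    + by apply: cvg_at_right_filter; exact: cf.
    + by apply: cvg_at_left_filter; apply: cf; rewrite /hi ltr0n.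
  - move=> x; rewrite in_itv/= => /andP[lx _]; rewrite derive1E.
    by have [_ ->] := df _ (lt_trans (lo_gt0 _) lx).
have h1 : (\int[mu]_(x in J k) (f' x)%:E)%E @[k --> \oo] --> (l - l0)%:E.
  under eq_fun do rewrite step.
  apply: cvg_EFin; first by apply: nearW.
  apply: cvgB; first exact: (cvg_comp _ _ cvg_hi fy).
  by move/cvg_at_rightP : f0; apply; split.
apply: (cvg_unique _ _ h1) => //.
pose fk k x := ((EFin \o f') \_ (J k)) x.
have -> : (fun k => \int[mu]_(x in J k) (f' x)%:E)%E = (fun k => \int[mu]_(x in `]0%R, +oo[) fk k x)%E.
  apply/funext => k; rewrite [RHS]integral_mkcond [LHS]integral_mkcond; apply: eq_integral => x _.
  rewrite !patchE /fk patchE; case: (boolP (x \in J k)) => [xJ|xJ]; last by rewrite if_same.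
  by rewrite mem_set//; apply: JS; exact: set_mem xJ.
have mf' := measurable_int _ intf'.
have [||||||_ _] := @dominated_convergence _ _ _ mu `]0%R, +oo[%classic _ fk (EFin \o f') (abse \o (EFin \o f')) => //.
- move=> k; apply: (measurable_funS measurableT (@subsetT _ _)).
  have mJ : measurable (J k : set (measurableTypeR R)) by exact: measurable_itv.
  apply: (measurable_restrictT (EFin \o f') mJ).1.
  exact: measurable_funS (measurable_itv _) (@JS k) mf'.
- apply: aeW => x; rewrite /= in_itv/= andbT => x0.
  apply: cvg_near_cst; near=> k; rewrite /fk patchE mem_set// /J/= in_itv/=.
  apply/andP; split; near: k.
    by move/cvgr_le : cvg_lo => /(_ _ x0).
  by move/cvgryPge : cvg_hi => /(_ x).
- exact: integrable_abse.
- apply: aeW => x k _; rewrite /fk patchE; case: ifPn => // _.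
  by rewrite abse0 abse_ge0.
Unshelve. all: end_near. Qed.

End half_line.

(** * The Gamma function *)

Section gamma_function.
Context {R : realType}.
Local Notation mu := (@lebesgue_measure R).
Implicit Types (F G f g : R -> R) (a b c s t x y : R).

Lemma exprn_le_expR x n : 0 <= x -> x ^+ n <= n`!%:R * expR x.
Proof.
case: n => [|n] x0; first by rewrite expr0 fact0 mul1r -[X in X <= _]expR0 ler_expR.
have := @expR_ge1Dxn R x n x0.
move=> h; rewrite mulrC -ler_pdivrMr ?ltr0n ?fact_gt0//; apply: le_trans h.
by rewrite lerDr.
Qed.

Lemma powR_cvgy a : 0 < a -> x `^ a @[x --> +oo] --> +oo.
Proof.
move=> a0; apply/cvgryPge => A; near=> x.
have Ax : `|A| `^ a^-1 <= x by near: x; apply: nbhs_pinfty_ge; rewrite num_real.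
apply: (le_trans (ler_norm A)).
rewrite -[leLHS](@powRr1 _ `|A|)// -(mulVf (lt0r_neq0 a0)) powRrM.
apply: ge0_ler_powR; rewrite ?nnegrE ?(ltW a0) ?powR_ge0// (le_trans _ Ax)// powR_ge0.
Unshelve. all: end_near. Qed.

Lemma continuous_powR a x : 0 < x -> {for x, continuous (fun y => y `^ a)}.
Proof. by move=> x0; apply: is_derive_continuous; exact: is_derive1_powR. Qed.

Lemma continuous_expRN : continuous (fun x : R => expR (- x)).
Proof.
move=> x; apply: continuous_comp; last exact: continuous_expR.
by apply: continuousN; exact: cvg_id.
Qed.

Lemma continuous_expRM c : continuous (fun x => expR (- (c * x))).
Proof.
move=> x; apply: continuous_comp; last exact: continuous_expR.
by apply: continuousN; apply: cvgM; [exact: cvg_cst|exact: cvg_id].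
Qed.

(** An explicit finite integral which, after a power substitution, serves as comparison for the
    Gamma integral. *)
Lemma integral_inv_sqr : (\int[mu]_(x in `]0%R, +oo[) ((1 + x) ^- 2)%:E = 1%:E)%E.
Proof.
have d x : 0 < 1 + x -> is_derive x 1 (fun x => - (1 + x)^-1) ((1 + x) ^- 2).
  move=> x0.
  have h : is_derive x 1 (fun x => 1 + x) 1.
    have := is_deriveD (is_derive_cst (1 : R) x 1) (is_derive_id x 1).
    by rewrite add0r.
  have := is_deriveN (is_deriveV (lt0r_neq0 x0) h).
  by rewrite scaleNr opprK /GRing.scale/= mulr1.
have c x : 0 < 1 + x -> {for x, continuous (fun x => (1 + x) ^- 2)}.
  move=> x0; apply: (@cvgV _ _ _ _ (fun x => (1 + x) ^+ 2)).
    by rewrite expf_neq0// lt0r_neq0.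
  apply: (@cvgM _ _ _ _ (fun x => 1 + x) (fun x => 1 + x)); (apply: cvgD; [exact: cvg_cst|exact: cvg_id]).
have x1 x : 0 <= x -> 0 < 1 + x by move=> ?; lra.
rewrite integral_itv_obnd_cbnd; last first.
  apply/measurable_EFinP; apply: pos_continuous_measurable => x x0.
  by apply/c/x1/ltW.
rewrite (@ge0_continuous_FTC2y _ _ (fun x => - (1 + x)^-1) 0 0).
- by rewrite addr0 invr1 -EFinB opprK add0r.
- by move=> x x0; rewrite invr_ge0 sqr_ge0.
- apply: continuous_in_subspaceT => x; rewrite inE/= in_itv/= andbT => x0.
  exact/c/x1.
- rewrite -oppr0; apply: cvgN; apply: (@gtr0_cvgV0 _ _ _ _ (fun x : R => 1 + x) _).2.
    by near=> x; apply: x1; near: x; apply: nbhs_pinfty_ge; rewrite num_real.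
  exact: cvg_addrl.
- by move=> x x0; have [] := d x (x1 _ (ltW x0)).
- apply: cvg_at_right_filter; apply: (is_derive_continuous (d 0 _)).
  by rewrite addr0.
- move=> x; rewrite in_itv/= andbT => x0; rewrite derive1E.
  by have [_ ->] := d x (x1 _ (ltW x0)).
Unshelve. all: end_near. Qed.

(** Substituting x^a in the integral of (1 + x)^(-2) gives an integrable function that carries the
    singularity x^(a-1) at 0 and decays only polynomially at infinity. It therefore dominates the
    Gamma integrand at both ends at once. *)
Lemma integrable_gamma a : 0 < a ->
  mu.-integrable `]0%R, +oo[ (fun t => (t `^ (a - 1) * expR (- t))%:E).
Proof.
move=> a0.
have dF x : 0 < x -> is_derive x 1 (fun x => x `^ a) (a * x `^ (a - 1)).
  by move=> x0; exact: is_derive1_powR.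
have cF' x : 0 < x -> {for x, continuous (fun x => a * x `^ (a - 1))}.
  by move=> x0; apply: cvgM; [exact: cvg_cst|exact: continuous_powR].
have cG x : 0 < x -> {for x, continuous (fun x => (1 + x) ^- 2)}.
  move=> x0; apply: (@cvgV _ _ _ _ (fun x => (1 + x) ^+ 2)).
    by rewrite expf_neq0// lt0r_neq0//; lra.
  apply: (@cvgM _ _ _ _ (fun x => 1 + x) (fun x => 1 + x)); (apply: cvgD; [exact: cvg_cst|exact: cvg_id]).
have I1 := @ge0_integral_subst_pos R (fun x => x `^ a) _ (fun x => (1 + x) ^- 2) 0
  dF _ cF' (powR_cvg0 a0) (powR_cvgy a0) cG _.
have cmf : measurable_fun (`]0%R, +oo[ : set R) (fun x => (1 + x `^ a) ^- 2 * (a * x `^ (a - 1))).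
  apply: pos_continuous_measurable => x x0; apply: cvgM; last exact: cF'.
  apply: (@continuous_comp _ _ _ (fun x => x `^ a) (fun x => (1 + x) ^- 2)).
    exact: continuous_powR.
  by apply: cG; rewrite powR_gt0.
have int1 : mu.-integrable `]0%R, +oo[ (fun x => ((1 + x `^ a) ^- 2 * (a * x `^ (a - 1)))%:E).
  apply/integrableP; split; first exact/measurable_EFinP.
  under eq_integral => x xI.
    rewrite gee0_abs; last first.
      by rewrite lee_fin !mulr_ge0 ?invr_ge0 ?sqr_ge0 ?powR_ge0// ltW.
    over.
  rewrite -I1 ?integral_inv_sqr ?ltry// => x x0; first by rewrite mulr_gt0// powR_gt0.
  by rewrite invr_ge0 sqr_ge0.
pose k := (Num.truncn a).+1.
have ak : a <= k%:R by rewrite ltW// /k truncnS_gt.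
(* The constant bounds (1 + t^a)^2 e^(-t): t^a <= 1 + t^k, then (2 + t^k)^2 <= 8 + 2 t^(2k), and
   t^(2k) <= (2k)! e^t. The factor 1/a cancels the Jacobian. *)
pose C : R := a^-1 * (8 + 2 * (k + k)`!%:R).
have mG : measurable_fun (`]0%R, +oo[ : set R) (fun t => t `^ (a - 1) * expR (- t)).
  apply: pos_continuous_measurable => x x0; apply: cvgM; first exact: continuous_powR.
  exact: continuous_expRN.
apply: (@le_integrable _ _ _ mu _ _ _ (fun x => C%:E * ((1 + x `^ a) ^- 2 * (a * x `^ (a - 1)))%:E)%E) => //.
- exact/measurable_EFinP.
- move=> t; rewrite /= in_itv/= andbT => t0.
  rewrite lee_fin !ger0_norm; last 2 first.
  - by rewrite !mulr_ge0 ?addr_ge0 ?invr_ge0 ?sqr_ge0 ?powR_ge0 ?(ltW a0)// mulr_ge0.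
  - by rewrite mulr_ge0// ?powR_ge0// expR_ge0.
  set u := t `^ (a - 1); have u0 : 0 <= u by rewrite powR_ge0.
  have v0 : 0 <= t `^ a by rewrite powR_ge0.
  have v1 : 0 < 1 + t `^ a by lra.
  rewrite (_ : C * _ = u * ((8 + 2 * (k + k)`!%:R) / (1 + t `^ a) ^+ 2)); last first.
    by rewrite /C; field; rewrite !lt0r_neq0.
  rewrite ler_wpM2l// ler_pdivlMr ?exprn_gt0// expRN mulrC ler_pdivrMr ?expR_gt0//.
  have tk : t `^ a <= 1 + t ^+ k.
    have [t1|t1] := leP t 1.
      rewrite -[leLHS]addr0 lerD ?exprn_ge0 ?(ltW t0)//.
      rewrite -[leRHS](powRr0 t) ger_powR ?t0 ?t1//; lra.
    by rewrite -powR_mulrn ?(ltW t0)// -[leLHS]add0r lerD// ler_powR// ltW.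
  have tkk := @exprn_le_expR t (k + k) (ltW t0).
  have tk0 : 0 <= t ^+ k by rewrite exprn_ge0 ?(ltW t0).
  have e1 : 1 <= expR t by rewrite -[leLHS]expR0 ler_expR ltW.
  rewrite mulrDl; rewrite exprD in tkk.
  move: (t ^+ k) (k + k)`!%:R tk tk0 tkk => K B tk tk0 tkk.
  have : (1 + t `^ a) ^+ 2 <= 8 + 2 * (K * K).
    apply: (@le_trans _ _ ((2 + K) ^+ 2)).
      by rewrite ler_pXn2r ?nnegrE ?addr_ge0//; lra.
    by have := sqr_ge0 (K - 2); rewrite !expr2; lra.
  move=> h; apply: (le_trans h); nra.
- exact: integrableZl.
Qed.

Lemma integral_gamma a : 0 < a ->
  (\int[mu]_(t in `]0%R, +oo[) (t `^ (a - 1) * expR (- t))%:E = (Gamma a)%:E)%E.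
Proof. by move=> a0; rewrite /Gamma /Rintegral fineK// integrable_fin_num// integrable_gamma. Qed.

(** A zero integral would make f vanish almost everywhere, so the half-line, of infinite measure,
    would lie in a null set. *)
Lemma integral_pos_gt0 f : measurable_fun (`]0%R, +oo[ : set R) f ->
  (forall x, 0 < x -> 0 < f x) -> (0 < \int[mu]_(x in `]0%R, +oo[) (f x)%:E)%E.
Proof.
move=> mf f0; have g0 : (0 <= \int[mu]_(x in `]0%R, +oo[) (f x)%:E)%E.
  by apply: integral_ge0 => x; rewrite /= in_itv/= andbT lee_fin => /f0/ltW.
rewrite lt_neqAle g0 andbT; apply/negP => /eqP/esym e.
have h : (\int[mu]_(x in `]0%R, +oo[) `|(f x)%:E| = 0)%E.
  rewrite -[RHS]e; apply: eq_integral => x; rewrite inE/= in_itv/= andbT => /f0 fx0.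
  by rewrite ger0_norm// ltW.
have mf' : measurable_fun (`]0%R, +oo[ : set R) (EFin \o f) by exact/measurable_EFinP.
have /(ae_eq_integral_abs mu (measurable_itv _) mf') [N [mN N0 sN]] := h.
have : (mu `]0%R, +oo[ <= mu N)%E.
  rewrite le_measure ?inE//.
  move=> x x0; apply: sN => /=; apply/not_implyP; split => // -[fx].
  by move: x0; rewrite /= in_itv/= andbT => /f0; rewrite fx ltxx.
by rewrite N0 lebesgue_measure_itv/= ltry.
Qed.

Lemma gamma_gt0 a : 0 < a -> 0 < Gamma a.
Proof.
move=> a0; rewrite -lte_fin -integral_gamma//; apply: integral_pos_gt0.
  by apply/measurable_EFinP; exact: (measurable_int _ (integrable_gamma a0)).
by move=> x x0; rewrite mulr_gt0 ?powR_gt0 ?expR_gt0.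
Qed.

(** The substitution x = y/s + t reduces this to the Gamma integral. It is the inner integral of the
    convolution theorem. *)
Lemma laplace_powR_shift a s t : 0 < a -> 0 < s ->
  (\int[mu]_(x in `]t, +oo[) (expR (- (s * x)) * (x - t) `^ (a - 1))%:E =
   (expR (- (s * t)) * (Gamma a * s `^ (- a)))%:E)%E.
Proof.
move=> a0 s0.
have dF x : 0 < x -> is_derive x 1 (fun x => s^-1 * x + t) s^-1.
  by move=> _; apply: is_derive_eq; rewrite addr0 /GRing.scale/= mulr1.
rewrite (@ge0_integral_subst_pos R (fun x => s^-1 * x + t) (fun=> s^-1)
   (fun x => expR (- (s * x)) * (x - t) `^ (a - 1)) t dF).
- transitivity (\int[mu]_(x in `]0%R, +oo[)
    ((expR (- (s * t)) * s `^ (- a))%:E * (x `^ (a - 1) * expR (- x))%:E))%E.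
    apply: eq_integral => x; rewrite inE/= in_itv/= andbT => x0.
    rewrite -EFinM; congr EFin.
    rewrite addrK powRM ?invr_ge0 ?(ltW s0) ?(ltW x0)//.
    have -> : s * (s^-1 * x + t) = s * t + x by field; exact: lt0r_neq0.
    rewrite opprD expRD.
    rewrite -powR_inv1 ?(ltW s0)// -powRrM.
    have -> : s `^ (- a) = s `^ (-1 * (a - 1)) * s `^ (-1).
      by rewrite -powRD; [congr (_ `^ _); ring|rewrite lt0r_neq0// implybT].
    ring.
  rewrite integralZl//; first by rewrite integral_gamma// -EFinM mulrA mulrAC.
  exact: integrable_gamma.
- by move=> x x0; rewrite invr_gt0.
- by move=> x _; exact: cvg_cst.
- apply: cvg_at_right_filter.
  have := @is_derive_continuous _ (fun x => s^-1 * x + t) 0 s^-1.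
  rewrite /prop_for/continuous_at mulr0 add0r; apply.
  by apply: is_derive_eq; rewrite addr0 /GRing.scale/= mulr1.
- apply/cvgryPge => A; near=> x.
  have Ax : (A - t) * s <= x by near: x; apply: nbhs_pinfty_ge; rewrite num_real.
  by rewrite -lerBlDr mulrC ler_pdivlMr.
- move=> x tx; apply: continuousM; first exact: continuous_expRM.
  apply: (@continuous_comp _ _ _ (fun x => x - t) (fun x => x `^ (a - 1))).
    by apply: continuousB; [exact: cvg_id|exact: cvg_cst].
  by apply: continuous_powR; rewrite subr_gt0.
- by move=> x _; rewrite mulr_ge0 ?expR_ge0 ?powR_ge0.
Unshelve. all: end_near. Qed.

Lemma laplace_powR a s : 0 < a -> 0 < s ->
  (\int[mu]_(x in `]0%R, +oo[) (expR (- (s * x)) * x `^ (a - 1))%:E =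
   (Gamma a * s `^ (- a))%:E)%E.
Proof.
move=> a0 s0; have := laplace_powR_shift 0 a0 s0.
rewrite mulr0 oppr0 expR0 mul1r => <-.
by apply: eq_integral => x _; rewrite addr0.
Qed.

(** The derivative of x^a e^(-x) has integral zero, because that function tends to 0 at both ends of
    the half-line. *)
Lemma GammaS a : 0 < a -> Gamma (a + 1) = a * Gamma a.
Proof.
move=> a0; have a10 : 0 < a + 1 by lra.
pose f' x := a * (x `^ (a - 1) * expR (- x)) - x `^ (a + 1 - 1) * expR (- x).
have df x : 0 < x -> is_derive x 1 (fun x => x `^ a * expR (- x)) (f' x).
  move=> x0; have d1 := is_derive1_powR a x0.
  apply: is_derive_eq; rewrite /f' addrK /GRing.scale/=; ring.
have cE x : {for x, continuous (fun x => expR (- x))}.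
  exact: continuous_expRN.
have cf' x : 0 < x -> {for x, continuous f'}.
  move=> x0; apply: cvgB.
    apply: cvgM; first exact: cvg_cst.
    by apply: cvgM; [exact: continuous_powR|exact: cE].
  by apply: cvgM; [exact: continuous_powR|exact: cE].
have i1 := integrable_gamma a0; have i2 := integrable_gamma a10.
have if' : mu.-integrable `]0%R, +oo[ (EFin \o f').
  apply: (@eq_integrable _ _ _ mu _ _ (fun x => (a%:E * (x `^ (a - 1) * expR (- x))%:E - (x `^ (a + 1 - 1) * expR (- x))%:E))%E) => //.
  by apply: integrableB => //; exact: integrableZl.
have f0 : x `^ a * expR (- x) @[x --> 0^'+] --> 0.
  rewrite -[X in _ --> X](mul0r (expR (- 0))); apply: cvgM; first exact: powR_cvg0.
  by apply: cvg_at_right_filter; exact: cE.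
pose k := (Num.truncn a).+1.
have ak : a <= k%:R by rewrite ltW// /k truncnS_gt.
have fy : x `^ a * expR (- x) @[x --> +oo] --> 0.
  apply: (@squeeze_cvgr _ _ _ _ (cst 0) (fun x => k.+1`!%:R * x^-1)).
  - near=> x; have x1 : 1 <= x by near: x; apply: nbhs_pinfty_ge; rewrite num_real.
    have x0 : 0 < x by lra.
    rewrite mulr_ge0 ?powR_ge0 ?expR_ge0//=.
    rewrite expRN ler_pdivrMr ?expR_gt0// mulrAC ler_pdivlMr//.
    apply: le_trans (@exprn_le_expR x k.+1 (ltW x0)).
    by rewrite exprSr ler_pM2r// -powR_mulrn ?(ltW x0)// ler_powR.
  - exact: cvg_cst.
  - rewrite -[X in _ --> X](mulr0 (k.+1`!%:R)); apply: cvgM; first exact: cvg_cst.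
    apply: (@gtr0_cvgV0 _ _ _ _ (fun x : R => x) _).2; last exact: cvg_id.
    by apply: nbhs_pinfty_gt; rewrite num_real.
have := integral_derive_pos df cf' if' f0 fy.
rewrite /f'; under eq_integral do rewrite EFinB EFinM.
rewrite integralB//; last exact: integrableZl.
rewrite integralZl// !integral_gamma// subr0 -EFinM -EFinB => -[]/eqP.
by rewrite subr_eq0 => /eqP.
Unshelve. all: end_near. Qed.

End gamma_function.

(** * Uniqueness of Laplace transforms *)

Section laplace_uniqueness.
Context {R : realType}.
Local Notation mu := (@lebesgue_measure R).
Local Notation pos := (`]0%R, +oo[%classic : set R).
Implicit Types (h w : R -> R) (s t x y : R).

Let mpos : measurable (pos : set (measurableTypeR R)). Proof. exact: measurable_itv. Qed.

Lemma integrable_mul_bounded w (g : R -> R) (M : R) : mu.-integrable `]0%R, +oo[ (EFin \o w) ->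
  measurable_fun pos g -> (forall t, 0 < t -> `|g t| <= M) ->
  mu.-integrable `]0%R, +oo[ (fun t => (w t * g t)%:E).
Proof.
move=> iw mg gM; have mw : measurable_fun pos w by apply/measurable_EFinP; exact: (measurable_int _ iw).
apply: (@le_integrable _ _ _ mu _ _ _ (fun t => (M%:E * `|(w t)%:E|)%E)) => //.
- by apply/measurable_EFinP; exact: measurable_funM.
- move=> t; rewrite /= in_itv/= andbT => t0.
  have M0 : 0 <= M by rewrite (le_trans _ (gM _ t0)).
  by rewrite lee_fin !normrM normr_id (ger0_norm M0) mulrC ler_wpM2r// gM.
- by apply: integrableZl => //; exact: integrable_abse.
Qed.

Lemma integral_horner_expRN w : mu.-integrable `]0%R, +oo[ (EFin \o w) ->
  (forall k : nat, \int[mu]_(t in `]0%R, +oo[) (w t * expR (- t) ^+ k) = 0) ->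
  forall p : {poly R}, \int[mu]_(t in `]0%R, +oo[) (w t * p.[expR (- t)]) = 0.
Proof.
move=> iw wk p.
have ik (k : nat) : mu.-integrable `]0%R, +oo[ (fun t => (w t * expR (- t) ^+ k)%:E).
  apply: (@integrable_mul_bounded _ _ 1) => //.
    apply: measurable_funX; apply: measurable_funTS; apply: continuous_measurable_fun.
    exact: continuous_expRN.
  move=> t t0; rewrite ger0_norm ?exprn_ge0 ?expR_ge0// exprn_ile1 ?expR_ge0//.
  by rewrite expR_le1 oppr_le0 ltW.
have -> : \int[mu]_(t in `]0%R, +oo[) (w t * p.[expR (- t)]) =
    \int[mu]_(t in `]0%R, +oo[) (\sum_(i < size p) p`_i * (w t * expR (- t) ^+ i)).
  apply: eq_Rintegral => t _; rewrite horner_coef mulr_sumr.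
  by apply: eq_bigr => i _; rewrite mulrCA.
have [|_ ->] := @Rintegral_sum _ _ _ mu pos mpos _ (index_enum 'I_(size p)) predT
  (fun i t => p`_i * (w t * expR (- t) ^+ i)).
  by move=> i; exact: (integrable_mulrl mpos _ (ik i)).
rewrite big1// => i _; rewrite RintegralZl//; last exact: ik.
by rewrite [X in _ * X](_ : _ = 0) ?mulr0//; exact: wk.
Qed.

(* If [w t0 > 0], the powers of [1 - (X - e^(-t0))^2] evaluated at [e^(-t)] concentrate near
   [t0], so one of their integrals against [w] is positive. *)
Lemma laplace_eq0_le0 w : (forall t, 0 < t -> {for t, continuous w}) ->
  mu.-integrable `]0%R, +oo[ (EFin \o w) ->
  (forall k : nat, \int[mu]_(t in `]0%R, +oo[) (w t * expR (- t) ^+ k) = 0) ->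
  forall t, 0 < t -> w t <= 0.
Proof.
move=> cw iw wk t0 t0_gt0; rewrite leNgt; apply/negP => wt0.
pose x0 := expR (- t0).
have [r [r0 rt0 wr]] : exists r, [/\ 0 < r, r < t0 & forall t, `|t - t0| < r -> w t0 / 2 <= w t].
  have /cvgrPdist_le/(_ (w t0 / 2)) : {for t0, continuous w} by exact: cw.
  rewrite divr_gt0// => /(_ isT)[r/= r0 wr].
  exists (Num.min r (t0 / 2)); split.
  - by rewrite lt_min r0 divr_gt0.
  - by rewrite gt_min; apply/orP; right; lra.
  - move=> t; rewrite lt_min => /andP[tr _].
    have := wr t; rewrite /ball_/= distrC => /(_ tr) /ler_normlP[]; lra.
(* The width [r] in time, expressed in the variable e^(-t): by monotonicity, points at distance at
   least [r] from [t0] stay at distance at least [d] from [x0]. *)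
pose d := Num.min (x0 - expR (- (t0 + r))) (expR (- (t0 - r)) - x0).
have d0 : 0 < d.
  by rewrite lt_min !subr_gt0 /x0 !ltr_expR; apply/andP; split; lra.
have far t : r <= `|t - t0| -> d <= `|expR (- t) - x0|.
  move=> rt; rewrite ge_min; apply/orP.
  have [tt0|tt0] := leP t0 t.
    left; rewrite ger0_norm ?subr_ge0// in rt.
    have e1 : expR (- t) <= expR (- (t0 + r)) by rewrite ler_expR; lra.
    by rewrite distrC; apply: le_trans (ler_norm _); lra.
  right; rewrite ltr0_norm ?subr_lt0// in rt.
  have e1 : expR (- (t0 - r)) <= expR (- t) by rewrite ler_expR; lra.
  by apply: le_trans (ler_norm _); lra.
have [r' [r'0 r'r near']] : exists r', [/\ 0 < r', r' <= r &
    forall t, `|t - t0| < r' -> `|expR (- t) - x0| <= d / 2].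
  have /cvgrPdist_le/(_ (d / 2)) : {for t0, continuous (fun t => expR (- t))}.
    exact: continuous_expRN.
  rewrite divr_gt0// => /(_ isT)[r1/= r10 wr1].
  exists (Num.min r1 r); split.
  - by rewrite lt_min r10.
  - by rewrite ge_min lexx orbT.
  - move=> t; rewrite lt_min => /andP[tr _].
    have := wr1 t; rewrite /ball_/= distrC => /(_ tr).
    by rewrite [X in X <= _]distrC.
have x01 : 0 < x0 < 1 by rewrite /x0 expR_gt0 expR_lt1 oppr_lt0.
have e01 t : 0 < t -> 0 < expR (- t) < 1 by move=> t1; rewrite expR_gt0 expR_lt1 oppr_lt0.
have d1 : d < 1.
  rewrite gt_min; apply/orP; left.
  by have := expR_gt0 (- (t0 + r)); move/andP: x01 => [_]; lra.
(* [rho] bounds the peak polynomial [p] from above off the [r]-neighbourhood of [t0], and [rho']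
   bounds it from below on the [r']-neighbourhood. The gap between them comes from halving [d]. *)
pose rho : R := 1 - d ^+ 2; pose rho' : R := 1 - (d / 2) ^+ 2.
have rho0 : 0 <= rho by rewrite /rho subr_ge0 expr_le1 ?ltW.
have rho'0 : 0 < rho' by rewrite /rho' subr_gt0 expr_lt1 ?divr_ge0 ?(ltW d0)//; lra.
have rr' : rho < rho' by rewrite /rho /rho' !expr2; nra.
pose p : {poly R} := 1 - ('X - x0%:P) ^+ 2.
have pE t : p.[expR (- t)] = 1 - (expR (- t) - x0) ^+ 2 by rewrite /p !hornerE.
have p01 t : 0 < t -> 0 <= p.[expR (- t)] <= 1.
  move=> /e01 /andP[e0 e1]; move/andP: x01 => [x00 x011]; rewrite pE gerBl sqr_ge0 andbT.
  by rewrite subr_ge0 -real_normK ?num_real// expr_le1// ler_norml; lra.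
have pfar t : r <= `|t - t0| -> p.[expR (- t)] <= rho.
  by move=> /far dt; rewrite pE /rho lerD2l lerN2 -[leRHS]real_normK ?num_real// ler_pXn2r ?nnegrE ?(ltW d0).
have pnear t : `|t - t0| < r' -> rho' <= p.[expR (- t)].
  move=> /near' dt; rewrite pE /rho' lerD2l lerN2 -[leLHS]real_normK ?num_real//.
  by rewrite ler_pXn2r ?nnegrE// divr_ge0// ltW.
pose B := `]t0 - r', t0 + r'[%classic.
have BP t : t \in B = (`|t - t0| < r').
  by rewrite /B mem_setE in_itv/= ltr_distl.
pose M := \int[mu]_(t in `]0%R, +oo[) `|w t|.
have M0 : 0 <= M by apply: Rintegral_ge0.
pose c := w t0 / 2.
have c0 : 0 < c by rewrite divr_gt0.
(* The integral of w p^m is 0. Its integrand is at least c rho'^m on [B], nonnegative between [r']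
   and [r], and at least - rho^m |w| farther away; integrating this minorant gives the inequality,
   which fails for large m. *)
have ineq (m : nat) : rho' ^+ m * (c * (r' + r')) <= rho ^+ m * M.
  have hp := integral_horner_expRN iw wk (p ^+ m).
  have iB : mu.-integrable `]0%R, +oo[ (fun t => (c * rho' ^+ m * \1_B t)%:E).
    apply: integrable_mulrl => //; apply/integrableP; split.
      by apply/measurable_EFinP; apply: measurable_indic; exact: measurable_itv.
    under eq_integral do rewrite gee0_abs ?lee_fin//.
    rewrite integral_indic//; last exact: measurable_itv.
    apply: le_lt_trans (_ : mu B < +oo)%E.
      rewrite le_measure ?inE//; last exact: measurable_itv.
      by apply: measurableI => //; exact: measurable_itv.
    by rewrite /B lebesgue_measure_itv/=; case: ifP => // _; rewrite ltry.
  have iM : mu.-integrable `]0%R, +oo[ (fun t => (rho ^+ m * `|w t|)%:E).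
    by apply: integrable_mulrl => //; exact: integrable_norm iw.
  have iwp : mu.-integrable `]0%R, +oo[ (fun t => (w t * (p ^+ m).[expR (- t)])%:E).
    apply: (@integrable_mul_bounded _ _ 1) => //.
      apply: measurable_funTS; apply: continuous_measurable_fun => t.
      apply: (@continuous_comp _ _ _ (fun t => expR (- t)) (fun x => (p ^+ m).[x])).
        exact: continuous_expRN.
      exact: continuous_horner.
    by move=> t /p01/andP[h1 h2]; rewrite horner_exp ger0_norm ?exprn_ge0// exprn_ile1.
  have : \int[mu]_(t in `]0%R, +oo[) (c * rho' ^+ m * \1_B t - rho ^+ m * `|w t|) <=
         \int[mu]_(t in `]0%R, +oo[) (w t * (p ^+ m).[expR (- t)]).
    apply: le_Rintegral => //; first exact: integrable_subr.
    move=> t; rewrite /= in_itv/= andbT => t_gt0; rewrite horner_exp.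
    have /andP[p0 p1] := p01 _ t_gt0.
    have [tr|tr] := ltP `|t - t0| r; last first.
      have tB : t \in B = false by rewrite BP; apply/negbTE; rewrite -leNgt (le_trans r'r).
      rewrite indicE tB mulr0 sub0r.
      have h1 : p.[expR (- t)] ^+ m <= rho ^+ m by rewrite lerXn2r ?nnegrE// pfar.
      have h2 : 0 <= p.[expR (- t)] ^+ m by rewrite exprn_ge0.
      have := ler_norm (- w t); rewrite normrN => h3; have h4 := normr_ge0 (w t).
      have : `|w t| * p.[expR (- t)] ^+ m <= `|w t| * rho ^+ m by rewrite ler_wpM2l.
      nra.
    have wc := wr _ tr; rewrite -/c in wc.
    have rm : 0 <= rho ^+ m * `|w t| by rewrite mulr_ge0// exprn_ge0.
    have pm : 0 <= p.[expR (- t)] ^+ m by rewrite exprn_ge0.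
    rewrite indicE BP; case: ltP => tr' /=; last first.
      rewrite mulr0 sub0r; apply: (@le_trans _ _ 0); first by rewrite oppr_le0.
      by rewrite mulr_ge0// (le_trans (ltW c0)).
    rewrite mulr1 lerBlDr -[leLHS]addr0 lerD// ler_pM ?(ltW c0) ?exprn_ge0 ?(ltW rho'0)//.
    by rewrite lerXn2r ?nnegrE ?(ltW rho'0)// pnear.
  have i1 : mu.-integrable `]0%R, +oo[ (EFin \o \1_B).
    apply: (eq_integrable_real mpos (integrable_mulrl mpos (c * rho' ^+ m)^-1 iB)) => t _.
    by rewrite mulKf// mulf_neq0 ?lt0r_neq0// exprn_gt0.
  rewrite hp RintegralB// RintegralZl// RintegralZl//; last exact: integrable_norm iw.
  have -> : \int[mu]_(t in `]0%R, +oo[) (\1_B t) = r' + r'.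
    rewrite /Rintegral integral_indic//; last exact: measurable_itv.
    rewrite setIidl; last first.
      move=> t; rewrite /B/= !in_itv/= andbT => /andP[h _]; lra.
    have e : mu B = (r' + r')%:E.
      rewrite /B lebesgue_measure_itv/= lte_fin ifT; last lra.
      by rewrite -EFinB; congr EFin; ring.
    exact: (congr1 fine e).
  rewrite subr_le0 => h; rewrite [leLHS](_ : _ = c * rho' ^+ m * (r' + r'))//; ring.
(* Dividing by [M + 1] rather than [M] avoids a possibly zero denominator. *)
have M1 : 0 < M + 1 by rewrite ltr_wpDl.
have q1 : `|rho / rho'| < 1.
  by rewrite ger0_norm ?divr_ge0 ?(ltW rho'0)// ltr_pdivrMr// mul1r.
have /cvgrPdist_lt/(_ (c * (r' + r') / (M + 1))) : (rho / rho') ^+ m @[m --> \oo] --> 0.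
  exact: cvg_expr.
case.
  by rewrite divr_gt0// mulr_gt0// addr_gt0.
move=> m _ /(_ m (leqnn m)); rewrite sub0r normrN ger0_norm ?exprn_ge0 ?divr_ge0 ?(ltW rho'0)//.
rewrite ltr_pdivlMr// expr_div_n mulrAC ltr_pdivrMr ?exprn_gt0// => h.
have := ineq m; rewrite leNgt => /negP; apply.
rewrite [ltRHS]mulrC; apply: le_lt_trans h.
by rewrite ler_wpM2l ?exprn_ge0// lerDl.
Qed.

(** Lerch's theorem from samples at s, s + 1, s + 2, ...: in the variable e^(-t) they are the
    moments of e^(-st) h(t), and the preceding sign result applies to both h and -h. *)
Lemma laplace_inj h s : (forall t, 0 < t -> {for t, continuous h}) ->
  mu.-integrable `]0%R, +oo[ (fun t => (expR (- (s * t)) * h t)%:E) ->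
  (forall k : nat, \int[mu]_(t in `]0%R, +oo[) (expR (- ((s + k%:R) * t)) * h t) = 0) ->
  forall t, 0 < t -> h t = 0.
Proof.
move=> ch ih hk.
have main h1 : (forall t, 0 < t -> {for t, continuous h1}) ->
  mu.-integrable `]0%R, +oo[ (fun t => (expR (- (s * t)) * h1 t)%:E) ->
  (forall k : nat, \int[mu]_(t in `]0%R, +oo[) (expR (- ((s + k%:R) * t)) * h1 t) = 0) ->
  forall t, 0 < t -> h1 t <= 0.
  move=> ch1 ih1 hk1 t t0.
  have := @laplace_eq0_le0 (fun t => expR (- (s * t)) * h1 t) _ ih1 _ t t0.
  rewrite pmulr_rle0 ?expR_gt0//; apply.
    by move=> x x0; apply: cvgM; [exact: continuous_expRM|exact: ch1].
  move=> k; rewrite -[RHS](hk1 k); apply: eq_Rintegral => x _.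
  by rewrite -expRM_natl mulrAC -expRD; congr (expR _ * _); ring.
move=> t t0; apply/eqP; rewrite eq_le main//=.
rewrite -oppr_le0; apply: (main (fun t => - h t)) => //.
- by move=> x x0; apply: cvgN; exact: ch.
- have := @eq_integrable_real _ _ _ mu pos mpos _ (fun t => expR (- (s * t)) * - h t) (integrable_oppr mpos ih).
  by apply => x _; rewrite mulrN.
- move=> k; under eq_Rintegral do rewrite mulrN -mulN1r.
  rewrite RintegralZl//; first by rewrite hk mulr0.
  apply: (@eq_integrable_real _ _ _ mu pos mpos (fun t => (expR (- (s * t)) * h t) * expR (- (k%:R * t)))); last first.
    by move=> x _; rewrite mulrAC -expRD; congr (expR _ * _); ring.
  apply: (@integrable_mul_bounded _ _ 1) => //.
    by apply: measurable_funTS; apply: continuous_measurable_fun; exact: continuous_expRM.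
  by move=> x x0; rewrite ger0_norm ?expR_ge0// expR_le1 oppr_le0 mulr_ge0// ltW.
Qed.

End laplace_uniqueness.

(** * Laplace transform of Caputo derivatives *)

Section laplace_transform.
Context {R : realType}.
Local Notation mu := (@lebesgue_measure R).
Implicit Types (f g q : R -> R) (a b c s t x y m : R).

Let mpos : measurable (`]0%R, +oo[%classic : set (measurableTypeR R)) := @measurable_pos R.

Lemma integrable_expR s : 0 < s -> mu.-integrable `]0%R, +oo[ (fun t => (expR (- (s * t)))%:E).
Proof.
move=> s0; apply/integrableP; split.
  by apply/measurable_EFinP; apply: measurable_funTS; apply: continuous_measurable_fun; exact: continuous_expRM.
have := laplace_powR (@ltr01 R) s0; under eq_integral do rewrite subrr powRr0 mulr1.
move=> h; under eq_integral do rewrite gee0_abs ?lee_fin ?expR_ge0//.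
by rewrite h ltry.
Qed.

Section convolution.
Variables (b s : R) (q : R -> R).
Hypotheses (b0 : 0 < b) (s0 : 0 < s).

(** Extending the power kernel and [q] by zero turns the convolution over 0 < x < t into an integral
    over the whole line, so Fubini can be applied on the full plane. *)
Let phi : R -> R := (fun x => x `^ (b - 1)) \_ `]0%R, +oo[.
Let q' : R -> R := q \_ `]0%R, +oo[.

Let phi_pos x : 0 < x -> phi x = x `^ (b - 1).
Proof. by move=> x0; rewrite /phi patchE mem_set//= in_itv/= x0. Qed.

Let phi_npos x : x <= 0 -> phi x = 0.
Proof. by move=> x0; rewrite /phi patchE memNset//= in_itv/= andbT => /lt_geF; rewrite x0. Qed.

Let q'_pos x : 0 < x -> q' x = q x.
Proof. by move=> x0; rewrite /q' patchE mem_set//= in_itv/= x0. Qed.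

Let q'_npos x : x <= 0 -> q' x = 0.
Proof. by move=> x0; rewrite /q' patchE memNset//= in_itv/= andbT => /lt_geF; rewrite x0. Qed.

Let C := Gamma b * s `^ (- b).

Let shift c t : (\int[mu]_x (expR (- (s * x)) * phi (x - t) * c)%:E = (C * expR (- (s * t)) * c)%:E)%E.
Proof.
transitivity (\int[mu]_(x in `]t, +oo[) (c%:E * (expR (- (s * x)) * (x - t) `^ (b - 1))%:E))%E.
  rewrite [RHS]integral_mkcond; apply: eq_integral => x _; rewrite patchE.
  case: (ltP t x) => tx.
    by rewrite mem_set/= ?in_itv/= ?tx// phi_pos ?subr_gt0// -EFinM mulrC.
  rewrite memNset/= ?in_itv/= ?andbT; last by apply/negP; rewrite -leNgt.
  by rewrite phi_npos ?subr_le0// mulr0 mul0r.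
have sh := laplace_powR_shift t b0 s0.
rewrite integralZl; first by rewrite sh -EFinM /C; congr EFin; ring.
  exact: measurable_itv.
apply/integrableP; split.
  apply/measurable_EFinP; apply: measurable_funM; apply: measurable_funTS.
    by apply: continuous_measurable_fun; exact: continuous_expRM.
  apply: (measurableT_comp (f := fun y : R => y `^ (b - 1))); first exact: measurable_powR.
  exact: measurable_funB.
under eq_integral do rewrite gee0_abs ?lee_fin ?mulr_ge0 ?powR_ge0 ?expR_ge0//.
by rewrite sh ltry.
Qed.

(** Fubini for e^(-sx) phi(x - t) q'(t): integrating in x first gives C e^(-st) q(t), and the same
    with absolute values yields integrability on the plane. The integrability on each ]0, t[ makes
    the other iterated integral equal to [cv] at every t, not merely almost everywhere. *)
Lemma laplace_convolution :
  mu.-integrable `]0%R, +oo[ (fun t => (expR (- (s * t)) * q t)%:E) ->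
  (forall t, 0 < t -> mu.-integrable `]0%R, t[ (fun x => ((t - x) `^ (b - 1) * q x)%:E)) ->
  let cv t := \int[mu]_(x in `]0%R, t[) ((t - x) `^ (b - 1) * q x) in
  mu.-integrable `]0%R, +oo[ (fun t => (expR (- (s * t)) * cv t)%:E) /\
  \int[mu]_(t in `]0%R, +oo[) (expR (- (s * t)) * cv t) =
  Gamma b * s `^ (- b) * \int[mu]_(t in `]0%R, +oo[) (expR (- (s * t)) * q t).
Proof.
move=> iq iqt cv.
have mq : measurable_fun (`]0%R, +oo[ : set R) q.
  have : measurable_fun (`]0%R, +oo[ : set R) (fun t => expR (s * t) * (expR (- (s * t)) * q t)).
    apply: measurable_funM.
      apply: measurable_funTS; exact: (measurableT_comp (f := @expR R)).
    by apply/measurable_EFinP; exact: (measurable_int _ iq).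
  apply: eq_measurable_fun => x _.
  by rewrite mulrA -expRD subrr expR0 mul1r.
have mq' : measurable_fun setT q' by apply: (measurable_restrictT _ mpos).1.
have mphi : measurable_fun setT phi.
  apply: (measurable_restrictT _ mpos).1; apply: pos_continuous_measurable => x.
  exact: continuous_powR.
pose K (z : R * R) : R := expR (- (s * z.1)) * phi (z.1 - z.2) * q' z.2.
have mK : measurable_fun setT K.
  apply: measurable_funM; last exact: measurableT_comp.
  apply: measurable_funM.
    apply: (measurableT_comp (f := fun x : R => expR (- (s * x)))) => //.
    by apply: continuous_measurable_fun; exact: continuous_expRM.
  by apply: measurableT_comp => //; exact: measurable_funB.
have EG t : (\int[mu]_x (K (x, t))%:E = ((fun t => (C * (expR (- (s * t)) * q t))%:E) \_ `]0%R, +oo[) t)%E.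
  rewrite /K/= shift patchE; case: (ltP 0 t) => t0.
    by rewrite mem_set/= ?in_itv/= ?t0// q'_pos// mulrA.
  rewrite memNset/= ?in_itv/= ?andbT; last by apply/negP; rewrite -leNgt.
  by rewrite q'_npos// mulr0.
have EGa t : (\int[mu]_x `|(K (x, t))%:E| = ((fun t => `|(C * (expR (- (s * t)) * q t))%:E|) \_ `]0%R, +oo[) t)%E.
  transitivity (\int[mu]_x (expR (- (s * x)) * phi (x - t) * `|q' t|)%:E)%E.
    apply: eq_integral => x _ /=; rewrite normrM ger0_norm// mulr_ge0 ?expR_ge0//.
    by have [xt|xt] := ltP 0 (x - t); [rewrite phi_pos// powR_ge0|rewrite phi_npos].
  rewrite shift patchE; case: (ltP 0 t) => t0.
    rewrite mem_set/= ?in_itv/= ?t0// q'_pos// mulrA normrM ger0_norm//.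
    by rewrite !mulr_ge0 ?expR_ge0 ?powR_ge0 ?(ltW (gamma_gt0 _)).
  rewrite memNset/= ?in_itv/= ?andbT; last by apply/negP; rewrite -leNgt.
  by rewrite q'_npos// normr0 mulr0.
have EF t : (\int[mu]_x (K (t, x))%:E = ((fun t => (expR (- (s * t)) * cv t)%:E) \_ `]0%R, +oo[) t)%E.
  rewrite patchE; case: (ltP 0 t) => t0; last first.
    rewrite memNset/= ?in_itv/= ?andbT; last by apply/negP; rewrite -leNgt.
    rewrite (eq_integral (fun=> 0%E)) ?integral0// => x _; rewrite /K/=.
    have [x0|x0] := ltP 0 x; last by rewrite q'_npos// mulr0.
    by rewrite phi_npos ?mulr0 ?mul0r//; lra.
  rewrite mem_set/= ?in_itv/= ?t0//.
  transitivity (\int[mu]_(x in `]0%R, t[) ((expR (- (s * t)))%:E * ((t - x) `^ (b - 1) * q x)%:E))%E.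
    rewrite [RHS]integral_mkcond; apply: eq_integral => x _; rewrite patchE /K/=.
    case: (boolP (x \in _)) => [|].
      rewrite inE/= in_itv/= => /andP[x0 xt].
      by rewrite phi_pos ?subr_gt0// q'_pos// -EFinM mulrA.
    rewrite notin_setE/= in_itv/= => /negP; rewrite negb_and -!leNgt => /orP[x0|tx].
      by rewrite q'_npos// mulr0.
    by rewrite phi_npos ?subr_le0// mulr0 mul0r.
  rewrite integralZl//; last exact: iqt.
  by rewrite EFin_Rintegral//; exact: iqt.
have iCq : mu.-integrable `]0%R, +oo[ (fun t => (C * (expR (- (s * t)) * q t))%:E).
  exact: (integrable_mulrl mpos).
have iK : (mu \x mu)%E.-integrable setT (EFin \o K).
  apply/integrable21ltyP; first exact/measurable_EFinP.
  under eq_integral do rewrite /= EGa.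
  rewrite -integral_mkcond.
  by have /integrableP[] := iCq.
have iF : mu.-integrable setT (fubini_F mu (EFin \o K)) := integrable_fubini_F iK.
have FE : fubini_F mu (EFin \o K) = ((fun t => (expR (- (s * t)) * cv t)%:E) \_ `]0%R, +oo[).
  by apply/funext => t; rewrite /fubini_F/= EF.
rewrite FE in iF; have icv := (integrable_mkcond _ mpos).2 iF.
split => //; have := Fubini iK; rewrite /=.
under eq_integral do rewrite EF; rewrite -integral_mkcond.
under [X in _ = X -> _]eq_integral do rewrite EG; rewrite -integral_mkcond.
rewrite (EFin_Rintegral mpos)// (EFin_Rintegral mpos)// => -[->].
by rewrite RintegralZl.
Qed.

End convolution.

Lemma laplace_derive g g' s (g0 : R) :
  (forall x, 0 < x -> is_derive x 1 g (g' x)) ->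
  (forall x, 0 < x -> {for x, continuous g'}) ->
  mu.-integrable `]0%R, +oo[ (fun t => (expR (- (s * t)) * g t)%:E) ->
  mu.-integrable `]0%R, +oo[ (fun t => (expR (- (s * t)) * g' t)%:E) ->
  g x @[x --> 0^'+] --> g0 -> expR (- (s * x)) * g x @[x --> +oo] --> 0 ->
  \int[mu]_(t in `]0%R, +oo[) (expR (- (s * t)) * g' t) =
  s * (\int[mu]_(t in `]0%R, +oo[) (expR (- (s * t)) * g t)) - g0.
Proof.
move=> dg cg' ig ig' g0l gy.
pose f' x := expR (- (s * x)) * g' x - s * (expR (- (s * x)) * g x).
have cE x : {for x, continuous (fun x => expR (- (s * x)))} by exact: continuous_expRM.
have cg x : 0 < x -> {for x, continuous g} by move=> /dg; exact: is_derive_continuous.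
have df x : 0 < x -> is_derive x 1 (fun x => expR (- (s * x)) * g x) (f' x).
  by move=> /dg dgx; apply: is_derive_eq; rewrite /f' /GRing.scale/=; ring.
have cf' x : 0 < x -> {for x, continuous f'}.
  move=> x0; apply: continuousB; first by apply: continuousM; [exact: cE|exact: cg'].
  by apply: continuousM; [exact: cst_continuous|apply: continuousM; [exact: cE|exact: cg]].
have isg := integrable_mulrl mpos s ig.
have if' : mu.-integrable `]0%R, +oo[ (EFin \o f') by exact: (integrable_subr mpos ig' isg).
have h0 : expR (- (s * x)) * g x @[x --> 0^'+] --> g0.
  rewrite -[X in _ --> X]mul1r; apply: cvgM => //.
  have := cE 0; rewrite /prop_for/continuous_at mulr0 oppr0 expR0.
  exact: cvg_at_right_filter.
have := integral_derive_pos df cf' if' h0 gy.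
rewrite (EFin_Rintegral mpos)// sub0r => -[].
rewrite RintegralB// RintegralZl// => /eqP; rewrite subr_eq => /eqP ->.
by rewrite addrC.
Qed.

Lemma bounded_near_zero g (l T : R) : (forall x, 0 < x -> {for x, continuous g}) ->
  g x @[x --> 0^'+] --> l -> exists M, forall x, 0 < x -> x <= T -> `|g x| <= M.
Proof.
move=> cg /cvgrPdist_le/(_ 1 ltr01)[d/= d0 gd].
have gd' x : 0 < x -> x < d -> `|g x| <= `|l| + 1.
  move=> x0 xd; have := gd x; rewrite /ball_/= sub0r normrN ger0_norm ?(ltW x0)// => /(_ xd x0).
  rewrite distrC => h; rewrite -[g x](subrK l) addrC; apply: (le_trans (ler_normD _ _)).
  by rewrite lerD2l.
have [Td|dT] := ltP T d.
  by exists (`|l| + 1) => x x0 xT; apply: gd' => //; exact: le_lt_trans Td.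
have d20 : 0 < d / 2 by rewrite divr_gt0.
have dT2 : d / 2 <= T by lra.
have cag : {within `[d / 2, T], continuous (fun x => `|g x|)}.
  apply: (pos_continuous_within d20) => x x0.
  by apply: continuous_comp; [exact: cg|exact: norm_continuous].
have [c cI cM] := EVT_max dT2 cag.
exists (Num.max (`|l| + 1) `|g c|) => x x0 xT; rewrite le_max.
have [xd|dx] := ltP x d; first by rewrite gd'.
by rewrite cM ?orbT// in_itv/= xT andbT; lra.
Qed.

Lemma integrable_near_zero g (l T : R) : (forall x, 0 < x -> {for x, continuous g}) ->
  g x @[x --> 0^'+] --> l -> mu.-integrable `]0%R, T[ (EFin \o g).
Proof.
move=> cg gl; have [M gM] := bounded_near_zero T cg gl.
have mT : measurable (`]0%R, T[%classic : set (measurableTypeR R)) by exact: measurable_itv.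
have fT : (mu `]0%R, T[ < +oo)%E.
  by rewrite lebesgue_measure_itv/=; case: ifP => // _; rewrite -EFinB ltry.
apply: measurable_bounded_integrable => //.
- apply: measurable_funS mpos _ (pos_continuous_measurable cg) => x/=.
  by rewrite !in_itv/= andbT => /andP[].
- exists M; split; first by rewrite num_real.
  move=> M' MM' x/=; rewrite in_itv/= => /andP[x0 xT].
  by rewrite (le_trans (gM _ x0 (ltW xT)))// ltW.
Qed.

(** The limit at exponent m gives |g(x)| <= e^(mx) only from some T on, where e^(-(s-m)x) is a
    majorant; below T the local integrability takes over, as e^(-sx) <= 1. *)
Lemma integrable_expR_mul g m s : (forall x, 0 < x -> {for x, continuous g}) ->
  m < s -> expR (- (m * x)) * g x @[x --> +oo] --> 0 ->
  (forall T, 0 < T -> mu.-integrable `]0%R, T[ (EFin \o g)) -> 0 <= s ->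
  mu.-integrable `]0%R, +oo[ (fun t => (expR (- (s * t)) * g t)%:E).
Proof.
move=> cg ms gy ig s0.
have [T [T0 gT]] : exists T, 0 < T /\ forall x, T <= x -> `|g x| <= expR (m * x).
  move/cvgrPdist_le : gy => /(_ 1 ltr01)[T [Tr gT]].
  exists (Num.max 1 (T + 1)); split; first by rewrite lt_max ltr01.
  move=> x; rewrite ge_max => /andP[x1 xT].
  have /gT : T < x by lra.
  rewrite sub0r normrN normrM ger0_norm ?expR_ge0// expRN mulrC ler_pdivrMr ?expR_gt0//.
  by rewrite mul1r.
have mT : measurable (`]0%R, T[%classic : set (measurableTypeR R)) by exact: measurable_itv.
pose g1 : R -> R := (fun x => `|g x|) \_ `]0%R, T[.
have ig1 : mu.-integrable `]0%R, +oo[ (EFin \o g1).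
  have : mu.-integrable setT ((EFin \o (fun x => `|g x|)) \_ `]0%R, T[).
    by apply/(integrable_mkcond _ mT); apply: integrable_norm; exact: ig.
  move=> /(integrableS measurableT mpos (@subsetT _ _)).
  by apply: eq_integrable => // x _; rewrite /g1 /= !patchE; case: ifPn.
have ie : mu.-integrable `]0%R, +oo[ (fun t => (expR (- ((s - m) * t)))%:E).
  by apply: integrable_expR; lra.
apply: (le_integrable mpos) (integrable_addr mpos ig1 ie).
  apply/measurable_EFinP; apply: pos_continuous_measurable => x x0.
  by apply: continuousM; [exact: continuous_expRM|exact: cg].
move=> x; rewrite /= in_itv/= andbT => x0; rewrite lee_fin.
have g10 : 0 <= g1 x by rewrite /g1 patchE; case: ifPn.
rewrite normrM ger0_norm ?expR_ge0// [leRHS]ger0_norm ?addr_ge0 ?expR_ge0//.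
have [xT|Tx] := ltP x T.
  rewrite -[leLHS]addr0 lerD ?expR_ge0// /g1 patchE mem_set/= ?in_itv/= ?x0//.
  by rewrite ler_piMl// expR_le1 oppr_le0 mulr_ge0// ltW.
rewrite -[leLHS]add0r lerD//.
have -> : - ((s - m) * x) = - (s * x) + m * x by ring.
by rewrite expRD ler_wpM2l ?expR_ge0// gT.
Qed.

Lemma derive1n_is_derive f : (forall (l : nat) t, 0 < t -> derivable (derive1n l f) t 1) ->
  forall (l : nat) x, 0 < x -> is_derive x 1 (derive1n l f) (derive1n l.+1 f x).
Proof.
move=> df l x x0; split; first exact: df.
by rewrite derive1nS derive1E.
Qed.

Lemma derive1n_continuous f : (forall (l : nat) t, 0 < t -> derivable (derive1n l f) t 1) ->
  forall (l : nat) x, 0 < x -> {for x, continuous (derive1n l f)}.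
Proof.
by move=> df l x x0; apply/differentiable_continuous/derivable1_diffP/df.
Qed.

Lemma laplace_derive1n f s (fl : nat -> R) (k : nat) :
  (forall (l : nat) t, 0 < t -> derivable (derive1n l f) t 1) ->
  (forall l : nat, (l < k)%N -> derive1n l f x @[x --> (0 : R)^'+] --> fl l) ->
  (forall l : nat, (l <= k)%N ->
    mu.-integrable `]0%R, +oo[ (fun t => (expR (- (s * t)) * derive1n l f t)%:E)) ->
  (forall l : nat, expR (- (s * x)) * derive1n l f x @[x --> +oo] --> 0) ->
  \int[mu]_(t in `]0%R, +oo[) (expR (- (s * t)) * derive1n k f t) =
  s ^+ k * (\int[mu]_(t in `]0%R, +oo[) (expR (- (s * t)) * f t)) -
  \sum_(l < k) s ^+ (k.-1 - l) * fl l.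
Proof.
move=> df + + fy; elim: k => [_ _|k IH fl0 fi]; first by rewrite big_ord0 subr0 mul1r.
have fl0' l : (l < k)%N -> derive1n l f x @[x --> (0 : R)^'+] --> fl l.
  by move=> lk; apply: fl0; exact: ltnW.
have fi' l : (l <= k)%N -> mu.-integrable `]0%R, +oo[ (fun t => (expR (- (s * t)) * derive1n l f t)%:E).
  by move=> lk; apply: fi; exact: leqW.
rewrite (laplace_derive (@derive1n_is_derive f df k) (@derive1n_continuous f df k.+1) _ _ (fl0 k _) (fy k))//; last 2 first.
- exact: fi'.
- exact: fi.
rewrite IH// big_ord_recr/= subnn expr0 mul1r mulrBr mulrA -exprS opprD addrA.
congr (_ - _ - _); rewrite mulr_sumr; apply: eq_bigr => i _.
rewrite mulrA -exprS; congr (s ^+ _ * _).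
by case: (k) i => [[]//|k' i]; rewrite /= subSn// -ltnS.
Qed.

End laplace_transform.

(** * From ordinary derivatives to Caputo derivatives and to the whole equation *)

Section laplace_caputo.
Context {R : realType}.
Local Notation mu := (@lebesgue_measure R).
Implicit Types (f g q : R -> R) (a b c s t x y m : R).

Let mpos : measurable (`]0%R, +oo[%classic : set (measurableTypeR R)) := @measurable_pos R.

Lemma cvg_expRM_y c : 0 < c -> expR (- (c * x)) @[x --> +oo] --> (0 : R).
Proof.
move=> c0; apply: (@cvg_comp _ _ _ (fun x : R => c * x) (fun x => expR (- x)) _ +oo).
  apply/cvgryPge => A; near=> x.
  have Ax : A / c <= x by near: x; apply: nbhs_pinfty_ge; rewrite num_real.
  by rewrite mulrC -ler_pdivrMr.
exact: cvgr_expR.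
Unshelve. all: end_near. Qed.

Lemma ceiln_ge0E a : 0 <= a -> (ceiln a)%:R = (Num.ceil a)%:~R :> R.
Proof.
move=> a0; rewrite /ceiln natr_absz ger0_norm// -(@ler_int R) (le_trans a0)//.
exact: ceil_ge.
Qed.

Lemma ceiln_natr (j : nat) : ceiln (j%:R : R) = j.
Proof. by apply/eqP; rewrite -(eqr_nat R) ceiln_ge0E// [X in Num.ceil X]pmulrn intrKceil -pmulrn. Qed.

Lemma ceiln_nonnat a : 0 <= a -> a \isn't a Num.nat -> 0 < (ceiln a)%:R - a < 1.
Proof.
move=> a0 an; rewrite subr_gt0 lt_neqAle ltrBlDr; apply/andP; split; last first.
  by rewrite ceiln_ge0E// addrC; have /andP[+ _] := ceil_itv a; rewrite intrD; lra.
rewrite [X in _ && (_ <= X)]ceiln_ge0E// ceil_ge andbT.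
by apply: contraNneq an => ->; rewrite natr_nat.
Qed.

(** With b = ceil(a) - a in ]0, 1[, the kernel (t - s)^(b-1) is at least t^(b-1) on ]0, t[, so the
    Caputo integrand controls the derivative it contains. No initial value is available for that
    derivative, and this replaces it near 0. *)
Lemma caputo_exists_integrable a f t : 0 <= a -> a \isn't a Num.nat ->
  (forall (l : nat) t, 0 < t -> derivable (derive1n l f) t 1) ->
  caputo_exists a f t -> mu.-integrable `]0%R, t[ (EFin \o derive1n (ceiln a) f).
Proof.
move=> a0 an df; rewrite /caputo_exists (negbTE an) => it.
have /andP[b0 b1] := ceiln_nonnat a0 an.
have mt : measurable (`]0%R, t[%classic : set (measurableTypeR R)) by exact: measurable_itv.
have mq : measurable_fun (`]0%R, t[ : set (measurableTypeR R)) (derive1n (ceiln a) f).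
  apply: (measurable_funS mpos _ (pos_continuous_measurable (@derive1n_continuous _ f df (ceiln a)))).
  by move=> x/=; rewrite !in_itv/= andbT => /andP[].
apply: (le_integrable mt) (integrable_mulrl mt (t `^ (1 - ((ceiln a)%:R - a))) it).
  exact/measurable_EFinP.
move=> x; rewrite /= in_itv/= => /andP[x0 xt]; rewrite lee_fin.
rewrite /caputo_integrand normrM normrM mulrA ger0_norm ?powR_ge0//.
rewrite [X in _ * X * _]ger0_norm ?powR_ge0// ler_peMl//.
have -> : (ceiln a)%:R - a - 1 = - (1 - ((ceiln a)%:R - a)) by ring.
rewrite powRN ler_pdivlMr ?powR_gt0 ?subr_gt0// mul1r.
by apply: ge0_ler_powR; rewrite ?nnegrE; lra.
Qed.

(** For non-integer a the Caputo derivative is a convolution of a power with the derivative of order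
    ceil(a), so its transform is s^(-b) times that of an ordinary derivative, with b = ceil(a) - a.
    For integer a nothing prescribed at 0 controls the derivative of order a, hence the separate
    last hypothesis. *)
Lemma laplace_caputo a f (fl : nat -> R) m s : 0 <= a ->
  (forall (l : nat) t, 0 < t -> derivable (derive1n l f) t 1) ->
  (forall l : nat, expR (- (m * x)) * derive1n l f x @[x --> +oo] --> 0) ->
  0 < m -> m < s ->
  mu.-integrable `]0%R, +oo[ (fun t => (expR (- (s * t)) * f t)%:E) ->
  (forall l : nat, (l < ceiln a)%N -> derive1n l f x @[x --> (0 : R)^'+] --> fl l) ->
  (forall t, 0 < t -> caputo_exists a f t) ->
  (a \is a Num.nat -> mu.-integrable `]0%R, +oo[
     (fun t => (expR (- (s * t)) * derive1n (Num.truncn a) f t)%:E)) ->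
  mu.-integrable `]0%R, +oo[ (fun t => (expR (- (s * t)) * caputo a f t)%:E) /\
  \int[mu]_(t in `]0%R, +oo[) (expR (- (s * t)) * caputo a f t) =
  s `^ a * (\int[mu]_(t in `]0%R, +oo[) (expR (- (s * t)) * f t)) -
  \sum_(l < ceiln a) s `^ (a - l%:R - 1) * fl l.
Proof.
move=> a0 df fy m0 ms if0 fl0 ce inat.
have s0 : 0 < s by exact: lt_trans ms.
have fys (l : nat) : expR (- (s * x)) * derive1n l f x @[x --> +oo] --> 0.
  have sm : 0 < s - m by lra.
  have -> : (fun x => expR (- (s * x)) * derive1n l f x) =
      (fun x => expR (- ((s - m) * x)) * (expR (- (m * x)) * derive1n l f x)).
    by apply/funext => x; rewrite mulrA -expRD; congr (expR _ * _); ring.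
  by rewrite -[X in _ --> X](mul0r 0); apply: cvgM => //; exact: cvg_expRM_y.
have ilow (l : nat) : (l < ceiln a)%N ->
    mu.-integrable `]0%R, +oo[ (fun t => (expR (- (s * t)) * derive1n l f t)%:E).
  move=> lk; apply: (@integrable_expR_mul _ _ m) (ltW s0) => //.
    exact: derive1n_continuous.
  by move=> T T0; apply: (integrable_near_zero T _ (fl0 l lk)); exact: derive1n_continuous.
have sumE : \sum_(l < ceiln a) s `^ ((ceiln a)%:R - l%:R - 1) * fl l =
    \sum_(l < ceiln a) s ^+ ((ceiln a).-1 - l) * fl l.
  apply: eq_bigr => l _; rewrite -powR_mulrn ?(ltW s0)//; congr (s `^ _ * _).
  have lk := ltn_ord l; rewrite natrB; last by rewrite -ltnS prednK// (leq_ltn_trans _ lk).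
  by rewrite -subn1 natrB ?(leq_ltn_trans _ lk)//; ring.
have [an|an] := boolP (a \is a Num.nat).
  have aE : a = (ceiln a)%:R by have /natrP[j ->] := an; rewrite ceiln_natr.
  have tE : Num.truncn a = ceiln a by apply/eqP; rewrite -(eqr_nat R) truncnK// -aE.
  have := inat an; rewrite /caputo an tE => ia; split => //.
  rewrite (@laplace_derive1n _ f s fl (ceiln a))//; last first.
    by move=> l; rewrite leq_eqVlt => /predU1P[->//|]; exact: ilow.
  by rewrite -sumE -powR_mulrn ?(ltW s0)// -aE.
have /andP[b0 b1] := ceiln_nonnat a0 an.
set b := (ceiln a)%:R - a in b0 b1 *.
have iq : mu.-integrable `]0%R, +oo[ (fun t => (expR (- (s * t)) * derive1n (ceiln a) f t)%:E).
  apply: (@integrable_expR_mul _ _ m) (ltW s0) => //.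
    exact: derive1n_continuous.
  by move=> T T0; apply: caputo_exists_integrable => //; exact: ce.
have ic t : 0 < t -> mu.-integrable `]0%R, t[
    (fun x => ((t - x) `^ (b - 1) * derive1n (ceiln a) f x)%:E).
  by move=> /ce; rewrite /caputo_exists (negbTE an).
have [icv Lcv] := laplace_convolution b0 s0 iq ic.
have cE t : expR (- (s * t)) * caputo a f t =
    (Gamma b)^-1 * (expR (- (s * t)) * (\int[mu]_(x in `]0%R, t[) ((t - x) `^ (b - 1) * derive1n (ceiln a) f x))).
  by rewrite /caputo (negbTE an) mulrCA.
split.
  apply: (eq_integrable_real mpos (integrable_mulrl mpos (Gamma b)^-1 icv)) => t _.
  by rewrite cE.
under eq_Rintegral do rewrite cE.
rewrite RintegralZl// Lcv !mulrA mulVf ?lt0r_neq0 ?gamma_gt0// mul1r.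
rewrite (@laplace_derive1n _ f s fl (ceiln a))//; last first.
  by move=> l; rewrite leq_eqVlt => /predU1P[->//|]; exact: ilow.
rewrite -sumE mulrBr mulrA; congr (_ * _ - _).
  rewrite -powR_mulrn ?(ltW s0)// -powRD; last by rewrite lt0r_neq0// implybT.
  by congr (_ `^ _); rewrite /b; ring.
rewrite mulr_sumr; apply: eq_bigr => l _; rewrite mulrA -powRD; last by rewrite lt0r_neq0// implybT.
by congr (_ `^ _ * _); rewrite /b; ring.
Unshelve. all: end_near. Qed.

Lemma ceiln_le a b : 0 <= a -> a <= b -> (ceiln a <= ceiln b)%N.
Proof.
move=> a0 ab; rewrite -(ler_nat R) !ceiln_ge0E ?(le_trans a0)// ler_int.
exact: ceil_le.
Qed.

Lemma ceiln_ge a : 0 <= a -> a <= (ceiln a)%:R.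
Proof. by move=> a0; rewrite ceiln_ge0E// ceil_ge. Qed.

(** The equation is integrated against e^(-st) term by term. The delicate point is that every term
    be integrable, which has a different source for each kind of order. *)
Lemma laplace_solves_caputo d (al : R) N (lam : nat -> R)
    (init : nat -> 'rV[R]_d -> R) F (x : 'rV[R]_d) :
  0 < al -> solves_caputo al N lam init F ->
  exists m : R, 0 < m /\ forall s, m < s ->
  mu.-integrable `]0%R, +oo[ (fun t => (expR (- (s * t)) * F t x)%:E) /\
  (\sum_(k < N.+1) lam k * s `^ (al * k%:R)) *
    (\int[mu]_(t in `]0%R, +oo[) (expR (- (s * t)) * F t x)) =
  \sum_(k < N.+1) lam k * (\sum_(l < ceiln (al * k%:R)) s `^ (al * k%:R - l%:R - 1) * init l x).
Proof.
move=> al0 [cF eqF initF]; have [m [m0 [df [iF fy]]]] := cF x.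
exists m; split => // s ms; have s0 : 0 < s by exact: lt_trans ms.
pose f := F^~ x.
have cf : forall y : R, 0 < y -> {for y, continuous f} by exact: (@derive1n_continuous _ f df 0).
have if0 : mu.-integrable `]0%R, +oo[ (fun t => (expR (- (s * t)) * f t)%:E).
  apply: (le_integrable mpos) iF.
    apply/measurable_EFinP; apply: pos_continuous_measurable => y y0.
    by apply: continuousM; [exact: continuous_expRM|exact: cf].
  move=> t; rewrite /= in_itv/= andbT => t0; rewrite lee_fin !normrM ler_wpM2r//.
  by rewrite !ger0_norm ?expR_ge0// ler_expR lerN2 ler_pM2r// ltW.
split=> //.
have ak0 (k : nat) : 0 <= al * k%:R by rewrite mulr_ge0// ltW.
have akN (k : nat) : (k <= N)%N -> (ceiln (al * k%:R) <= ceiln (N%:R * al))%N.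
  by move=> kN; apply: ceiln_le => //; rewrite mulrC ler_pM2r// ler_nat.
have fl0 (k : nat) : (k <= N)%N -> forall l : nat, (l < ceiln (al * k%:R))%N ->
    derive1n l f y @[y --> (0 : R)^'+] --> init l x.
  by move=> kN l lk; apply: initF; exact: leq_trans lk (akN _ kN).
have ilow (l : nat) : (l < ceiln (N%:R * al))%N ->
    mu.-integrable `]0%R, +oo[ (fun t => (expR (- (s * t)) * derive1n l f t)%:E).
  move=> lk; apply: (@integrable_expR_mul _ _ m) (ltW s0) => //.
    exact: derive1n_continuous.
  move=> T T0; apply: (integrable_near_zero T _ (initF l x lk)).
  exact: derive1n_continuous.
have ce (k : nat) : (k <= N)%N -> forall t, 0 < t -> caputo_exists (al * k%:R) f t.
  by move=> kN t t0; have [+ _] := eqF t x t0; apply.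
have step (k : nat) : (k <= N)%N -> (al * k%:R \is a Num.nat ->
    mu.-integrable `]0%R, +oo[ (fun t => (expR (- (s * t)) * derive1n (Num.truncn (al * k%:R)) f t)%:E)) ->
  mu.-integrable `]0%R, +oo[ (fun t => (expR (- (s * t)) * caputo (al * k%:R) f t)%:E) /\
  \int[mu]_(t in `]0%R, +oo[) (expR (- (s * t)) * caputo (al * k%:R) f t) =
  s `^ (al * k%:R) * (\int[mu]_(t in `]0%R, +oo[) (expR (- (s * t)) * f t)) -
  \sum_(l < ceiln (al * k%:R)) s `^ (al * k%:R - l%:R - 1) * init l x.
  move=> kN ik; apply: (@laplace_caputo _ f (init^~ x) m s) => //.
  - exact: fl0.
  - exact: ce.
(* An integer order al k with k < N is strictly below ceil(N al), so an initial value is prescribed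
   for that very derivative. *)
have stepN (k : nat) : (k < N)%N -> al * k%:R \is a Num.nat ->
    mu.-integrable `]0%R, +oo[ (fun t => (expR (- (s * t)) * derive1n (Num.truncn (al * k%:R)) f t)%:E).
  move=> kN kn; apply: ilow; rewrite -(ltr_nat R) truncnK//.
  apply: lt_le_trans (ceiln_ge _); last by rewrite mulr_ge0// ltW.
  by rewrite mulrC ltr_pM2r// ltr_nat.
pose D (k : 'I_N.+1) t := lam k * (expR (- (s * t)) * caputo (al * k%:R) f t).
have main (k : 'I_N.+1) : mu.-integrable `]0%R, +oo[ (EFin \o D k) /\
  \int[mu]_(t in `]0%R, +oo[) D k t = lam k * (s `^ (al * k%:R) * (\int[mu]_(t in `]0%R, +oo[) (expR (- (s * t)) * f t)) -
  \sum_(l < ceiln (al * k%:R)) s `^ (al * k%:R - l%:R - 1) * init l x).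
  (* A vanishing coefficient is treated apart, since the top integer order is recovered below by
     dividing by [lam k]. *)
  have [k0|k0] := eqVneq (lam k) 0.
    split; last first.
      rewrite k0 mul0r; under eq_Rintegral do rewrite /D k0 mul0r.
      by rewrite /Rintegral integral0.
    apply: (@eq_integrable_real _ _ _ mu _ mpos (fun=> 0)); first exact: integrable0.
    by move=> t _; rewrite /D k0 mul0r.
  (* For the top order only the equation itself gives integrability of the integer derivative. *)
  suff ik : al * k%:R \is a Num.nat ->
    mu.-integrable `]0%R, +oo[ (fun t => (expR (- (s * t)) * derive1n (Num.truncn (al * k%:R)) f t)%:E).
    have [i1 e1] := step k (leq_ord k) ik.
    split; first exact: (integrable_mulrl mpos).
    by rewrite RintegralZl// e1.
  have [kN|] := ltnP k N; first exact: stepN.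
  move=> Nk kn; have kE : k = ord_max.
    by apply/val_inj/eqP; rewrite eqn_leq Nk leq_ord.
  have [iS _] := @Rintegral_sum _ _ _ mu _ mpos _ (index_enum 'I_N) predT
    (fun (j : 'I_N) t => lam j * (expR (- (s * t)) * caputo (al * j%:R) f t))
    (fun j => integrable_mulrl mpos _ (step j (ltnW (ltn_ord j)) (stepN j (ltn_ord j))).1).
  apply: (eq_integrable_real mpos (integrable_mulrl mpos (- (lam k)^-1) iS)) => t.
  rewrite /= in_itv/= andbT => t0.
  have [_] := eqF t x t0; rewrite big_ord_recr/= => /eqP; rewrite addr_eq0 => /eqP e.
  under eq_bigr do rewrite mulrCA.
  have e' : \sum_(i < N) lam i * caputo (al * i%:R) f t = - (lam N * caputo (al * N%:R) f t) := e.
  have -> : derive1n (Num.truncn (al * k%:R)) f t = caputo (al * k%:R) f t by rewrite /caputo kn.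
  have kN : k = N :> nat by rewrite kE.
  rewrite -mulr_sumr e'; rewrite kN in k0 *.
  by field.
have [_ ] := @Rintegral_sum _ _ _ mu _ mpos _ (index_enum 'I_N.+1) predT D (fun k => (main k).1).
have -> : \int[mu]_(t in `]0%R, +oo[) (\sum_(i < N.+1) D i t) = 0.
  rewrite (@eq_Rintegral _ _ _ mu _ (fun=> 0)); first by rewrite /Rintegral integral0.
  move=> t; rewrite inE/= in_itv/= andbT => t0; rewrite /D.
  under eq_bigr do rewrite mulrCA.
  by have [_ e] := eqF t x t0; rewrite -mulr_sumr e mulr0.
under eq_bigr do rewrite (main _).2 mulrBr mulrA.
rewrite sumrB -mulr_suml => /esym/eqP; rewrite subr_eq0 => /eqP.
exact.
Qed.

End laplace_caputo.

(** * Expectations of products and the multiplication formula *)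

Section independence.
Context {R : realType}.
Local Notation mu := (@lebesgue_measure R).

Let mpos : measurable (`]0%R, +oo[%classic : set (measurableTypeR R)) := @measurable_pos R.

Lemma measurable_indic_itv (i : interval R) : measurable_fun setT (\1_[set` i] : R -> R).
Proof. by apply: measurable_indic; exact: measurable_itv. Qed.

Section layer_cake.
Context d (T : measurableType d) (rho : {sigma_finite_measure set T -> \bar R}).
Variables X W : T -> R.
Hypotheses (mX : measurable_fun setT X) (mW : measurable_fun setT W).
Hypotheses (X0 : forall w, 0 <= X w) (W0 : forall w, 0 <= W w).

Let K (z : T * R) : \bar R := (\1_`]0%R, +oo[ z.2 * \1_`]0%R, +oo[ (X z.1 - z.2) * W z.1)%:E.

Let mK : measurable_fun setT K.
Proof.
apply/measurable_EFinP; apply: measurable_funM; last exact: measurableT_comp.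
apply: measurable_funM; first by apply: measurableT_comp => //; exact: measurable_indic_itv.
apply: (measurableT_comp (f := \1_`]0%R, +oo[ : R -> R)); first exact: measurable_indic_itv.
by apply: measurable_funB => //; exact: measurableT_comp.
Qed.

Let K0 z : (0 <= K z)%E.
Proof. by rewrite lee_fin !mulr_ge0// indicE ler0n. Qed.

Let KE r : ((fun r => \int[rho]_w (\1_`]r, +oo[ (X w) * W w)%:E) \_ `]0%R, +oo[)%E r =
  (\int[rho]_w K (w, r))%E.
Proof.
rewrite patchE; case: (ltP 0 r) => r0.
  rewrite mem_set/= ?in_itv/= ?r0//; apply: eq_integral => w _.
  by rewrite /K/= !indicE !mem_setE !in_itv/= !andbT r0 mul1r subr_gt0.
rewrite memNset/= ?in_itv/= ?andbT; last by apply/negP; rewrite -leNgt.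
rewrite (eq_integral (fun=> 0%E)) ?integral0// => w _.
by rewrite /K/= !indicE mem_setE in_itv/= andbT ltNge r0 !mul0r.
Qed.

Lemma measurable_layer_cake : measurable_fun (`]0%R, +oo[ : set (measurableTypeR R))
  (fun r => \int[rho]_w (\1_`]r, +oo[ (X w) * W w)%:E)%E.
Proof.
apply/(measurable_restrictT _ mpos).
rewrite (_ : _ \_ _ = fun r => (\int[rho]_w K (w, r))%E); last exact/funext.
exact: (@measurable_fun_fubini_tonelli_G _ _ _ _ R rho K).
Qed.

(** X is the integral over r > 0 of the indicator of X > r; then Tonelli. The weight W lets one
    factor of a product be replaced while the others stay, and also lets W be a density. *)
Lemma layer_cake : (\int[rho]_w (X w * W w)%:E =
  \int[mu]_(r in `]0%R, +oo[) \int[rho]_w (\1_`]r, +oo[ (X w) * W w)%:E)%E.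
Proof.
rewrite [RHS]integral_mkcond; under [RHS]eq_integral do rewrite KE.
rewrite -(@fubini_tonelli _ _ _ _ R rho mu K)//; apply: eq_integral => w _.
transitivity (\int[mu]_r ((W w)%:E * (\1_`]0%R, X w[ r)%:E))%E; last first.
  apply: eq_integral => r _; rewrite /K/= -EFinM mulrC; congr (_ * _)%:E.
  rewrite !indicE !mem_setE !in_itv/= !andbT subr_gt0.
  by case: (0 < r); rewrite ?mul1r ?mul0r.
rewrite ge0_integralZl//; last 2 first.
- apply/measurable_EFinP; exact: measurable_indic_itv.
- by rewrite lee_fin.
rewrite integral_indic ?setIT//.
have e : mu `]0%R, X w[%classic = (X w)%:E.
  rewrite lebesgue_measure_itv/= lte_fin; case: ltP => [_|Xw]; first by rewrite oppr0 adde0.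
  by have /eqP -> : X w == 0 by rewrite eq_le Xw X0.
by rewrite mulrC EFinM; congr (_ * _)%E; rewrite -e.
Qed.

End layer_cake.

(** Independence speaks of events, so factors are exchanged one at a time: in the mixed product
    [Z r B] the indices in [r] carry X_i and the others an indicator. The empty list is independence
    itself, the full list is the claim. *)
Lemma expectation_prod_independent d (T : measurableType d) (P : probability T R)
    (m : nat) (X : 'I_m -> T -> R) :
  (forall i, measurable_fun setT (X i)) -> (forall i w, 0 <= X i w) ->
  mutually_independent P X ->
  (\int[P]_w (\prod_(i < m) X i w)%:E = \prod_(i < m) \int[P]_w (X i w)%:E)%E.
Proof.
move=> mX X0 indX.
pose Z (r : seq 'I_m) (B : 'I_m -> set R) i w := if i \in r then X i w else \1_(B i) (X i w).
have Z0 r B i w : 0 <= Z r B i w by rewrite /Z; case: ifP => // _; rewrite indicE ler0n.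
have mZ r B i : (forall i, measurable (B i)) -> measurable_fun setT (Z r B i).
  move=> mB; rewrite (_ : Z r B i = if i \in r then X i else \1_(B i) \o X i); last first.
    by apply/funext => w; rewrite /Z; case: (i \in r).
  case: (i \in r) => //.
  by apply: (measurableT_comp (f := \1_(B i) : R -> R)) => //; exact: measurable_indic.
suff main r B : uniq r -> (forall i, measurable (B i)) ->
    (\int[P]_w (\prod_(i < m) Z r B i w)%:E = \prod_(i < m) \int[P]_w (Z r B i w)%:E)%E.
  have := main (enum 'I_m) (fun=> setT) (enum_uniq _) (fun=> measurableT).
  have ZE i w : Z (enum 'I_m) (fun=> setT) i w = X i w by rewrite /Z mem_enum.
  under eq_integral do under eq_bigr do rewrite ZE.
  by move=> ->; apply: eq_bigr => i _; apply: eq_integral => w _; rewrite ZE.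
elim: r B => [|i r IH] B.
  move=> _ mB; transitivity (P (\bigcap_(i in [set: 'I_m]) (X i @^-1` B i))).
    rewrite -[in RHS](setIT (\bigcap_(i in _) _)) -integral_indic//; last first.
      by apply: fin_bigcap_measurable => // i _; rewrite -[X in measurable X]setTI; exact: mX.
    apply: eq_integral => w _; congr EFin; rewrite indicE.
    case: (boolP (w \in _)) => [|].
      rewrite inE => wB; apply: big1 => i _; rewrite /Z/= indicE mem_set//.
      exact: wB.
    rewrite notin_setE => /existsNP[i /not_implyP[_ wB]].
    by rewrite (bigD1 i)//= /Z/= indicE memNset// mul0r.
  rewrite indX//; apply: eq_bigr => i _.
  rewrite -[in LHS](setIT (_ @^-1` _)) -integral_indic//; last first.
    by rewrite -[X in measurable X]setTI; exact: mX.
move=> /= /andP[ir ur] mB.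
(* The layer cake formula replaces X_i by the indicator of X_i > r0, which is absorbed into the
   family of events; the induction hypothesis then applies for each r0. *)
pose B' r0 j : set R := if j == i then `]r0, +oo[%classic else B j.
have mB' r0 j : measurable (B' r0 j) by rewrite /B'; case: ifP => // _; exact: measurable_itv.
pose W w := \prod_(j < m | j != i) Z (i :: r) B j w.
have mW : measurable_fun setT W.
  rewrite /W; under eq_fun do rewrite big_mkcond/=.
  by apply: measurable_prod => j _; case: (j != i) => //; exact: mZ.
have W0 w : 0 <= W w by apply: prodr_ge0.
have ZE r0 j w : j != i -> Z r (B' r0) j w = Z (i :: r) B j w.
  by move=> ji; rewrite /Z /B' inE (negbTE ji).
pose c := (\prod_(j < m | j != i) \int[P]_w (Z (i :: r) B j w)%:E)%E.
have c0 : (0 <= c)%E.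
  apply: prode_ge0 => j _; apply: integral_ge0 => w _; rewrite lee_fin; exact: Z0.
have Zi w : Z (i :: r) B i w = X i w by rewrite /Z inE eqxx.
transitivity (\int[P]_w (X i w * W w)%:E)%E.
  by apply: eq_integral => w _; rewrite (bigD1 i)//= Zi.
rewrite (layer_cake P (mX i) mW)// (bigD1 i)//= -/c.
have -> : (\int[P]_w (Z (i :: r) B i w)%:E = \int[P]_w (X i w * 1)%:E)%E.
  by apply: eq_integral => w _; rewrite Zi mulr1.
rewrite (layer_cake P (W := fun=> 1))//.
rewrite -ge0_integralZr//; last 2 first.
- exact: (measurable_layer_cake P (W := fun=> 1)).
- by move=> r0 _; apply: integral_ge0 => w _; rewrite lee_fin mulr1 indicE ler0n.
apply: eq_integral => r0 _.
transitivity (\int[P]_w (\prod_(j < m) Z r (B' r0) j w)%:E)%E.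
  apply: eq_integral => w _; rewrite [in RHS](bigD1 i)//=; congr (_ * _)%:E.
    by rewrite /Z (negbTE ir) /B' eqxx.
  by apply: eq_bigr => j ji; rewrite ZE.
rewrite IH// (bigD1 i)//=; congr (_ * _)%E.
  by apply: eq_integral => w _; rewrite /Z (negbTE ir) /B' eqxx mulr1.
by apply: eq_bigr => j ji; apply: eq_integral => w _; rewrite ZE.
Qed.

(** Applying the layer cake formula on both sides reduces the identity to the events phi(X) > r,
    where the density is given. *)
Lemma expectation_density d (T : measurableType d) (P : probability T R)
    (X : T -> R) (dens phi : R -> R) : measurable_fun setT X ->
  measurable_fun setT dens -> (forall y, 0 <= dens y) ->
  measurable_fun setT phi -> (forall y, 0 <= phi y) ->
  (forall A : set R, measurable A -> P (X @^-1` A) = \int[mu]_(y in A) (dens y)%:E)%E ->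
  (\int[P]_w (phi (X w))%:E = \int[mu]_y (phi y * dens y)%:E)%E.
Proof.
move=> mX mdens dens0 mphi phi0 PX.
transitivity (\int[P]_w (phi (X w) * 1)%:E)%E.
  by apply: eq_integral => w _; rewrite mulr1.
rewrite (layer_cake P (W := fun=> 1))//; last exact: measurableT_comp.
rewrite (layer_cake mu mphi mdens)//; apply: eq_integral => r _.
have mA : measurable (phi @^-1` `]r, +oo[%classic).
  by rewrite -[X in measurable X]setTI; apply: mphi => //; exact: measurable_itv.
transitivity (P (X @^-1` (phi @^-1` `]r, +oo[%classic))).
  rewrite -[in RHS](setIT (X @^-1` _)) -integral_indic//; last first.
    by rewrite -[X in measurable X]setTI; exact: mX.
  by apply: eq_integral => w _; rewrite mulr1.
rewrite PX// integral_mkcond; apply: eq_integral => y _.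
rewrite patchE indicE -[y \in _]/(phi y \in `]r, +oo[%classic) /=.
by case: (phi y \in _); rewrite ?mul1r ?mul0r.
Qed.

End independence.

(** * Gamma at integers, generalized Gamma integrals, the multiplication formula *)

Section gamma_product.
Context {R : realType}.
Local Notation mu := (@lebesgue_measure R).

Let mpos : measurable (`]0%R, +oo[%classic : set (measurableTypeR R)) := @measurable_pos R.

Lemma Gamma1 : Gamma (1 : R) = 1.
Proof.
have i1 : mu.-integrable `]0%R, +oo[ (fun t : R => (expR (- t))%:E).
  apply: (eq_integrable_real mpos (integrable_gamma (@ltr01 R))) => t _.
  by rewrite subrr powRr0 mul1r.
have d1 (x : R) : 0 < x -> is_derive x 1 (fun x => - expR (- x)) (expR (- x)).
  by move=> x0; apply: is_derive_eq; rewrite /GRing.scale/=; ring.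
have c0 : - expR (- x) @[x --> (0 : R)^'+] --> (- 1 : R).
  apply: cvgN; apply: cvg_at_right_filter.
  by have := @continuous_expRN R 0; rewrite /continuous_at oppr0 expR0.
have cy : - expR (- x) @[x --> (+oo : set_system R)] --> (0 : R).
  by rewrite -oppr0; apply: cvgN; exact: cvgr_expR.
have := integral_derive_pos d1 (fun x _ => @continuous_expRN R x) i1 c0 cy.
rewrite sub0r opprK => h; have := integral_gamma (@ltr01 R).
under eq_integral do rewrite subrr powRr0 mul1r.
by rewrite h => -[].
Qed.

Lemma Gamma_fact (k : nat) : Gamma (k%:R + 1 : R) = k`!%:R.
Proof.
elim: k => [|k IH]; first by rewrite add0r Gamma1.
by rewrite GammaS ?ltr0n// -[k.+1]addn1 natrD IH addn1 factS natrM -[k.+1 in RHS]addn1 natrD.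
Qed.

Lemma is_derive_exprn (k : nat) (x : R) :
  is_derive x 1 (fun y : R => y ^+ k) (k%:R * x ^+ k.-1).
Proof.
by split; [exact: exprn_derivable|rewrite exp_derive /GRing.scale/= mulr1].
Qed.

Lemma ge0_integral_subst_exprn (n : nat) (c : R) (G : R -> R) : (0 < n)%N -> 0 < c ->
  (forall x, 0 < x -> {for x, continuous G}) -> (forall x, 0 < x -> 0 <= G x) ->
  (\int[mu]_(t in `]0%R, +oo[) (G t)%:E =
   \int[mu]_(u in `]0%R, +oo[) (G (c * u ^+ n) * (c * (n%:R * u ^+ n.-1)))%:E)%E.
Proof.
case: n => // n _ c0 cG G0.
have cX (k : nat) (x : R) : {for x, continuous (fun y : R => y ^+ k)} by exact: exprn_continuous.
apply: (@ge0_integral_subst_pos R (fun x => c * x ^+ n.+1) (fun x => c * (n.+1%:R * x ^+ n)) G 0) => //.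
- by move=> x _; exact: (is_deriveZ c (is_derive_exprn n.+1 x)).
- by move=> x x0; rewrite !mulr_gt0 ?exprn_gt0.
- move=> x x0; apply: continuousM; first exact: cst_continuous.
  by apply: continuousM; [exact: cst_continuous|exact: cX].
- rewrite -[X in _ --> X](mulr0 c); apply: cvgM; first exact: cvg_cst.
  apply: cvg_at_right_filter; rewrite -[X in _ --> X](expr0n R n.+1).
  exact: cX.
- apply/cvgryPge => B; near=> x.
  have x1 : 1 <= x by near: x; apply: nbhs_pinfty_ge; rewrite num_real.
  have xB : c^-1 * B <= x by near: x; apply: nbhs_pinfty_ge; rewrite num_real.
  have -> : B = c * (c^-1 * B) by rewrite mulrA divff ?mul1r// lt0r_neq0.
  rewrite ler_pM2l// (le_trans xB)// exprS ler_peMr ?(le_trans ler01 x1)//.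
  exact: exprn_ege1.
Unshelve. all: end_near. Qed.

(** Substitute y^n / A in the Gamma integral. With i shifted by k this gives the k-th moments of the
    densities of the G_j up to normalization. *)
Lemma integral_pow_expR_pow (n i : nat) (A : R) : (0 < n)%N -> 0 < A ->
  (\int[mu]_(y in `]0%R, +oo[) (y ^+ i * expR (- (y ^+ n / A)))%:E =
   (n%:R^-1 * A `^ (i.+1%:R / n%:R) * Gamma (i.+1%:R / n%:R))%:E)%E.
Proof.
case: n => // n _ A0; set a := i.+1%:R / _.
have n0 : 0 < n.+1%:R :> R by rewrite ltr0n.
have a0 : 0 < a by rewrite divr_gt0 ?ltr0n.
have cX (k : nat) (x : R) : {for x, continuous (fun y : R => y ^+ k)} by exact: exprn_continuous.
have cG (x : R) : 0 < x -> {for x, continuous (fun x => x `^ (a - 1) * expR (- x))}.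
  by move=> x0; apply: continuousM; [exact: continuous_powR|exact: continuous_expRN].
have G0 (x : R) : 0 < x -> 0 <= x `^ (a - 1) * expR (- x).
  by move=> x0; rewrite mulr_ge0 ?powR_ge0 ?expR_ge0.
have A0' : 0 < A^-1 by rewrite invr_gt0.
have := @ge0_integral_subst_exprn n.+1 A^-1 _ isT A0' cG G0.
rewrite integral_gamma// => e.
have -> : (\int[mu]_(y in `]0%R, +oo[) (y ^+ i * expR (- (y ^+ n.+1 / A)))%:E =
   \int[mu]_(y in `]0%R, +oo[) ((n.+1%:R^-1 * A `^ a)%:E *
    ((A^-1 * y ^+ n.+1) `^ (a - 1) * expR (- (A^-1 * y ^+ n.+1)) * (A^-1 * (n.+1%:R * y ^+ n)))%:E))%E.
  apply: eq_integral => y; rewrite inE/= in_itv/= andbT => y0.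
  rewrite -EFinM; congr EFin; rewrite [A^-1 * y ^+ n.+1]mulrC.
  set E := expR _.
  rewrite powRM ?invr_ge0 ?exprn_ge0 ?(ltW y0) ?(ltW A0)//.
  have e1 : (y ^+ n.+1) `^ (a - 1) * y ^+ n = y ^+ i.
    rewrite -!powR_mulrn ?(ltW y0)// -powRrM -powRD; last by rewrite (lt0r_neq0 y0) implybT.
    congr (_ `^ _); rewrite /a -!natr1; field.
    by rewrite natr1 lt0r_neq0.
  have e2 (b : R) : A `^ b * ((A^-1) `^ (b - 1) * A^-1) = 1.
    rewrite -[X in _ `^ (b - 1) * X]powR_inv1 ?(ltW A0)// -[X in X `^ (b - 1)]powR_inv1 ?(ltW A0)//.
    rewrite -powRrM -!powRD; try by rewrite lt0r_neq0// implybT.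
    have -> : b + (-1 * (b - 1) - 1) = 0 by ring.
    by rewrite powRr0.
  rewrite (_ : _ * (_ * E * _) = (A `^ a * ((A^-1) `^ (a - 1) * A^-1)) * ((y ^+ n.+1) `^ (a - 1) * y ^+ n) * E).
    by rewrite e1 e2 mul1r.
  move: (A `^ a) ((A^-1) `^ (a - 1)) ((y ^+ n.+1) `^ (a - 1)) (y ^+ n) A^-1 E (n.+1%:R : R) (lt0r_neq0 n0) => a1 a2 a3 a4 a5 a6 N N0.
  by field.
rewrite integralZl//.
  by rewrite -e -EFinM.
have mf : measurable_fun (`]0%R, +oo[ : set R) (fun y => (A^-1 * y ^+ n.+1) `^ (a - 1) *
    expR (- (A^-1 * y ^+ n.+1)) * (A^-1 * (n.+1%:R * y ^+ n))).
  apply: pos_continuous_measurable => x x0; apply: continuousM; last first.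
    apply: continuousM; first exact: cst_continuous.
    by apply: continuousM; [exact: cst_continuous|exact: cX].
  apply: (@continuous_comp R R R (fun x => A^-1 * x ^+ n.+1) (fun x => x `^ (a - 1) * expR (- x))).
    by apply: continuousM; [exact: cst_continuous|exact: cX].
  by apply: cG; rewrite mulr_gt0 ?invr_gt0 ?exprn_gt0.
apply/integrableP; split; first exact/measurable_EFinP.
under eq_integral => y.
  move=> yI; have y0 : 0 < y by move: yI; rewrite inE/= in_itv/= andbT.
  rewrite gee0_abs; last first.
    by rewrite lee_fin !mulr_ge0 ?powR_ge0 ?expR_ge0 ?invr_ge0 ?(ltW A0) ?exprn_ge0 ?(ltW y0).
  over.
by rewrite -e ltry.
Qed.

Lemma prod_ord_shift (q : nat -> R) (n : nat) :
  (\prod_(j < n) q j.+1) * q 0%N = (\prod_(j < n) q j) * q n.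
Proof.
elim: n => [|n IH]; first by rewrite !big_ord0.
by rewrite big_ord_recr [in RHS]big_ord_recr /= mulrAC IH.
Qed.

(* Gauss' multiplication formula, in the form of a telescoping product. *)
Lemma prod_Gamma_shift (n k : nat) : (0 < n)%N ->
  n%:R ^+ k * (\prod_(j < n.-1) Gamma ((j.+1 + k)%:R / n%:R)) * Gamma (1 + k%:R / n%:R : R) =
  k`!%:R * \prod_(j < n.-1) Gamma (j.+1%:R / n%:R).
Proof.
case: n => // n _ /=; have n0 : 0 < n.+1%:R :> R by rewrite ltr0n.
(* The formula rests only on the value at 1 and the functional equation, so [Gamma] becomes an
   abstract function. *)
move: (@Gamma R) Gamma1 (@GammaS R) => gam gam1 gamS.
elim: k => [|k IH].
  rewrite mul0r addr0 gam1 mulr1 expr0 !mul1r.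
  by apply: eq_bigr => j _; rewrite addn0.
pose q i : R := gam ((i.+1 + k)%:R / n.+1%:R).
have tel : (\prod_(j < n) gam ((j.+1 + k.+1)%:R / n.+1%:R)) * q 0%N = (\prod_(j < n) q j) * q n.
  rewrite -prod_ord_shift; congr (_ * _); apply: eq_bigr => j _.
  by rewrite /q addnS -addSn.
have qn : q n = gam (1 + k%:R / n.+1%:R).
  by rewrite /q; congr gam; rewrite natrD mulrDl divff// lt0r_neq0.
have q0 : gam (1 + k.+1%:R / n.+1%:R) = k.+1%:R / n.+1%:R * q 0%N.
  by rewrite addrC gamS ?divr_gt0 ?ltr0n// /q add1n.
rewrite factS natrM -[RHS]mulrA -IH q0 exprS -qn.
rewrite (_ : _ * _ * _ = n.+1%:R ^+ k * k.+1%:R * ((\prod_(j < n) gam ((j.+1 + k.+1)%:R / n.+1%:R)) * q 0%N)).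
  by rewrite tel /q; ring.
by field; rewrite lt0r_neq0.
Qed.

End gamma_product.

(** * Moments of the product of the G_j *)

Section moments.
Context {R : realType}.
Local Notation mu := (@lebesgue_measure R).

Let mpos : measurable (`]0%R, +oo[%classic : set (measurableTypeR R)) := @measurable_pos R.

(* Truncation of the null event [y <= 0]; it makes every [G j] positive everywhere. *)
Definition posval (y : R) : R := if 0 < y then y else 1.

Lemma posval_gt0 y : 0 < posval y.
Proof. by rewrite /posval; case: ifP. Qed.

Lemma measurable_posval : measurable_fun setT posval.
Proof.
rewrite (_ : posval = fun y => \1_`]0%R, +oo[ y * y + (1 - \1_`]0%R, +oo[ y)); last first.
  apply/funext => y; rewrite /posval indicE mem_setE in_itv/= andbT.
  by case: (0 < y); rewrite ?mul1r ?mul0r ?subrr ?subr0 ?addr0 ?add0r.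
apply: measurable_funD; first by apply: measurable_funM => //; exact: measurable_indic_itv.
by apply: measurable_funB => //; exact: measurable_indic_itv.
Qed.

Section density.
Variables (n : nat) (t : R).
Hypotheses (n2 : (2 <= n)%N) (t0 : 0 < t).

Let A := (n%:R ^+ n * t) `^ (1 / (n.-1)%:R).

Let n0 : 0 < n%:R :> R. Proof. by rewrite ltr0n (leq_trans _ n2). Qed.

Let A0 : 0 < A. Proof. by rewrite powR_gt0// mulr_gt0// exprn_gt0. Qed.

(** Normalizing constant of the density; [j] counts from 0 here and stands for G_(j+1). *)
Let Z (j : nat) : R := n%:R `^ (j.+1%:R / (n.-1)%:R - 1) * t `^ (j.+1%:R / (n * n.-1)%:R) * Gamma (j.+1%:R / n%:R).

Let Z0 j : 0 < Z j.
Proof. by rewrite !mulr_gt0 ?powR_gt0// gamma_gt0// divr_gt0// ltr0n. Qed.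

Let GE j y : 0 < y -> G_density n j.+1 t y = (Z j)^-1 * (y ^+ j * expR (- (y ^+ n / A))).
Proof. by move=> y0; rewrite /G_density y0 /= -/(Z j) -/A mulrA [_ / Z j]mulrC. Qed.

Let GE0 j y : y <= 0 -> G_density n j.+1 t y = 0.
Proof. by move=> y0; rewrite /G_density ltNge y0. Qed.

Lemma G_density_ge0 j y : 0 <= G_density n j.+1 t y.
Proof.
have [y0|y0] := ltP 0 y; last by rewrite GE0.
by rewrite GE// !mulr_ge0 ?invr_ge0 ?expR_ge0 ?exprn_ge0 ?(ltW y0) ?(ltW (Z0 j)).
Qed.

Lemma measurable_G_density j : measurable_fun setT (G_density n j.+1 t).
Proof.
rewrite (_ : G_density n j.+1 t = (fun y => (Z j)^-1 * (y ^+ j * expR (- (y ^+ n / A)))) \_ `]0%R, +oo[); last first.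
  apply/funext => y; rewrite patchE; case: (ltP 0 y) => y0.
    by rewrite mem_set/= ?in_itv/= ?y0// GE.
  by rewrite memNset/= ?in_itv/= ?andbT ?GE0//; apply/negP; rewrite -leNgt.
apply: (measurable_restrictT _ mpos).1; apply: measurable_funTS.
apply: measurable_funM => //; apply: measurable_funM => //.
apply: measurableT_comp => //; apply: measurableT_comp => //.
by apply: measurable_funM.
Qed.

Let integral_G_density j (k : nat) : (\int[mu]_y (posval y ^+ k * G_density n j.+1 t y)%:E =
  ((Z j)^-1 * (n%:R^-1 * A `^ ((j + k).+1%:R / n%:R) * Gamma ((j + k).+1%:R / n%:R)))%:E)%E.
Proof.
transitivity (\int[mu]_(y in `]0%R, +oo[) ((Z j)^-1%:E * (y ^+ (j + k) * expR (- (y ^+ n / A)))%:E))%E.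
  rewrite [RHS]integral_mkcond; apply: eq_integral => y _; rewrite patchE; case: (ltP 0 y) => y0.
    by rewrite mem_set/= ?in_itv/= ?y0// GE// /posval y0 -EFinM exprD; congr EFin; ring.
  by rewrite memNset/= ?in_itv/= ?andbT ?GE0 ?mulr0//; apply/negP; rewrite -leNgt.
have n00 : (0 < n)%N by exact: leq_trans n2.
have I := integral_pow_expR_pow (j + k) n00 A0.
rewrite ge0_integralZl//; first by rewrite I.
- apply/measurable_EFinP; apply: measurable_funTS; apply: measurable_funM => //.
  by apply: measurableT_comp => //; apply: measurableT_comp => //; apply: measurable_funM.
- move=> y; rewrite /= in_itv/= andbT => y0.
  by rewrite lee_fin mulr_ge0 ?expR_ge0// exprn_ge0// ltW.
- by rewrite lee_fin invr_ge0 ltW.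
Qed.

(** Each factor contributes A^(k/n) times a quotient of Gamma values. The quotients multiply by
    Gauss' formula, and the power n^k which that formula asks for is supplied by the scale [A]. *)
Lemma moments_prod_G d (T : measurableType d) (P : probability T R) (G : 'I_n.-1 -> {RV P >-> R}) :
  mutually_independent P (fun j => G j) ->
  (forall (j : 'I_n.-1) (A : set R), measurable A ->
     distribution P (G j) A = (\int[mu]_(y in A) (G_density n j.+1 t y)%:E)%E) ->
  forall k : nat, (\int[P]_w ((\prod_(j < n.-1) posval (G j w)) ^+ k)%:E =
    (t `^ (k%:R / n%:R) * (k`!%:R / Gamma (1 + k%:R / n%:R)))%:E)%E.
Proof.
move=> indG lawG k.
have mpk : measurable_fun setT (fun y => posval y ^+ k).
  by apply: measurable_funX; exact: measurable_posval.
pose X (j : 'I_n.-1) w := posval (G j w) ^+ k.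
have EG (j : 'I_n.-1) (i : nat) : (\int[P]_w (posval (G j w) ^+ i)%:E =
    ((Z j)^-1 * (n%:R^-1 * A `^ ((j + i).+1%:R / n%:R) * Gamma ((j + i).+1%:R / n%:R)))%:E)%E.
  rewrite -integral_G_density.
  apply: (@expectation_density _ _ _ P (G j) (G_density n j.+1 t) (fun y => posval y ^+ i)) => //.
  - exact: measurable_G_density.
  - exact: G_density_ge0.
  - by apply: measurable_funX; exact: measurable_posval.
  - by move=> y; rewrite exprn_ge0// ltW// posval_gt0.
  - by move=> B mB; rewrite -lawG.
have gj (j : nat) : 0 < Gamma (j.+1%:R / n%:R : R) by rewrite gamma_gt0// divr_gt0// ltr0n.
have EX (j : 'I_n.-1) : (\int[P]_w (X j w)%:E =
    (A `^ (k%:R / n%:R) * (Gamma ((j.+1 + k)%:R / n%:R) / Gamma (j.+1%:R / n%:R)))%:E)%E.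
  rewrite EG; congr EFin.
  (* The zeroth moment under a probability is 1. This eliminates [Z j] from the k-th moment without
     evaluating it. *)
  have : (1 = (Z j)^-1 * (n%:R^-1 * A `^ (j.+1%:R / n%:R) * Gamma (j.+1%:R / n%:R))).
    have := EG j 0%N; rewrite addn0; under eq_integral do rewrite expr0.
    by rewrite integral_cst//= probability_setT mule1 => -[].
  have -> : A `^ ((j + k).+1%:R / n%:R) = A `^ (j.+1%:R / n%:R) * A `^ (k%:R / n%:R).
    rewrite -powRD; last by rewrite lt0r_neq0// implybT.
    by rewrite -mulrDl -natrD addSn.
  rewrite addSn; move: (A `^ (j.+1%:R / n%:R)) (A `^ (k%:R / n%:R)) (gj j) => a1 a2.
  move: (Gamma (j.+1%:R / n%:R)) (Gamma ((j + k).+1%:R / n%:R)) => g1 g2 g10.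
  set z := (Z j)^-1; set nV := n%:R^-1 => e.
  transitivity ((z * (nV * a1 * g1)) * (a2 * (g2 / g1))); last by rewrite -e mul1r.
  by field; rewrite lt0r_neq0.
transitivity (\int[P]_w (\prod_(j < n.-1) X j w)%:E)%E.
  by apply: eq_integral => w _; rewrite /X prodrXl.
rewrite expectation_prod_independent//; last 3 first.
- by move=> j; rewrite /X; exact: (measurableT_comp mpk).
- by move=> j w; rewrite exprn_ge0// ltW// posval_gt0.
- move=> B mB.
  pose B' j := (fun y => posval y ^+ k) @^-1` B j.
  apply: (indG B') => j; rewrite -[X in measurable X]setTI; exact: mpk.
under eq_bigr do rewrite EX.
rewrite -(big_morph EFin EFinM (erefl _)); congr EFin.
rewrite big_split/= prodr_const card_ord big_split/= prodfV.
have n00 : (0 < n)%N by exact: leq_trans n2.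
have := @prod_Gamma_shift R n k n00.
have pg : 0 < \prod_(j < n.-1) Gamma (j.+1%:R / n%:R : R) by apply: prodr_gt0.
have g1k : 0 < Gamma (1 + k%:R / n%:R : R) by rewrite gamma_gt0// ltr_pwDl// divr_ge0.
(* The root of order n-1 in [A] is undone by the n-1 factors, which leaves (n^n t)^(k/n). *)
have -> : A `^ (k%:R / n%:R) ^+ n.-1 = n%:R ^+ k * t `^ (k%:R / n%:R).
  rewrite -powR_mulrn ?powR_ge0// -!powRrM.
  have n1 : (n.-1)%:R != 0 :> R by rewrite pnatr_eq0 -lt0n -ltnS prednK.
  have -> : 1 / (n.-1)%:R * (k%:R / n%:R * (n.-1)%:R) = k%:R / n%:R :> R.
    by field; rewrite n1 lt0r_neq0.
  rewrite powRM ?exprn_ge0 ?(ltW n0) ?(ltW t0)//; congr (_ * _).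
  rewrite -powR_mulrn ?(ltW n0)// -powRrM -powR_mulrn ?(ltW n0)//.
  by congr (_ `^ _); rewrite mulrC divfK// lt0r_neq0.
move: pg g1k; set g1 := \prod_(j < n.-1) _; set g2 := \prod_(j < n.-1) _; set g3 := Gamma _.
move=> g10 g30 e.
have : n%:R ^+ k * g2 = k`!%:R * g1 / g3 by rewrite -e mulfK// lt0r_neq0.
move: (t `^ _) => c e'; transitivity (c * (n%:R ^+ k * g2) / g1); first by rewrite !mulrA [_ * c]mulrC.
by rewrite e'; field; rewrite !lt0r_neq0.
Qed.

End density.
End moments.

(** * Determinacy by moments *)

Section moment_problem.
Context {R : realType}.
Local Notation mu := (@lebesgue_measure R).
Implicit Types (h : R -> R) (u x : R) (m : nat -> R).

Let mpos : measurable (`]0%R, +oo[%classic : set (measurableTypeR R)) := @measurable_pos R.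

Lemma partial_exp_le_expR (N : nat) x : 0 <= x -> \sum_(l < N) x ^+ l / l`!%:R <= expR x.
Proof.
move=> x0; rewrite -(big_mkord xpredT (fun l => x ^+ l / l`!%:R)).
have := @nondecreasing_cvgn_le R (series (exp_coeff x)) _ (is_cvg_series_exp_coeff x) N.
apply; apply/nondecreasing_seqP => k; rewrite /series/= big_nat_recr//= lerDl.
by rewrite /exp_coeff/= divr_ge0// exprn_ge0.
Qed.

Lemma norm_partial_exp_le (N : nat) x : `|\sum_(l < N) x ^+ l / l`!%:R| <= expR `|x|.
Proof.
apply: le_trans (partial_exp_le_expR N (normr_ge0 x)).
apply: le_trans (ler_norm_sum _ _ _) _; apply: ler_sum => l _.
by rewrite normrM normrX [X in _ * X]ger0_norm// invr_ge0.
Qed.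

Lemma partial_exp_cvg x : (\sum_(l < N) x ^+ l / l`!%:R) @[N --> \oo] --> expR x.
Proof.
have : series (exp_coeff x) @ \oo --> expR x := is_cvg_series_exp_coeff x.
apply: cvg_trans; apply: near_eq_cvg; near=> N.
by rewrite /series/= -(big_mkord xpredT (fun l => x ^+ l / l`!%:R)).
Unshelve. all: end_near. Qed.

(** Expanding e^(2u), the l-th term integrates to at most C 2^l / 4^l = C / 2^l, so all partial sums
    stay below 2 C and monotone convergence applies. *)
Lemma integrable_expR_of_moments h m (C : R) :
  (forall x, 0 < x -> {for x, continuous h}) -> (forall x, 0 < x -> 0 <= h x) ->
  (forall i : nat, \int[mu]_(u in `]0%R, +oo[) (u ^+ i * h u)%:E = (m i)%:E)%E ->
  (forall i : nat, m i <= C * i`!%:R / 4 ^+ i) ->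
  mu.-integrable `]0%R, +oo[ (fun u => (expR (2 * u) * h u)%:E).
Proof.
move=> ch h0 hm mC.
have mh := pos_continuous_measurable ch.
apply/integrableP; split.
  apply/measurable_EFinP; apply: measurable_funM => //; apply: measurable_funTS.
  by apply: measurableT_comp => //; apply: measurable_funM.
have C0 : 0 <= C.
  have : 0 <= m 0%N.
    rewrite -lee_fin -hm; apply: integral_ge0 => u; rewrite /= in_itv/= andbT => u0.
    by rewrite lee_fin mul1r h0.
  by have := mC 0%N; rewrite expr0 divr1 fact0 mulr1; lra.
pose f N u := (\sum_(l < N) (2 * u) ^+ l / l`!%:R) * h u.
have f0 N u : 0 < u -> 0 <= f N u.
  move=> u0; rewrite mulr_ge0 ?h0//; apply: sumr_ge0 => l _.
  by rewrite divr_ge0// exprn_ge0// mulr_ge0// ltW.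
have mf N : measurable_fun (`]0%R, +oo[ : set (measurableTypeR R)) (EFin \o f N).
  apply/measurable_EFinP; apply: measurable_funM => //; apply: measurable_sum => l.
  by apply: measurable_funM => //; apply: measurable_funX; apply: measurable_funM.
have cvgf u : (EFin \o (f ^~ u)) N @[N --> \oo] --> (expR (2 * u) * h u)%:E.
  apply: cvg_EFin; first exact: nearW.
  by apply: cvgM; [exact: partial_exp_cvg|exact: cvg_cst].
have intf N : (\int[mu]_(u in `]0%R, +oo[) (f N u)%:E <= (C * 2)%:E)%E.
  have -> : (\int[mu]_(u in `]0%R, +oo[) (f N u)%:E = \sum_(l < N) ((2 ^+ l / l`!%:R) * m l)%:E)%E.
    transitivity (\int[mu]_(u in `]0%R, +oo[) (\sum_(l < N) ((2 ^+ l / l`!%:R)%:E * (u ^+ l * h u)%:E)))%E.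
      apply: eq_integral => u _; rewrite /f mulr_suml -sumEFin; apply: eq_bigr => l _.
      by rewrite -EFinM exprMn; congr EFin; ring.
    rewrite ge0_integral_sum//.
    - apply: eq_bigr => l _; rewrite ge0_integralZl//; first by rewrite hm.
      + apply/measurable_EFinP; apply: measurable_funM => //.
      + move=> u; rewrite /= in_itv/= andbT => u0.
        by rewrite lee_fin mulr_ge0 ?h0// exprn_ge0// ltW.
    - move=> l; apply: emeasurable_funM => //; apply/measurable_EFinP.
      by apply: measurable_funM => //.
    - move=> l u; rewrite /= in_itv/= andbT => u0; rewrite -EFinM lee_fin.
      by rewrite !mulr_ge0 ?h0 ?invr_ge0 ?exprn_ge0 ?(ltW u0).
  rewrite sumEFin lee_fin.
  apply: (@le_trans _ _ (\sum_(l < N) C * 2^-1 ^+ l)).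
    apply: ler_sum => l _.
    have l0 : 0 < l`!%:R :> R by rewrite ltr0n fact_gt0.
    apply: (@le_trans _ _ (2 ^+ l / l`!%:R * (C * l`!%:R / 4 ^+ l))).
      by rewrite ler_wpM2l// divr_ge0// exprn_ge0.
    have E (a b c : R) : 0 < a -> c != 0 -> b / a * (C * a / c) = C * (b / c).
      by move=> a0 c0; field; rewrite c0 lt0r_neq0.
    rewrite E// ?expf_neq0//.
    rewrite -expr_div_n (_ : 2 / 4 = 2^-1)//; first by field.
  rewrite -mulr_sumr ler_wpM2l//.
  have := subrX1 (2^-1 : R) N; have : 0 <= (2^-1 : R) ^+ N by rewrite exprn_ge0// invr_ge0.
  by rewrite -(big_mkord xpredT (fun l => 2^-1 ^+ l)) => ? ?; lra.
have -> : (\int[mu]_(u in `]0%R, +oo[) `|(expR (2 * u) * h u)%:E| =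
    \int[mu]_(u in `]0%R, +oo[) (limn (fun N => (f N u)%:E)))%E.
  apply: eq_integral => u; rewrite inE/= in_itv/= andbT => u0.
  rewrite ger0_norm ?mulr_ge0 ?expR_ge0 ?h0//.
  by apply/esym/cvg_lim => //; exact: cvgf.
rewrite monotone_convergence//; last 2 first.
- by move=> N u; rewrite /= in_itv/= andbT lee_fin; exact: f0.
- move=> u; rewrite /= in_itv/= andbT => u0; apply/nondecreasing_seqP => N.
  rewrite lee_fin /f big_ord_recr/= ler_wpM2r ?h0// lerDl divr_ge0// exprn_ge0//.
  by rewrite mulr_ge0// ltW.
apply: le_lt_trans (ltry (C * 2)); apply: lime_le.
  apply: ereal_nondecreasing_is_cvgn; apply/nondecreasing_seqP => N.
  apply: ge0_le_integral => //.
  - by move=> u; rewrite /= in_itv/= andbT lee_fin; exact: f0.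
  - exact: mf.
  - exact: mf.
  - move=> u; rewrite /= in_itv/= andbT => u0.
    rewrite lee_fin /f big_ord_recr/= ler_wpM2r ?h0// lerDl divr_ge0// exprn_ge0//.
    by rewrite mulr_ge0// ltW.
by apply: nearW => N; exact: intf.
Qed.

(* Moments growing at most like [i! / 4^i] allow termwise integration of the exponential
   series of [e^{-u}], so all integrals of [u^i e^{-j u}] agree as well. *)
Lemma moments_inj h1 h2 m (C : R) :
  (forall x, 0 < x -> {for x, continuous h1}) -> (forall x, 0 < x -> 0 <= h1 x) ->
  (forall x, 0 < x -> {for x, continuous h2}) -> (forall x, 0 < x -> 0 <= h2 x) ->
  (forall i : nat, \int[mu]_(u in `]0%R, +oo[) (u ^+ i * h1 u)%:E = (m i)%:E)%E ->
  (forall i : nat, \int[mu]_(u in `]0%R, +oo[) (u ^+ i * h2 u)%:E = (m i)%:E)%E ->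
  (forall i : nat, m i <= C * i`!%:R / 4 ^+ i) ->
  forall u, 0 < u -> h1 u = h2 u.
Proof.
move=> ch1 h10 ch2 h20 hm1 hm2 mC.
have e1 := integrable_expR_of_moments ch1 h10 hm1 mC.
have e2 := integrable_expR_of_moments ch2 h20 hm2 mC.
pose h u := h1 u - h2 u.
have ch x : 0 < x -> {for x, continuous h} by move=> x0; apply: continuousB; [exact: ch1|exact: ch2].
have mh := pos_continuous_measurable ch.
have eh : mu.-integrable `]0%R, +oo[ (fun u => (expR (2 * u) * h u)%:E).
  apply: (eq_integrable_real mpos (integrable_subr mpos e1 e2)) => u _.
  by rewrite /h mulrBr.
have eha := integrable_norm eh.
have dom (g : R -> R) (K : R) : measurable_fun (`]0%R, +oo[ : set R) g ->
    (forall u, 0 < u -> `|g u| <= K * (expR (2 * u) * `|h u|)) ->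
    mu.-integrable `]0%R, +oo[ (EFin \o g).
  move=> mg gK; apply: (le_integrable mpos) (integrable_mulrl mpos K eha).
    exact/measurable_EFinP.
  move=> u; rewrite /= in_itv/= andbT => u0; rewrite lee_fin.
  rewrite normrM [X in `|K| * X]ger0_norm// normrM (ger0_norm (expR_ge0 _)).
  by apply: (le_trans (gK _ u0)); rewrite ler_wpM2r ?ler_norm// mulr_ge0 ?expR_ge0.
have mterm (i j : nat) : measurable_fun (`]0%R, +oo[ : set R) (fun u => u ^+ i * expR (- (j%:R * u)) * h u).
  apply: measurable_funM => //; apply: measurable_funTS; apply: measurable_funM => //.
  by apply: measurableT_comp => //; apply: measurableT_comp => //; apply: measurable_funM.
have bterm (i j : nat) u : 0 < u -> `|u ^+ i * expR (- (j%:R * u))| <= i`!%:R * expR u.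
  move=> u0; rewrite ger0_norm ?mulr_ge0 ?exprn_ge0 ?expR_ge0 ?(ltW u0)//.
  apply: le_trans (exprn_le_expR i (ltW u0)).
  by rewrite ler_piMr ?exprn_ge0 ?(ltW u0)// expR_le1 oppr_le0 mulr_ge0// ltW.
have iterm (i j : nat) : mu.-integrable `]0%R, +oo[ (EFin \o (fun u => u ^+ i * expR (- (j%:R * u)) * h u)).
  apply: (dom _ i`!%:R) => // u u0; rewrite normrM mulrA ler_wpM2r//.
  apply: (le_trans (bterm i j u u0)); rewrite ler_wpM2l// ler_expR; lra.
(* Induction on [j] with [i] free: expanding one more factor e^(-u) raises the power of u. *)
have main (j i : nat) : \int[mu]_(u in `]0%R, +oo[) (u ^+ i * expR (- (j%:R * u)) * h u) = 0.
  elim: j i => [|j IH] i.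
    have i1 : mu.-integrable `]0%R, +oo[ (fun u => (u ^+ i * h1 u)%:E).
      apply/integrableP; split.
        by apply/measurable_EFinP; apply: measurable_funM => //; exact: pos_continuous_measurable.
      under eq_integral => u.
        move=> uI; have u0 : 0 < u by move: uI; rewrite inE/= in_itv/= andbT.
        rewrite gee0_abs ?lee_fin ?mulr_ge0 ?h10 ?exprn_ge0 ?(ltW u0)//.
        over.
      by rewrite hm1 ltry.
    have i2 : mu.-integrable `]0%R, +oo[ (fun u => (u ^+ i * h2 u)%:E).
      apply/integrableP; split.
        by apply/measurable_EFinP; apply: measurable_funM => //; exact: pos_continuous_measurable.
      under eq_integral => u.
        move=> uI; have u0 : 0 < u by move: uI; rewrite inE/= in_itv/= andbT.
        rewrite gee0_abs ?lee_fin ?mulr_ge0 ?h20 ?exprn_ge0 ?(ltW u0)//.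
        over.
      by rewrite hm2 ltry.
    under eq_Rintegral do rewrite mul0r oppr0 expR0 mulr1 /h mulrBr.
    by rewrite RintegralB// /Rintegral hm1 hm2 subrr.
  pose f (N : nat) u := \sum_(l < N) ((-1) ^+ l / l`!%:R) * (u ^+ (i + l) * expR (- (j%:R * u)) * h u).
  have fE N u : f N u = (\sum_(l < N) (- u) ^+ l / l`!%:R) * (u ^+ i * expR (- (j%:R * u)) * h u).
    rewrite /f mulr_suml; apply: eq_bigr => l _; rewrite exprD [(- u) ^+ l]exprNn.
    by move: ((-1) ^+ l : R) (u ^+ i) (u ^+ l) (l`!%:R^-1 : R) (expR _) (h u) => a b c d e0 f0; ring.
  have f_int N : \int[mu]_(u in `]0%R, +oo[) f N u = 0.
    have [|_ ->] := @Rintegral_sum _ _ _ mu _ mpos _ (index_enum 'I_N) predT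
      (fun l u => ((-1) ^+ l / l`!%:R) * (u ^+ (i + l) * expR (- (j%:R * u)) * h u)).
        by move=> l; exact: (integrable_mulrl mpos _ (iterm _ _)).
    by apply: big1 => l _; rewrite RintegralZl// [X in _ * X](IH (i + l)%N) mulr0.
  have cvgf u : (f N u)%:E @[N --> \oo] --> (u ^+ i * expR (- (j.+1%:R * u)) * h u)%:E.
    apply: cvg_EFin; first exact: nearW.
    suff : f ^~ u @ \oo --> u ^+ i * expR (- (j.+1%:R * u)) * h u by [].
    rewrite (funext (fE ^~ u)).
    have -> : u ^+ i * expR (- (j.+1%:R * u)) * h u = expR (- u) * (u ^+ i * expR (- (j%:R * u)) * h u).
      have -> : - (j.+1%:R * u) = - u + - (j%:R * u) by rewrite -natr1; ring.
      by rewrite expRD; ring.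
    by apply: cvgM; [exact: partial_exp_cvg|exact: cvg_cst].
  have mf N : measurable_fun (`]0%R, +oo[ : set (measurableTypeR R)) (EFin \o f N).
    apply/measurable_EFinP; apply: measurable_sum => l.
    by apply: measurable_funM => //; exact: mterm.
  have [||||_ _] := @dominated_convergence _ _ _ mu `]0%R, +oo[%classic mpos
    (fun N => EFin \o f N) (fun u => (u ^+ i * expR (- (j.+1%:R * u)) * h u)%:E)
    (fun u => (i`!%:R * `|expR (2 * u) * h u|)%:E) mf.
  - by apply/measurable_EFinP; exact: mterm.
  - by apply: aeW => u _; exact: cvgf.
  - exact: (integrable_mulrl mpos _ eha).
  - apply: aeW => u N; rewrite /= in_itv/= andbT => u0; rewrite lee_fin fE.
    (* Origin of the weight e^(2u): one factor e^u bounds the partial sums of e^(-u), the other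
       bounds u^i / i!. *)
    have h1' := norm_partial_exp_le N (- u); rewrite normrN (ger0_norm (ltW u0)) in h1'.
    have h2' := bterm i j u u0.
    rewrite normrM [X in _ * X]normrM [in leRHS]normrM (ger0_norm (expR_ge0 (2 * u))).
    rewrite !mulrA ler_wpM2r//.
    have -> : i`!%:R * expR (2 * u) = expR u * (i`!%:R * expR u).
      by rewrite (_ : 2 * u = u + u) ?expRD; ring.
    by rewrite ler_pM.
  rewrite (_ : [sequence _]_n = cst 0%E); last first.
    apply/funext => N /=; transitivity (\int[mu]_(u in `]0%R, +oo[) f N u)%:E; last by rewrite f_int.
    apply: EFin_Rintegral => //.
    have [//|+ _] := @Rintegral_sum _ _ _ mu _ mpos _ (index_enum 'I_N) predT
      (fun l u => ((-1) ^+ l / l`!%:R) * (u ^+ (i + l) * expR (- (j%:R * u)) * h u)).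
      by move=> l; exact: (integrable_mulrl mpos _ (iterm _ _)).
    exact.
  move=> h0; have e := cvg_unique (@ereal_hausdorff R) (cvg_cst (0%E : \bar R)) h0.
  by rewrite /Rintegral -e.
move=> u u0; apply/eqP; rewrite -subr_eq0; apply/eqP; move: u u0.
apply: (@laplace_inj _ h 0) => //.
  apply: (eq_integrable_real mpos (iterm 0%N 0%N)) => u _.
  by rewrite expr0 mul1r !mul0r.
move=> k; rewrite -[RHS](main k 0%N); apply: eq_Rintegral => u _.
by rewrite expr0 mul1r add0r.
Qed.

End moment_problem.

(** * Subordination *)

Section subordination.
Context {R : realType} d (T : measurableType d) (P : probability T R).
Local Notation mu := (@lebesgue_measure R).

Let mpos : measurable (`]0%R, +oo[%classic : set (measurableTypeR R)) := @measurable_pos R.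

Lemma tonelli_pos (g : T * R -> R) :
  measurable_fun setT g -> (forall w t, 0 < t -> 0 <= g (w, t)) ->
  measurable_fun (`]0%R, +oo[ : set (measurableTypeR R)) (fun t => \int[P]_w (g (w, t))%:E)%E /\
  (\int[mu]_(t in `]0%R, +oo[) \int[P]_w (g (w, t))%:E =
   \int[P]_w \int[mu]_(t in `]0%R, +oo[) (g (w, t))%:E)%E.
Proof.
move=> mg g0.
pose K (z : T * R) : \bar R := (\1_`]0%R, +oo[ z.2 * g z)%:E.
have mK : measurable_fun setT K.
  apply/measurable_EFinP; apply: measurable_funM => //.
  by apply: measurableT_comp => //; exact: measurable_indic_itv.
have K0 z : (0 <= K z)%E.
  rewrite lee_fin indicE mem_setE in_itv/= andbT; case: z => w t /=.
  by case: (ltP 0 t) => t0; rewrite ?mul0r// mul1r g0.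
have KE t : ((fun t => \int[P]_w (g (w, t))%:E) \_ `]0%R, +oo[)%E t = (\int[P]_w K (w, t))%E.
  rewrite patchE; case: (ltP 0 t) => t0.
    rewrite mem_set/= ?in_itv/= ?t0//; apply: eq_integral => w _.
    by rewrite /K/= indicE mem_setE in_itv/= t0 mul1r.
  rewrite memNset/= ?in_itv/= ?andbT; last by apply/negP; rewrite -leNgt.
  rewrite (eq_integral (fun=> 0%E)) ?integral0// => w _.
  by rewrite /K/= indicE mem_setE in_itv/= andbT ltNge t0 mul0r.
split.
  apply/(measurable_restrictT _ mpos); rewrite (funext KE).
  exact: (@measurable_fun_fubini_tonelli_G _ _ _ _ R P K).
rewrite [LHS]integral_mkcond; under [LHS]eq_integral do rewrite KE.
rewrite -(@fubini_tonelli _ _ _ _ R P mu K mK K0); apply: eq_integral => w _.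
rewrite [RHS]integral_mkcond; apply: eq_integral => t _; rewrite /K patchE/= indicE.
by case: (_ \in _); rewrite ?mul1r ?mul0r.
Qed.

Section kernel.
Variables (n : nat) (Y : T -> R) (s : R).
Hypotheses (n0 : (0 < n)%N) (s0 : 0 < s).
Hypotheses (mY : measurable_fun setT Y) (Y0 : forall w, 0 < Y w).

(** For fixed w, the substitution u = t^(1/n) Y(w) has the inverse t = c(w) u^n. *)
Let c w := Y w `^ (- n%:R).

Let c0 w : 0 < c w. Proof. by rewrite powR_gt0. Qed.

Let mc : measurable_fun setT c.
Proof. by apply: (measurableT_comp (f := fun y => y `^ (- n%:R))) => //; exact: measurable_powR. Qed.

Let n0R : 0 < n%:R :> R. Proof. by rewrite ltr0n. Qed.

Let cK w u : 0 < u -> (c w * u ^+ n) `^ (1 / n%:R) * Y w = u.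
Proof.
move=> u0; rewrite powRM ?(ltW (c0 w)) ?exprn_ge0 ?(ltW u0)// /c.
rewrite -(powR_mulrn _ (ltW u0)) -!powRrM.
rewrite -[X in _ * X](powRr1 (ltW (Y0 w))) mulrAC -powRD; last by rewrite lt0r_neq0 ?implybT.
have -> : - n%:R * (1 / n%:R) + 1 = 0 :> R by field; rewrite lt0r_neq0.
have -> : n%:R * (1 / n%:R) = 1 :> R by field; rewrite lt0r_neq0.
by rewrite powRr0 mul1r powRr1// ltW.
Qed.

(** This is e^(-st) dt/du for t = c(w) u^n; averaging over w gives the kernel [k]. *)
Let kappa u w := expR (- (s * (c w * u ^+ n))) * (c w * (n%:R * u ^+ n.-1)).

Let kappa0 u w : 0 < u -> 0 <= kappa u w.
Proof. by move=> u0; rewrite !mulr_ge0 ?expR_ge0 ?(ltW (c0 w)) ?exprn_ge0 ?(ltW u0). Qed.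

(** With z = s c(w) u^n one has kappa = n/(su) z e^(-z), and z e^(-z) <= 1. The bound is uniform in
    w, which gives both the integrability of [kappa] and the continuity of [k]. *)
Let kappa_le u w : 0 < u -> kappa u w <= n%:R / (s * u).
Proof.
move=> u0; set z := s * (c w * u ^+ n).
have -> : kappa u w = n%:R / (s * u) * (z * expR (- z)).
  have uE : u ^+ n = u * u ^+ n.-1 by rewrite -exprS prednK.
  rewrite /kappa -/z {2}/z uE.
  by move: (expR _) (c w) (u ^+ n.-1) (n%:R : R) => a b e f; field; rewrite !lt0r_neq0.
rewrite ler_piMr ?divr_ge0 ?mulr_ge0 ?(ltW u0) ?(ltW s0)//.
rewrite expRN ler_pdivrMr ?expR_gt0// mul1r.
by apply: le_trans (expR_ge1Dx z); rewrite lerDr.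
Qed.

Let mkappa u : measurable_fun setT (kappa u).
Proof.
apply: measurable_funM; last by apply: measurable_funM.
apply: measurableT_comp => //; apply: measurableT_comp => //.
by apply: measurable_funM => //; apply: measurable_funM.
Qed.

Let ikappa u : 0 < u -> P.-integrable setT (EFin \o kappa u).
Proof.
move=> u0.
have ic : P.-integrable setT (EFin \o (fun=> n%:R / (s * u) : R)) by exact: finite_measure_integrable_cst.
apply: (le_integrable measurableT _ _ ic).
  exact/measurable_EFinP.
move=> w _; rewrite lee_fin ger0_norm ?kappa0//.
by rewrite (le_trans (kappa_le w u0))// ler_norm.
Qed.

Let k u := \int[P]_w kappa u w.

Let k0 u : 0 < u -> 0 <= k u.
Proof. by move=> u0; apply: Rintegral_ge0 => w _; exact: kappa0. Qed.

Let ck u : 0 < u -> {for u, continuous k}.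
Proof.
move=> u0.
have I x : `]u / 2, u * 2[%classic x -> u / 2 < x by rewrite /= in_itv/= => /andP[].
have u20 : 0 < u / 2 by rewrite divr_gt0.
have I0 x : `]u / 2, u * 2[%classic x -> 0 < x by move=> /I; exact: lt_trans.
have := @continuity_under_integral R _ T P kappa setT measurableT (u / 2) (u * 2)
  (fun x Ix => ikappa (I0 x Ix)) _ (fun=> n%:R / (s * (u / 2))).
move=> /(_ _ _ _ u); apply.
- apply: aeW => w _ x _.
  suff : {for x, continuous (fun u : R => expR (- (s * (c w * u ^+ n))) * (c w * (n%:R * u ^+ n.-1)))} by [].
  apply: continuousM.
    apply: continuous_comp; last exact: continuous_expR.
    apply: continuousN; apply: continuousM; first exact: cst_continuous.
    by apply: continuousM; [exact: cst_continuous|exact: exprn_continuous].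
  apply: continuousM; first exact: cst_continuous.
  by apply: continuousM; [exact: cst_continuous|exact: exprn_continuous].
- exact: finite_measure_integrable_cst.
- move=> x Ix; apply: aeW => w _; rewrite ger0_norm; last exact: kappa0 (I0 _ Ix).
  have x0 := I0 _ Ix; rewrite (le_trans (kappa_le w x0))// ler_pM2l// lef_pV2 ?posrE.
  + by rewrite ler_pM2l// ltW// I.
  + exact: mulr_gt0.
  + exact: mulr_gt0.
- by rewrite inE/= in_itv/=; apply/andP; split; lra.
Qed.

Lemma laplace_scaled_mixture (F : R -> R) :
  (forall u, 0 < u -> {for u, continuous F}) -> (forall u, 0 < u -> 0 <= F u) ->
  measurable_fun (`]0%R, +oo[ : set (measurableTypeR R))
    (fun t => \int[P]_w (expR (- (s * t)) * F (t `^ (1 / n%:R) * Y w))%:E)%E /\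
  (\int[mu]_(t in `]0%R, +oo[) \int[P]_w (expR (- (s * t)) * F (t `^ (1 / n%:R) * Y w))%:E =
   \int[P]_w \int[mu]_(t in `]0%R, +oo[) (expR (- (s * t)) * F (t `^ (1 / n%:R) * Y w))%:E)%E /\
  (\int[P]_w \int[mu]_(t in `]0%R, +oo[) (expR (- (s * t)) * F (t `^ (1 / n%:R) * Y w))%:E =
   \int[mu]_(u in `]0%R, +oo[) (F u * k u)%:E)%E.
Proof.
move=> cF F0; have mF := pos_continuous_measurable cF.
(* F is controlled only at positive arguments; the extension by zero makes the integrands jointly
   measurable. *)
pose F' := F \_ `]0%R, +oo[.
have mF' : measurable_fun setT F' by exact: (measurable_restrictT _ mpos).1.
have F'E u : 0 < u -> F' u = F u by move=> u0; rewrite /F' patchE mem_set//= in_itv/= u0.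
pose g (z : T * R) := expR (- (s * z.2)) * F' (z.2 `^ (1 / n%:R) * Y z.1).
have mg : measurable_fun setT g.
  apply: measurable_funM.
    by apply: measurableT_comp => //; apply: measurableT_comp => //; apply: measurable_funM.
  apply: measurableT_comp => //; apply: measurable_funM; last exact: measurableT_comp.
  by apply: (measurableT_comp (f := fun y : R => y `^ (1 / n%:R))) => //; exact: measurable_powR.
have gE w t : 0 < t -> g (w, t) = expR (- (s * t)) * F (t `^ (1 / n%:R) * Y w).
  by move=> t0; rewrite /g/= F'E// mulr_gt0 ?powR_gt0.
have [m1 e1] : measurable_fun (`]0%R, +oo[ : set (measurableTypeR R)) (fun t => \int[P]_w (g (w, t))%:E)%E /\
    (\int[mu]_(t in `]0%R, +oo[) \int[P]_w (g (w, t))%:E =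
     \int[P]_w \int[mu]_(t in `]0%R, +oo[) (g (w, t))%:E)%E.
  apply: tonelli_pos => // w t t0; rewrite gE// mulr_ge0 ?expR_ge0// F0//.
  by rewrite mulr_gt0 ?powR_gt0.
split; [|split].
- apply: eq_measurable_fun m1 => t; rewrite inE/= in_itv/= andbT => t0.
  by apply: eq_integral => w _; rewrite gE.
- transitivity (\int[mu]_(t in `]0%R, +oo[) \int[P]_w (g (w, t))%:E)%E.
    apply: eq_integral => t; rewrite inE/= in_itv/= andbT => t0.
    by apply: eq_integral => w _; rewrite gE.
  rewrite e1; apply: eq_integral => w _; apply: eq_integral => t; rewrite inE/= in_itv/= andbT => t0.
  by rewrite gE.
pose g2 (z : T * R) := F' z.2 * kappa z.2 z.1.
have mg2 : measurable_fun setT g2.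
  apply: measurable_funM; first exact: measurableT_comp.
  have mc1 : measurable_fun setT (fun z : T * R => c z.1) by exact: measurableT_comp.
  apply: measurable_funM; last by apply: measurable_funM => //; apply: measurable_funM => //; exact: measurable_funX.
  apply: measurableT_comp => //; apply: measurableT_comp => //.
  by apply: measurable_funM => //; apply: measurable_funM => //; exact: measurable_funX.
have [|_ e2] := tonelli_pos mg2.
  by move=> w u u0; rewrite /g2/= mulr_ge0 ?F'E ?F0 ?kappa0.
transitivity (\int[P]_w \int[mu]_(t in `]0%R, +oo[) (g2 (w, t))%:E)%E.
  apply: eq_integral => w _.
  rewrite (@ge0_integral_subst_exprn R n (c w) (fun t => expR (- (s * t)) * F (t `^ (1 / n%:R) * Y w)))//.
  - apply: eq_integral => u; rewrite inE/= in_itv/= andbT => u0.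
    by rewrite /g2/= cK// F'E// /kappa; congr EFin; ring.
  - move=> t t0; apply: continuousM.
      by apply: continuous_expRM.
    apply: (@continuous_comp R R R (fun t => t `^ (1 / n%:R) * Y w) F).
      by apply: continuousM; [exact: continuous_powR|exact: cst_continuous].
    by apply: cF; rewrite mulr_gt0 ?powR_gt0.
  - by move=> t t0; rewrite mulr_ge0 ?expR_ge0// F0// mulr_gt0 ?powR_gt0.
rewrite -e2; apply: eq_integral => u; rewrite inE/= in_itv/= andbT => u0.
rewrite -[RHS]/((F u)%:E * (k u)%:E)%E /k -EFin_Rintegral ?ikappa//.
rewrite -ge0_integralZl//; first by apply: eq_integral => w _; rewrite /g2/= F'E// EFinM.
- exact/measurable_EFinP.
- by move=> w _; rewrite lee_fin kappa0.
- by rewrite lee_fin F0.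
Qed.

Hypothesis momY : forall i : nat, (\int[P]_w (Y w ^+ i)%:E = (i`!%:R / Gamma (1 + i%:R / n%:R))%:E)%E.
Hypothesis s4 : 4 <= s `^ (1 / n%:R).

(** Take F(u) = u^i: the time integral is Gamma(1 + i/n) s^(-(1 + i/n)) Y^i, and this Gamma value
    cancels the denominator of E Y^i. *)
Let moments_k (i : nat) : (\int[mu]_(u in `]0%R, +oo[) (u ^+ i * k u)%:E =
  (i`!%:R * s `^ (- (1 + i%:R / n%:R)))%:E)%E.
Proof.
have cX (u : R) : 0 < u -> {for u, continuous (fun u : R => u ^+ i)}.
  by move=> _; exact: exprn_continuous.
have [_ [_ <-]] := laplace_scaled_mixture cX (fun u u0 => exprn_ge0 i (ltW u0)).
set a := 1 + _; have a0 : 0 < a by rewrite ltr_pwDl// divr_ge0.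
transitivity (\int[P]_w ((Gamma a * s `^ (- a))%:E * (Y w ^+ i)%:E))%E.
  apply: eq_integral => w _; rewrite -laplace_powR// muleC -ge0_integralZl//.
  - apply: eq_integral => t; rewrite inE/= in_itv/= andbT => t0.
    rewrite -EFinM exprMn /a -(powR_mulrn i (powR_ge0 t _)) -powRrM.
    have -> : 1 / n%:R * i%:R = 1 + i%:R / n%:R - 1 :> R by field; rewrite lt0r_neq0.
    by congr EFin; move: (t `^ _) => z; ring.
  - apply/measurable_EFinP; apply: pos_continuous_measurable => t t0.
    by apply: continuousM; [exact: continuous_expRM|exact: continuous_powR].
  - by move=> t _; rewrite lee_fin mulr_ge0 ?expR_ge0 ?powR_ge0.
  - by rewrite lee_fin exprn_ge0// ltW.
have ga := gamma_gt0 a0.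
rewrite ge0_integralZl//.
- rewrite momY -/a -EFinM; congr EFin; move: (Gamma a) ga => g g0.
  by field; rewrite lt0r_neq0.
- by apply/measurable_EFinP; exact: measurable_funX.
- by move=> w _; rewrite lee_fin exprn_ge0// ltW.
- by rewrite lee_fin mulr_ge0 ?powR_ge0 ?ltW.
Qed.

(** Both sides have i-th moment s^(-1) i! / sigma^i with sigma = s^(1/n), and sigma >= 4 is the
    growth condition of the moment problem with C = 1/s. *)
Let kE u : 0 < u -> k u = s `^ (1 / n%:R - 1) * expR (- (s `^ (1 / n%:R) * u)).
Proof.
have sig0 : 0 < s `^ (1 / n%:R) by rewrite powR_gt0.
apply: (@moments_inj R k (fun u => s `^ (1 / n%:R - 1) * expR (- (s `^ (1 / n%:R) * u)))
  (fun i => i`!%:R * s `^ (- (1 + i%:R / n%:R))) s^-1) => //.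
- by move=> x _; apply: continuousM; [exact: cst_continuous|exact: continuous_expRM].
- by move=> x _; rewrite mulr_ge0 ?powR_ge0 ?expR_ge0.
- move=> i.
  have i10 : 0 < i%:R + 1 :> R by rewrite ltr_wpDl.
  transitivity (\int[mu]_(u in `]0%R, +oo[) ((s `^ (1 / n%:R - 1))%:E *
      (expR (- (s `^ (1 / n%:R) * u)) * u `^ (i%:R + 1 - 1))%:E))%E.
    apply: eq_integral => v; rewrite inE/= in_itv/= andbT => v0.
    rewrite -EFinM addrK powR_mulrn ?(ltW v0)//; congr EFin.
    by move: (s `^ _) (expR _) (v ^+ i) => a1 a2 a3; ring.
  rewrite ge0_integralZl//.
  + rewrite laplace_powR// Gamma_fact -EFinM mulrCA -powRrM -powRD; last by rewrite lt0r_neq0 ?implybT.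
    by congr (_ * _ `^ _)%:E; field; rewrite lt0r_neq0.
  + apply/measurable_EFinP; apply: pos_continuous_measurable => t t0.
    by apply: continuousM; [exact: continuous_expRM|exact: continuous_powR].
  + by move=> t _; rewrite lee_fin mulr_ge0 ?expR_ge0 ?powR_ge0.
  + by rewrite lee_fin powR_ge0.
- move=> i; rewrite [leLHS]mulrC mulrAC ler_wpM2r//.
  have -> : - (1 + i%:R / n%:R) = -1 + - (1 / n%:R * i%:R) :> R by field; rewrite lt0r_neq0.
  rewrite powRD; last by rewrite lt0r_neq0 ?implybT.
  rewrite powR_inv1 ?(ltW s0)// ler_pM2l ?invr_gt0// powRN powRrM powR_mulrn ?(ltW sig0)//.
  by rewrite lef_pV2 ?posrE ?exprn_gt0// lerXn2r ?nnegrE// ltW.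
Qed.

(** An identity in the extended reals, where both sides may be infinite; it can therefore prove
    finiteness, and is used so with F(u) = e^(mu). *)
Lemma laplace_subordination (F : R -> R) :
  (forall u, 0 < u -> {for u, continuous F}) -> (forall u, 0 < u -> 0 <= F u) ->
  measurable_fun (`]0%R, +oo[ : set (measurableTypeR R))
    (fun t => \int[P]_w (expR (- (s * t)) * F (t `^ (1 / n%:R) * Y w))%:E)%E /\
  (\int[mu]_(t in `]0%R, +oo[) \int[P]_w (expR (- (s * t)) * F (t `^ (1 / n%:R) * Y w))%:E =
   (s `^ (1 / n%:R - 1))%:E *
   \int[mu]_(u in `]0%R, +oo[) (expR (- (s `^ (1 / n%:R) * u)) * F u)%:E)%E.
Proof.
move=> cF F0; have [mg [-> ->]] := laplace_scaled_mixture cF F0; split => //.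
rewrite -ge0_integralZl//.
- apply: eq_integral => u; rewrite inE/= in_itv/= andbT => u0.
  by rewrite kE// -EFinM; congr EFin; ring.
- apply/measurable_EFinP; apply: pos_continuous_measurable => u u0.
  by apply: continuousM; [exact: continuous_expRM|exact: cF].
- by move=> u; rewrite /= in_itv/= andbT => u0; rewrite lee_fin mulr_ge0 ?expR_ge0 ?F0.
- by rewrite lee_fin powR_ge0.
Qed.

End kernel.
End subordination.

Section null_set.
Context d (T : measurableType d) (R : realType) (mu : {measure set T -> \bar R}).
Variable N : set T.
Hypotheses (mN : measurable N) (N0 : mu N = 0%E).

Import HBNNSimple.

Let le_nonneg (f g : T -> \bar R) : (forall x, 0 <= f x)%E -> (forall x, 0 <= g x)%E ->
  (forall x, ~ N x -> f x = g x) -> (\int[mu]_x f x <= \int[mu]_x g x)%E.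
Proof.
move=> f0 g0 fg; rewrite !ge0_integralTE//.
apply: ub_ereal_sup => _ [h hf <-].
pose h' := proj_nnsfun h (measurableC mN).
have h'E x : h' x = if x \in N then 0 else h x.
  rewrite /h' /proj_nnsfun/= mindicE in_setC.
  by case: (x \in N); rewrite ?mulr0 ?mulr1.
apply: (@le_trans _ _ (sintegral mu h')).
  rewrite -!integralT_nnsfun; rewrite le_eqVlt; apply/orP; left; apply/eqP.
  apply: ae_eq_integral => //.
  - by apply/measurable_EFinP.
  - by apply/measurable_EFinP.
  exists N; split => // x hx; apply: contrapT => Nx; apply: hx => _.
  by rewrite h'E memNset.
apply: ereal_sup_ubound; exists h' => // x; rewrite h'E.
case: (boolP (x \in N)) => [//|]; rewrite notin_setE => Nx.
by rewrite -fg//; exact: hf.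
Qed.

(* Neither function is assumed measurable: the integral of a nonnegative function is a
   supremum over simple functions, which may be truncated on the null set. *)
Lemma eq_integral_off_null (f g : T -> \bar R) :
  (forall x, ~ N x -> f x = g x) -> (\int[mu]_x f x = \int[mu]_x g x)%E.
Proof.
move=> fg; rewrite integralE [RHS]integralE; congr (_ - _)%E; apply/eqP; rewrite eq_le.
  by apply/andP; split; apply: le_nonneg => // x Nx; rewrite !funeposE fg.
by apply/andP; split; apply: le_nonneg => // x Nx; rewrite !funenegE fg.
Qed.

End null_set.

(** * Subordination of exponentially bounded functions *)

Section subordinated_function.
Context {R : realType} d (T : measurableType d) (P : probability T R).
Local Notation mu := (@lebesgue_measure R).
Variables (n : nat) (Y : T -> R).
Hypotheses (n0 : (0 < n)%N).
Hypotheses (mY : measurable_fun setT Y) (Y0 : forall w, 0 < Y w).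
Hypothesis momY : forall i : nat, (\int[P]_w (Y w ^+ i)%:E = (i`!%:R / Gamma (1 + i%:R / n%:R))%:E)%E.

Let mpos : measurable (`]0%R, +oo[%classic : set (measurableTypeR R)) := @measurable_pos R.

Let n0R : 0 < n%:R :> R. Proof. by rewrite ltr0n. Qed.

Local Notation rt t := (t `^ (1 / n%:R)).

Let rtK (s : R) : 0 < s -> rt (s ^+ n) = s.
Proof.
move=> s0; rewrite -powR_mulrn ?(ltW s0)// -powRrM.
by rewrite (_ : _ * _ = 1) ?powRr1 ?(ltW s0)//; field; rewrite lt0r_neq0.
Qed.

Let rt_le (s t : R) : 0 < s -> s <= t -> rt s <= rt t.
Proof.
move=> s0 st; apply: ge0_ler_powR; rewrite ?nnegrE ?divr_ge0 ?(ltW s0)//.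
exact: le_trans (ltW s0) st.
Qed.

Let expRM_cont (m u : R) : {for u, continuous (fun u : R => expR (m * u))}.
Proof.
apply: continuous_comp; last exact: continuous_expR.
by apply: continuousM; [exact: cst_continuous|exact: id].
Qed.

(** The subordination identity for e^(mu) shows that the expectation has a finite Laplace integral
    over time. Since it increases in time, an infinite value at t would persist on ]t, t + 1[ and
    make that integral infinite. *)
Let mgf_lty (m t : R) : 0 < m -> 0 < t -> (\int[P]_w (expR (m * (rt t * Y w)))%:E < +oo)%E.
Proof.
move=> m0 t0.
(* Against e^(mu), the exponent 4 + m leaves e^(-4u), and it meets the threshold 4. *)
pose sg : R := 4 + m; have sg0 : 0 < sg by rewrite addr_gt0.
pose s := sg ^+ n; have s0 : 0 < s by rewrite exprn_gt0.
have s4 : 4 <= rt s by rewrite rtK// lerDl ltW.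
have [mg e] := laplace_subordination n0 s0 mY Y0 momY s4
  (fun u _ => @expRM_cont m u) (fun u _ => expR_ge0 (m * u)).
have fin : (\int[mu]_(t in `]0%R, +oo[) \int[P]_w (expR (- (s * t)) * expR (m * (rt t * Y w)))%:E < +oo)%E.
  rewrite e rtK//.
  have -> : (\int[mu]_(u in `]0%R, +oo[) (expR (- (sg * u)) * expR (m * u))%:E =
      \int[mu]_(u in `]0%R, +oo[) (expR (- (4 * u)) * u `^ (1 - 1))%:E)%E.
    apply: eq_integral => u _; rewrite subrr powRr0 mulr1 -expRD; congr (expR _)%:E.
    by rewrite /sg; ring.
  by rewrite laplace_powR// -EFinM ltry.
have mexp : measurable_fun setT (fun w => (expR (m * (rt t * Y w)))%:E).
  apply/measurable_EFinP; apply: measurableT_comp => //; apply: measurable_funM => //.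
  exact: measurable_funM.
set H := (\int[P]_w _)%E.
have H0 : (0 <= H)%E by apply: integral_ge0 => w _; rewrite lee_fin expR_ge0.
pose e0 := expR (- (s * (t + 1))); have e00 : 0 < e0 by exact: expR_gt0.
have step : (e0%:E * H <= \int[mu]_(t in `]0%R, +oo[) \int[P]_w (expR (- (s * t)) * expR (m * (rt t * Y w)))%:E)%E.
  have mI : measurable (`]t, t + 1[%classic : set (measurableTypeR R)) by exact: measurable_itv.
  have sub : (`]t, t + 1[ `<=` `]0%R, +oo[)%classic.
    by move=> u; rewrite /= !in_itv/= andbT => /andP[+ _]; exact: lt_trans.
  apply: le_trans; last first.
    apply: (ge0_subset_integral _ mI mpos mg _ sub).
    by move=> u _; apply: integral_ge0 => w _; rewrite lee_fin mulr_ge0 ?expR_ge0.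
  have -> : (e0%:E * H = \int[mu]_(u in `]t, (t + 1)%R[) (cst (e0%:E * H) u))%E.
    have I1 : mu `]t, (t + 1)%R[%classic = 1%E.
      by rewrite lebesgue_measure_itv/= lte_fin ltrDl ltr01 -EFinB addrAC subrr add0r.
    by rewrite integral_cst// -[LHS]mule1; congr (_ * _)%E; rewrite -I1.
  apply: ge0_le_integral => //.
  - by move=> u _; rewrite mule_ge0// lee_fin ltW.
  - exact: measurable_funS mpos sub mg.
  - move=> u; rewrite /= in_itv/= => /andP[tu ut].
    have -> : (e0%:E * H = \int[P]_w (e0%:E * (expR (m * (rt t * Y w)))%:E))%E.
      by rewrite ge0_integralZl// lee_fin ltW.
    apply: ge0_le_integral => //.
    + by move=> w _; rewrite mule_ge0 ?lee_fin ?expR_ge0// ltW.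
    + by apply: emeasurable_funM.
    + apply/measurable_EFinP; apply: measurable_funM => //; apply: measurableT_comp => //.
      by apply: measurable_funM => //; exact: measurable_funM.
    + move=> w _; rewrite -EFinM lee_fin ler_pM ?expR_ge0//.
        by rewrite ler_expR lerN2 ler_pM2l// ltW.
      by rewrite ler_expR ler_pM2l// ler_pM2r// rt_le// ltW.
have {step}fin2 := le_lt_trans step fin.
case: H H0 fin2 => [r _ _|_|//]; first exact: ltry.
by rewrite gt0_muley// lte_fin.
Qed.

Section bounded.
Variables (F : R -> R) (C m : R).
Hypotheses (m0 : 0 < m) (cF : forall u, 0 < u -> {for u, continuous F}).
Hypothesis bF : forall u, 0 < u -> `|F u| <= C * expR (m * u).

Let C0 : 0 <= C.
Proof.
have := le_trans (normr_ge0 _) (bF ltr01); rewrite pmulr_lge0//; exact: expR_gt0.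
Qed.

Let rtY0 (t : R) w : 0 < t -> 0 < rt t * Y w.
Proof. by move=> t0; rewrite mulr_gt0 ?powR_gt0. Qed.

Let mFY (t : R) : 0 < t -> measurable_fun setT (fun w => F (rt t * Y w)).
Proof.
move=> t0; have mF := pos_continuous_measurable cF.
rewrite (_ : (fun w => _) = (F \_ `]0%R, +oo[) \o (fun w => rt t * Y w)); last first.
  by apply/funext => w; rewrite /= patchE mem_set//= in_itv/= rtY0.
apply: measurableT_comp; last exact: measurable_funM.
exact: (measurable_restrictT _ mpos).1.
Qed.

Lemma integrable_subordinated (t : R) : 0 < t ->
  P.-integrable setT (fun w => (F (rt t * Y w))%:E).
Proof.
move=> t0.
have ie : P.-integrable setT (EFin \o (fun w => C * expR (m * (rt t * Y w)))).
  apply: integrable_mulrl => //; apply/integrableP; split.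
    apply/measurable_EFinP; apply: measurableT_comp => //; apply: measurable_funM => //.
    exact: measurable_funM.
  rewrite (_ : (\int[P]_x _)%E = (\int[P]_w (expR (m * (rt t * Y w)))%:E)%E) ?mgf_lty//.
  by apply: eq_integral => w _; rewrite /= ger0_norm// expR_ge0.
apply: (le_integrable measurableT _ _ ie).
  by apply/measurable_EFinP; exact: mFY.
move=> w _; rewrite lee_fin; apply: (le_trans (bF (rtY0 w t0))); exact: ler_norm.
Qed.

Let g t := \int[P]_w F (rt t * Y w).

(** The majorant C e^(m u^(1/n) Y) increases with the time u, so its value at 2t dominates on all of
    ]t/2, 2t[. *)
Lemma continuous_subordinated t : 0 < t -> {for t, continuous g}.
Proof.
move=> t0.
have I0 x : `]t / 2, t * 2[%classic x -> 0 < x.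
  by rewrite /= in_itv/= => /andP[+ _]; apply: lt_trans; rewrite divr_gt0.
have t20 : 0 < t * 2 by rewrite mulr_gt0.
have ie : P.-integrable setT (EFin \o (fun w => C * expR (m * (rt (t * 2) * Y w)))).
  apply: integrable_mulrl => //; apply/integrableP; split.
    apply/measurable_EFinP; apply: measurableT_comp => //; apply: measurable_funM => //.
    exact: measurable_funM.
  rewrite (_ : (\int[P]_x _)%E = (\int[P]_w (expR (m * (rt (t * 2) * Y w)))%:E)%E) ?mgf_lty//.
  by apply: eq_integral => w _; rewrite /= ger0_norm// expR_ge0.
have := @continuity_under_integral R _ T P (fun t w => F (rt t * Y w)) setT measurableT (t / 2) (t * 2)
  (fun x Ix => integrable_subordinated (I0 x Ix)) _ _ ie.
move=> /(_ _ _ t); apply.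
- apply: aeW => w _ x; rewrite inE => /I0 x0.
  suff : {for x, continuous (fun t : R => F (rt t * Y w))} by [].
  apply: (@continuous_comp R R R (fun t => rt t * Y w) F).
    by apply: continuousM; [exact: continuous_powR|exact: cst_continuous].
  exact: cF (rtY0 w x0).
- move=> x Ix; apply: aeW => w _; have x0 := I0 _ Ix.
  apply: (le_trans (bF (rtY0 w x0))); rewrite ler_wpM2l// ler_expR ler_pM2l// ler_pM2r// rt_le//.
  by move: Ix; rewrite /= in_itv/= => /andP[_ /ltW].
- by rewrite inE/= in_itv/=; apply/andP; split; lra.
Qed.

Lemma integrable_laplace_dominated (s : R) : m < s -> mu.-integrable `]0%R, +oo[ (fun u => (expR (- (s * u)) * F u)%:E).
Proof.
move=> ms; have ms0 : 0 < s - m by rewrite subr_gt0.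
have ie := integrable_mulrl mpos C (integrable_expR ms0).
apply: (le_integrable mpos _ _ ie).
  apply/measurable_EFinP; apply: pos_continuous_measurable => u u0.
  by apply: continuousM; [exact: continuous_expRM|exact: cF].
move=> u; rewrite /= in_itv/= andbT => u0; rewrite lee_fin normrM (ger0_norm (expR_ge0 _)).
apply: le_trans (ler_norm _).
apply: (@le_trans _ _ (expR (- (s * u)) * (C * expR (m * u)))).
  by rewrite ler_wpM2l ?expR_ge0// bF.
by rewrite mulrCA -expRD; rewrite (_ : - (s * u) + m * u = - ((s - m) * u))//; ring.
Qed.

Lemma laplace_subordinated_nonneg (s : R) : (forall u, 0 < u -> 0 <= F u) ->
  0 < s -> 4 <= rt s -> m < rt s ->
  mu.-integrable `]0%R, +oo[ (fun t => (expR (- (s * t)) * g t)%:E) /\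
  \int[mu]_(t in `]0%R, +oo[) (expR (- (s * t)) * g t) =
  s `^ (1 / n%:R - 1) * \int[mu]_(u in `]0%R, +oo[) (expR (- (rt s * u)) * F u).
Proof.
move=> F0 s0 s4 ms.
have [_ e] := laplace_subordination n0 s0 mY Y0 momY s4 cF F0.
have {e} : (\int[mu]_(t in `]0%R, +oo[) (expR (- (s * t)) * g t)%:E =
    (s `^ (1 / n%:R - 1) * \int[mu]_(u in `]0%R, +oo[) (expR (- (rt s * u)) * F u))%:E)%E.
  rewrite EFinM -EFin_Rintegral//; last exact: integrable_laplace_dominated.
  rewrite -e; apply: eq_integral => t; rewrite inE/= in_itv/= andbT => t0.
  rewrite EFinM -EFin_Rintegral//; last exact: integrable_subordinated.
  rewrite -ge0_integralZl//.
  - by apply/measurable_EFinP; exact: mFY.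
  - by move=> w _; rewrite lee_fin F0// rtY0.
move=> e; split; last by rewrite /Rintegral e.
apply/integrableP; split.
  apply/measurable_EFinP; apply: pos_continuous_measurable => t t0.
  by apply: continuousM; [exact: continuous_expRM|exact: continuous_subordinated].
rewrite (_ : (\int[mu]_(x in _) _)%E = (\int[mu]_(t in `]0%R, +oo[) (expR (- (s * t)) * g t)%:E)%E).
  by rewrite e ltry.
apply: eq_integral => t; rewrite inE/= in_itv/= andbT => t0.
rewrite ger0_norm// mulr_ge0 ?expR_ge0//.
by apply: Rintegral_ge0 => w _; rewrite F0// rtY0.
Qed.

End bounded.

(** Signed F is reached by subtraction: with E(u) = C e^(mu), both E and F + E are nonnegative,
    continuous and exponentially bounded. *)
Lemma laplace_subordinated (F : R -> R) (C m s : R) : 0 < m ->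
  (forall u, 0 < u -> {for u, continuous F}) ->
  (forall u, 0 < u -> `|F u| <= C * expR (m * u)) ->
  0 < s -> 4 <= rt s -> m < rt s ->
  let g t := \int[P]_w F (rt t * Y w) in
  mu.-integrable `]0%R, +oo[ (fun t => (expR (- (s * t)) * g t)%:E) /\
  \int[mu]_(t in `]0%R, +oo[) (expR (- (s * t)) * g t) =
  s `^ (1 / n%:R - 1) * \int[mu]_(u in `]0%R, +oo[) (expR (- (rt s * u)) * F u).
Proof.
move=> m0 cF bF s0 s4 ms g.
have C0 : 0 <= C.
  have := le_trans (normr_ge0 _) (bF 1 ltr01); rewrite pmulr_lge0//; exact: expR_gt0.
pose E u := C * expR (m * u); pose G u := F u + E u.
have E0 u : 0 <= E u by rewrite mulr_ge0 ?expR_ge0.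
have cE u : 0 < u -> {for u, continuous E}.
  by move=> _; apply: continuousM; [exact: cst_continuous|exact: expRM_cont].
have bE u : 0 < u -> `|E u| <= C * expR (m * u) by move=> _; rewrite ger0_norm.
have G0 u : 0 < u -> 0 <= G u.
  by move=> u0; rewrite -lerBlDr sub0r; have := bF u u0; rewrite ler_norml => /andP[].
have cG u : 0 < u -> {for u, continuous G}.
  by move=> u0; apply: continuousD; [exact: cF|exact: cE].
have bG u : 0 < u -> `|G u| <= (C + C) * expR (m * u).
  by move=> u0; rewrite mulrDl (le_trans (ler_normD _ _))// lerD ?bF ?bE.
have [iE eE] := laplace_subordinated_nonneg m0 cE bE (fun u _ => E0 u) s0 s4 ms.
have [iG eG] := laplace_subordinated_nonneg m0 cG bG G0 s0 s4 ms.
pose gE t := \int[P]_w E (rt t * Y w); pose gG t := \int[P]_w G (rt t * Y w).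
have gD t : 0 < t -> gG t - gE t = g t.
  move=> t0; rewrite /gG /gE -RintegralB//.
  - by apply: eq_Rintegral => w _; rewrite /G addrK.
  - exact: (integrable_subordinated m0 cG bG).
  - exact: (integrable_subordinated m0 cE bE).
have gD' t : 0 < t -> expR (- (s * t)) * gG t - expR (- (s * t)) * gE t = expR (- (s * t)) * g t.
  by move=> t0; rewrite -mulrBr gD.
have posE (t : R) : `]0%R, +oo[%classic t -> 0 < t by rewrite /= in_itv/= andbT.
split.
  by apply: (eq_integrable_real mpos (integrable_subr mpos iG iE)) => t /posE; exact: gD'.
transitivity (\int[mu]_(t in `]0%R, +oo[) (expR (- (s * t)) * gG t - expR (- (s * t)) * gE t)).
  by apply: eq_Rintegral => t; rewrite inE => /posE t0; rewrite gD'.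
rewrite RintegralB// [X in X - _]eG [X in _ - X]eE -mulrBr -RintegralB//.
- by congr (_ * _); apply: eq_Rintegral => u _; rewrite -mulrBr /G addrK.
- exact: (integrable_laplace_dominated cG bG).
- exact: (integrable_laplace_dominated cE bE).
Qed.

End subordinated_function.

(** * Comparison of the two problems *)

Section initial_data.
Context {R : realType}.
Local Notation mu := (@lebesgue_measure R).

Lemma ltn_ceiln (h : nat) (a : R) : 0 <= a -> (h < ceiln a)%N = (h%:R < a).
Proof.
move=> a0; have e := ceiln_ge0E a0.
rewrite -(ltr_nat R) e -[h%:R]/(h%:~R : R) ltr_int.
by rewrite real_ceil_gt_int// num_real.
Qed.

(** Matches initial data placed at the multiples of n with the data of the problem of order nu/n;
    the hypothesis on [c1] and [c2] says c1 = ceil(c2 / n). *)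
Lemma sum_multiples (V : nmodType) (n c1 c2 : nat) (a : nat -> V) : (0 < n)%N ->
  (forall h : nat, (h < c1)%N = (h * n < c2)%N) ->
  \sum_(l < c2) (if (n %| l)%N then a (l %/ n)%N else 0) = \sum_(h < c1) a h.
Proof.
move=> n0 H.
have -> : c1 = ((c2 + n.-1) %/ n)%N.
  have H' h : (h < c1)%N = (h < (c2 + n.-1) %/ n)%N.
    by rewrite H leq_divRL// mulSn -(leq_add2r n.-1) addSn -addnS prednK// addnC.
  by apply/eqP; rewrite eqn_leq leqNgt H' ltnn/= leqNgt -H' ltnn.
elim: c2 {H} => [|c IH]; first by rewrite add0n divn_small ?prednK// !big_ord0.
rewrite big_ord_recr/= IH addSn divnS//.
have -> : (c + n.-1).+1 = (c + n)%N by rewrite -addnS prednK.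
rewrite dvdn_addl//; case: ifP => [/dvdnP[q ->]|_]; last by rewrite add0n addr0.
by rewrite mulnK// divnMDl// divn_small ?prednK// addn0 add1n big_ord_recr.
Qed.

(** A nonzero real polynomial has no root beyond its Cauchy bound; it is nonzero here because its
    complex image is. *)
Lemma horner_eventually_neq0 (N : nat) (lam : nat -> R) :
  \sum_(k < N.+1) real_complex R (lam k) *: 'X^k != 0 ->
  exists b : R, forall y, b <= y -> \sum_(k < N.+1) lam k * y ^+ k != 0.
Proof.
move=> p0; pose q : {poly R} := \sum_(k < N.+1) lam k *: 'X^k.
have q0 : q != 0.
  apply: contra_neq p0 => q0.
  have : map_poly (real_complex R) q = 0 by rewrite q0 rmorph0.
  rewrite /q rmorph_sum/= => e; rewrite -[RHS]e; apply: eq_bigr => k _.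
  by rewrite map_polyZ/= map_polyXn.
exists (polyrcf.cauchy_bound q) => y qy.
have := polyrcf.ge_cauchy_bound q0; move=> /(_ y); rewrite in_itv/= andbT => /(_ qy).
rewrite /root /q horner_sum; congr (~~ (_ == 0)); apply: eq_bigr => k _.
by rewrite hornerZ hornerXn.
Qed.

Lemma exponential_bound (F : R -> R) (l m : R) : 0 < m ->
  (forall u, 0 < u -> {for u, continuous F}) ->
  F u @[u --> (0 : R)^'+] --> l -> expR (- (m * u)) * F u @[u --> +oo] --> 0 ->
  exists C : R, forall u, 0 < u -> `|F u| <= C * expR (m * u).
Proof.
move=> m0 cF F0 /cvgrPdist_le/(_ 1 ltr01)[A [_ FA]].
have [M FM] := bounded_near_zero (A + 1) cF F0.
exists (Num.max M 1) => u u0.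
have [uA|Au] := leP u (A + 1).
  apply: (le_trans (FM u u0 uA)); apply: (@le_trans _ _ (Num.max M 1)).
    by rewrite le_max lexx.
  rewrite ler_peMr//; first by rewrite le_max ler01 orbT.
  by rewrite -expR0 ler_expR mulr_ge0 ?ltW.
have := FA u (lt_trans _ Au); rewrite ltrDl ltr01 => /(_ isT).
rewrite sub0r normrN normrM (ger0_norm (expR_ge0 _)) expRN mulrC ler_pdivrMr ?expR_gt0//.
move=> /le_trans; apply; rewrite ler_wpM2r ?expR_ge0//.
by rewrite le_max lexx orbT.
Qed.

Lemma solves_caputo_exponential_bound d (al : R) N (lam : nat -> R)
    (init : nat -> 'rV[R]_d -> R) F (x : 'rV[R]_d) : 0 < al -> (N = 0%N -> lam 0%N != 0) ->
  solves_caputo al N lam init F ->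
  exists m C : R, [/\ 0 < m, forall u, 0 < u -> {for u, continuous (F^~ x)} &
    forall u, 0 < u -> `|F u x| <= C * expR (m * u)].
Proof.
move=> al0 lam0 [/(_ x)[m [m0 [dF [_ Fy]]]] eqF initF].
have cF u : 0 < u -> {for u, continuous (F^~ x)} by move=> u0; exact: (@derive1n_continuous R (F^~ x) dF 0%N u u0).
have [l Fl] : exists l : R, F u x @[u --> (0 : R)^'+] --> l.
  (* For N = 0 no initial value is prescribed, but the equation reads lam_0 F = 0 and forces F = 0.
     Otherwise the limit at 0 is the first initial value. *)
  case: N lam0 eqF initF => [lam0 eqF _|N _ _ initF].
    exists 0; have F0 u : 0 < u -> F u x = 0.
      move=> u0; have [_] := eqF u x u0; rewrite big_ord1 mulr0 /caputo.
      rewrite (_ : (0 : R) \is a Num.nat); last exact: (natr_nat R 0%N).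
      rewrite truncn0 /= => /eqP; rewrite mulf_eq0 (negbTE (lam0 erefl)) => /eqP; exact.
    apply: cvg_near_cst; near=> u; apply: F0; near: u; exact: nbhs_right_gt.
  exists (init 0%N x); apply: (initF 0%N x).
  by rewrite ltn_ceiln ?mulr_ge0 ?(ltW al0)// mulr_gt0.
have [C bF] := exponential_bound m0 cF Fl (Fy 0%N).
by exists m, C.
Unshelve. all: end_near. Qed.

End initial_data.

Section initial_values.
Context {R : realType}.

(** At l = hn the exponents agree: (nu k - hn - 1)/n + 1/n - 1 = nu k/n - h - 1. This is why the
    data f_h sit at the orders hn and why the prefactor is s^(1/n - 1). *)
Lemma laplace_initial_data (N n : nat) (nu s : R) (lam f : nat -> R) : (0 < n)%N -> 0 < nu -> 0 < s ->
  s `^ (1 / n%:R - 1) * (\sum_(k < N.+1) lam k * (\sum_(l < ceiln (nu * k%:R))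
    (s `^ (1 / n%:R)) `^ (nu * k%:R - l%:R - 1) *
      (if (n %| l)%N && (l %/ n < ceiln (N%:R * nu / n%:R))%N then f (l %/ n)%N else 0))) =
  \sum_(k < N.+1) lam k * (\sum_(h < ceiln (nu / n%:R * k%:R)) s `^ (nu / n%:R * k%:R - h%:R - 1) * f h).
Proof.
move=> n0 nu0 s0; have n0R : 0 < n%:R :> R by rewrite ltr0n.
have ltM (q k : nat) : (q < ceiln (nu / n%:R * k%:R))%N = (q * n < ceiln (nu * k%:R))%N.
  rewrite !ltn_ceiln ?mulr_ge0 ?invr_ge0 ?(ltW nu0)// natrM.
  by rewrite mulrAC ltr_pdivlMr.
rewrite mulr_sumr; apply: eq_bigr => k _; rewrite mulrCA; congr (_ * _).
rewrite mulr_sumr.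
rewrite -(@sum_multiples _ n _ _ (fun h => s `^ (nu / n%:R * k%:R - h%:R - 1) * f h) n0 (fun h => ltM h k)).
apply: eq_bigr => -[l lk] _ /=; case: (boolP (n %| l)%N) => [/dvdnP[q lE]|_]; last by rewrite !mulr0.
rewrite lE in lk *; rewrite mulnK//=.
(* The cutoff written into the data holds automatically here, because qn < nu k with k <= N. *)
have -> : (q < ceiln (N%:R * nu / n%:R))%N.
  have := lk; rewrite -ltM => /leq_trans; apply; apply: ceiln_le.
    by rewrite !mulr_ge0 ?invr_ge0 ?(ltW nu0).
  rewrite mulrAC [N%:R * _]mulrC ler_pM2r ?invr_gt0// ler_pM2l// ler_nat.
  by rewrite -ltnS.
rewrite mulrA -powRrM -powRD; last by rewrite lt0r_neq0 ?implybT.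
by congr (_ `^ _ * _); rewrite natrM; field; rewrite lt0r_neq0.
Qed.

Lemma prod_monic_neq0 (N M : nat) (lam : nat -> R) (eta : 'I_M -> R[i]) (m : 'I_M -> nat) :
  \sum_(k < N.+1) real_complex R (lam k) *: 'X^k = \prod_(j < M) ('X - (eta j)%:P) ^+ m j ->
  \sum_(k < N.+1) real_complex R (lam k) *: 'X^k != 0.
Proof.
by move=> ->; apply/prodf_neq0 => j _; rewrite expf_neq0// polyXsubC_eq0.
Qed.

End initial_values.

Theorem theorem3p2 (R : realType) (d N n : nat) (nu : R)
    (lambda : nat -> R) (f : nat -> 'rV[R]_d -> R)
    (Fnun Fnu : R -> 'rV[R]_d -> R) :
  (2 <= n)%N -> 0 < nu ->
  (exists (M : nat) (eta : 'I_M -> R[i]) (m : 'I_M -> nat),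
      [/\ injective eta, (forall j, eta j != 0), (forall j, (0 < m j)%N) &
          \sum_(k < N.+1) real_complex R (lambda k) *: 'X^k
          = \prod_(j < M) ('X - (eta j)%:P) ^+ m j]) ->
  solves_caputo (nu / n%:R) N lambda f Fnun ->
  solves_caputo nu N lambda
    (fun l x => if (n %| l)%N && (l %/ n < ceiln (N%:R * nu / n%:R))%N
                then f (l %/ n)%N x else 0) Fnu ->
  forall (t : R) (x : 'rV[R]_d), 0 < t ->
  forall (dT : measure_display) (T : measurableType dT) (P : probability T R)
         (G : 'I_n.-1 -> {RV P >-> R}),
    mutually_independent P (fun j => G j) ->
    (forall (j : 'I_n.-1) (A : set R), measurable A ->
       distribution P (G j) A
       = (\int[lebesgue_measure]_(y in A) (G_density n j.+1 t y)%:E)%E) ->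
    (Fnun t x)%:E = ('E_P[fun w => Fnu (\prod_(j < n.-1) G j w)%R x])%E.
Proof.
move=> n2 nu0 [M [eta [mlt [_ _ _ /prod_monic_neq0 p0]]]] sFnun sFnu t x t0 dT T P G indG lawG.
have n0 : (0 < n)%N by exact: leq_trans n2.
have n0R : 0 < n%:R :> R by rewrite ltr0n.
have al0 : 0 < nu / n%:R by rewrite divr_gt0.
have mpos := @measurable_pos R.
pose rt (s : R) := s `^ (1 / n%:R).
pose Z w := \prod_(j < n.-1) posval (G j w).
have Z0 w : 0 < Z w by apply: prodr_gt0 => j _; exact: posval_gt0.
have mZ : measurable_fun setT Z.
  apply: measurable_prod => j _; apply: measurableT_comp; first exact: measurable_posval.
  exact: measurable_funPT.
(* Here t is the fixed time of the statement. The process u^(1/n) Y, defined for all u > 0, takes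
   the value [Z] at u = t. *)
pose Y w := (rt t)^-1 * Z w.
have rt0 : 0 < rt t by rewrite powR_gt0.
have Y0 w : 0 < Y w by rewrite mulr_gt0 ?invr_gt0.
have mY : measurable_fun setT Y by exact: measurable_funM.
have YE w : rt t * Y w = Z w by rewrite mulrA divff ?mul1r// lt0r_neq0.
have momY i : (\int[P]_w (Y w ^+ i)%:E = (i`!%:R / Gamma (1 + i%:R / n%:R))%:E)%E.
  transitivity (\int[P]_w ((rt t ^- i)%:E * (Z w ^+ i)%:E))%E.
    by apply: eq_integral => w _; rewrite -EFinM /Y exprMn exprVn.
  rewrite ge0_integralZl//; last 3 first.
  - by apply/measurable_EFinP; exact: measurable_funX.
  - by move=> w _; rewrite lee_fin exprn_ge0// ltW.
  - by rewrite lee_fin invr_ge0 exprn_ge0// ltW.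
  rewrite (moments_prod_G n2 t0 indG lawG) -EFinM; congr EFin.
  have -> : t `^ (i%:R / n%:R) = rt t ^+ i.
    by rewrite -powR_mulrn ?(ltW rt0)// -powRrM mulrAC mul1r.
  by rewrite mulrA mulVf ?mul1r// expf_neq0// lt0r_neq0.
have lam0 : N = 0%N -> lambda 0%N != 0.
  move=> N0; move: p0; rewrite N0 big_ord1; apply: contra_neq => ->.
  by rewrite rmorph0 scale0r.
have [m [C [m0 cF bF]]] := solves_caputo_exponential_bound x nu0 lam0 sFnu.
have [b pb] := horner_eventually_neq0 p0.
have [m1 [m10 L1]] := laplace_solves_caputo x al0 sFnun.
have [m2 [m20 L2]] := laplace_solves_caputo x nu0 sFnu.
have cFnun u : 0 < u -> {for u, continuous (Fnun^~ x)}.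
  have [/(_ x)[_ [_ [dF _]]] _ _] := sFnun.
  by move=> u0; exact: (@derive1n_continuous R (Fnun^~ x) dF 0%N u u0).
pose g u := \int[P]_w Fnu (rt u * Y w) x.
have cg u : 0 < u -> {for u, continuous g}.
  by move=> u0; exact: (continuous_subordinated n0 mY Y0 momY m0 cF bF u0).
(* [B] puts s^(1/n) above 4, above the growth exponent [m] and above the abscissa [m2]; [b1] is made
   positive so that s^(nu/n) >= b can be solved for s. *)
pose B := 4 + m + m2; pose b1 := Num.max b 1.
have b10 : 0 < b1 by rewrite lt_max ltr01 orbT.
pose s0 := Num.max (m1 + 1) (Num.max (B ^+ n) (b1 `^ (nu / n%:R)^-1)).
have main s : s0 <= s -> [/\ (@lebesgue_measure R).-integrable `]0%R, +oo[ (fun u => (expR (- (s * u)) * g u)%:E),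
    (@lebesgue_measure R).-integrable `]0%R, +oo[ (fun u => (expR (- (s * u)) * Fnun u x)%:E) &
    \int[lebesgue_measure]_(u in `]0%R, +oo[) (expR (- (s * u)) * g u) =
    \int[lebesgue_measure]_(u in `]0%R, +oo[) (expR (- (s * u)) * Fnun u x)].
  rewrite /s0 !ge_max => /and3P[sm1 sB sb].
  have s00 : 0 < s by lra.
  have B0 : 0 < B by rewrite /B; lra.
  have Bs : B <= rt s.
    have -> : B = rt (B ^+ n).
      rewrite /rt -powR_mulrn ?(ltW B0)// -powRrM.
      by rewrite (_ : _ * _ = 1) ?powRr1 ?(ltW B0)//; field; rewrite lt0r_neq0.
    by apply: ge0_ler_powR; rewrite ?nnegrE ?divr_ge0 ?exprn_ge0 ?(ltW s00) ?(ltW B0).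
  have bs : b <= s `^ (nu / n%:R).
    apply: (@le_trans _ _ b1); first by rewrite le_max lexx.
    have -> : b1 = (b1 `^ (nu / n%:R)^-1) `^ (nu / n%:R).
      by rewrite -powRrM mulVf ?powRr1 ?(ltW b10)// lt0r_neq0.
    by apply: ge0_ler_powR; rewrite ?nnegrE ?powR_ge0 ?(ltW al0) ?(ltW s00).
  have [B4 Bm Bm2] : [/\ 4 <= rt s, m < rt s & m2 < rt s] by split; move: Bs; rewrite /B; lra.
  have [ig eg] := laplace_subordinated n0 mY Y0 momY m0 cF bF s00 B4 Bm.
  have sm : m1 < s by lra.
  have [iF eF1] := L1 s sm.
  have [_ eF2] := L2 (rt s) Bm2.
  split => //.
  have pE (k : nat) : s `^ (nu / n%:R * k%:R) = (s `^ (nu / n%:R)) ^+ k.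
    by rewrite powRrM powR_mulrn// powR_ge0.
  have pE2 (k : nat) : rt s `^ (nu * k%:R) = s `^ (nu / n%:R * k%:R).
    by rewrite /rt -powRrM; congr (_ `^ _); field; rewrite lt0r_neq0.
  (* Both characteristic sums coincide, as (s^(1/n))^(nu k) = s^(nu k/n). Multiplied by this nonzero
     value, the two transforms become the same expression in the initial data. *)
  apply: (mulfI (pb _ bs)).
  under eq_bigr do rewrite -pE.
  rewrite eF1 -(laplace_initial_data N lambda (f^~ x) n0 nu0 s00) -eF2.
  under [in RHS]eq_bigr do rewrite pE2.
  by rewrite [X in _ * X = _]eg mulrCA.
have gE : g t = Fnun t x.
  apply/eqP; rewrite -subr_eq0; apply/eqP.
  have [ig iF _] := main s0 (lexx _).
  apply: (@laplace_inj R (fun u => g u - Fnun u x) s0 _ _ _ t t0).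
  - by move=> u u0; apply: continuousB; [exact: cg|exact: cFnun].
  - by apply: (eq_integrable_real mpos (integrable_subr mpos ig iF)) => u _; rewrite mulrBr.
  - move=> k; have [|ig' iF' e] := main (s0 + k%:R); first by rewrite lerDl.
    by under eq_Rintegral do rewrite mulrBr; rewrite RintegralB// e subrr.
rewrite -gE unlock /g.
(* Return from [Z] to the product of the G_j: they can differ only where some G_j <= 0, and each
   such event is null because the density vanishes there. *)
pose A j := G j @^-1` `]-oo, 0%R]%classic.
have mA j : measurable (A j).
  by rewrite -[A j]setTI; apply: measurable_funPT => //; exact: measurable_itv.
have A0 j : P (A j) = 0%E.
  have := lawG j `]-oo, 0%R]%classic (measurable_itv _); rewrite /distribution/= /pushforward => ->.
  rewrite (eq_integral (fun=> 0%E)) ?integral0// => y; rewrite inE/= in_itv/= => y0.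
  by rewrite /G_density ltNge y0.
pose Nul := \big[setU/set0]_(j < n.-1) A j.
have [mN N0] : measurable Nul /\ P Nul = 0%E.
  rewrite /Nul; elim/big_ind : _ => [|S1 S2 [mS1 S10] [mS2 S20]|j _]; last by split.
    by rewrite measure0.
  by split; [exact: measurableU|rewrite measureU0].
rewrite -EFin_Rintegral//; last exact: (integrable_subordinated n0 mY Y0 momY m0 cF bF t0).
apply: (eq_integral_off_null mN N0) => w Nw.
rewrite -/(rt t) YE /Z; congr (Fnu _ x)%:E; apply: eq_bigr => j _.
rewrite /posval; case: ltP => // Gj; exfalso; apply: Nw.
by rewrite /Nul (bigD1 j)//=; left; rewrite /A/= in_itv.
Qed.
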